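(* The reachability problem for VASS with three $\mathbb{N}$-counters and an arbitrary number of $\mathbb{Z}$-counters, with all numbers encoded in unary, is $\mathsf{TOWER}$-hard.
   Context: A VASS with $d$ $\mathbb{N}$-counters and $k$ $\mathbb{Z}$-counters consists of a finite set $Q$ of states and a finite set $T\subseteq Q\times\mathbb{Z}^{d+k}\times Q$ of transitions. A configuration is $p(\mathbf{u})$ with $p\in Q$, $\mathbf{u}\in\mathbb{N}^d\times\mathbb{Z}^k$. A transition $(p,\mathbf{v},q)$ can be fired from $p(\mathbf{u})$, leading to $q(\mathbf{u}+\mathbf{v})$, provided the first $d$ coordinates of $\mathbf{u}+\mathbf{v}$ are nonnegative. The reachability problem asks, given $k$, such a VASS (here $d=3$) and two configurations $s,t$, whether there is a run from $s$ to $t$. $\mathsf{TOWER}$ is the class $\mathcal{F}_3$ of the fast-growing hierarchy: problems decidable in deterministic time $\mathrm{Tower}(f(n))$ for some $f$ computable in time $2^{2^{\cdots^{n}}}$ with a fixed number of exponentials, where $\mathrm{Tower}(n)$ is a tower of $n$ twos. *)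

(* Defs.v *)
From mathcomp Require Import all_boot all_algebra.
From Stdlib Require Import Relations.
Set Implicit Arguments. Unset Strict Implicit. Unset Printing Implicit Defensive.
Import GRing.Theory Num.Theory.

(*    input alphabet {0,1} (bool), tape alphabet option bool (None=blank) *)

Record TM := {
  tm_n : nat;
  tm_delta : 'I_tm_n.+1 -> option bool ->
             option ('I_tm_n.+1 * option bool * bool); (* bool: true = move right *)
  tm_acc : 'I_tm_n.+1                           (* accepting state; start = ord0 *)
}.

Record config (M : TM) := Config {
  c_state : 'I_(tm_n M).+1;
  c_left  : seq (option bool);  (* cells left of the head, nearest first *)
  c_cur   : option bool;
  c_right : seq (option bool)   (* cells right of the head, nearest first *)
}.
Arguments Config {M}.

Definition tm_step (M : TM) (c : config M) : option (config M) :=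
  match @tm_delta M (c_state c) (c_cur c) with
  | None => None
  | Some (s', w, true) =>
      Some (Config s' (w :: c_left c) (head None (c_right c)) (behead (c_right c)))
  | Some (s', w, false) =>
      Some (Config s' (behead (c_left c)) (head None (c_left c)) (w :: c_right c))
  end.

Fixpoint tm_steps (M : TM) (t : nat) (c : config M) : option (config M) :=
  match t with
  | 0 => Some c
  | t'.+1 => match tm_steps t' c with Some c' => tm_step c' | None => None end
  end.

Definition tm_init (M : TM) (w : seq bool) : config M :=
  @Config M ord0 [::] (head None (map Some w)) (behead (map Some w)).

Fixpoint tape_out (s : seq (option bool)) : seq bool :=
  match s with Some b :: s' => b :: tape_out s' | _ => [::] end.

Definition tm_output (M : TM) (c : config M) : seq bool := tape_out (c_cur c :: c_right c).

Definition decides_in (M : TM) (L : seq bool -> Prop) (T : nat -> nat) : Prop :=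
  forall w, exists t c, t <= T (size w) /\ tm_steps t (tm_init M w) = Some c /\
    tm_step c = None /\ (L w <-> c_state c = @tm_acc M).

Definition computes_in (M : TM) (f : seq bool -> seq bool) (T : nat -> nat) : Prop :=
  forall w, exists t c, t <= T (size w) /\ tm_steps t (tm_init M w) = Some c /\
    tm_step c = None /\ tm_output c = f w.

Definition exp_iter (k n : nat) : nat := iter k (fun m => 2 ^ m) n.
Definition Tower (n : nat) : nat := iter n (fun m => 2 ^ m) 1.

Definition elementary_fun (f : seq bool -> seq bool) : Prop :=
  exists M k, computes_in M f (exp_iter k).

Definition in_TOWER (L : seq bool -> Prop) : Prop :=
  exists g : nat -> nat,
    elementary_fun (fun w => nseq (g (size w)) true) /\
    exists M, decides_in M L (fun n => Tower (g n)).

Definition TOWER_hard (P : seq bool -> Prop) : Prop :=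
  forall L, in_TOWER L ->
    exists r, elementary_fun r /\ forall w, L w <-> P (r w).

Record vass_inst := VassInst {
  v_k : nat;                                   (* number of Z-counters *)
  v_trans : seq (nat * seq int * nat);
  v_src : nat * seq int;
  v_tgt : nat * seq int
}.

Definition nonneg_first (d : nat) (u : seq int) : bool :=
  all (fun z : int => (0 <= z)%R) (take d u).

Definition vass_wf (d : nat) (I : vass_inst) : bool :=
  all (fun t => size t.1.2 == d + v_k I) (v_trans I) &&
  (size (v_src I).2 == d + v_k I) && (size (v_tgt I).2 == d + v_k I) &&
  nonneg_first d (v_src I).2 && nonneg_first d (v_tgt I).2.

Definition vadd (u v : seq int) : seq int := [seq (x.1 + x.2)%R | x <- zip u v].

Definition vass_step (d : nat) (I : vass_inst) (c c' : nat * seq int) : Prop :=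
  exists t, t \in v_trans I /\ c.1 = t.1.1 /\ c' = (t.2, vadd c.2 t.1.2) /\
    nonneg_first d (vadd c.2 t.1.2).

Definition vass_reach (d : nat) (I : vass_inst) : Prop :=
  clos_refl_trans_1n _ (vass_step d I) (v_src I) (v_tgt I).

Definition sONE : seq bool := [:: true; true].
Definition sSEP : seq bool := [:: true; false].
Definition sNEG : seq bool := [:: false; true].
Definition sEND : seq bool := [:: false; false].

Definition enc_nat (n : nat) : seq bool := flatten (nseq n sONE) ++ sSEP.
Definition enc_int (z : int) : seq bool :=
  match z with Posz n => enc_nat n | Negz n => sNEG ++ enc_nat n.+1 end.
Definition enc_vec (v : seq int) : seq bool := flatten (map enc_int v) ++ sEND.
Definition enc_trans (t : nat * seq int * nat) : seq bool :=
  enc_nat t.1.1 ++ enc_vec t.1.2 ++ enc_nat t.2.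
Definition enc_inst (I : vass_inst) : seq bool :=
  enc_nat (v_k I) ++ flatten (map enc_trans (v_trans I)) ++ sEND ++
  enc_nat (v_src I).1 ++ enc_vec (v_src I).2 ++
  enc_nat (v_tgt I).1 ++ enc_vec (v_tgt I).2.

Definition VASS_reach_unary (d : nat) (w : seq bool) : Prop :=
  exists I, vass_wf d I /\ enc_inst I = w /\ vass_reach d I.

(* Main.v *)
Require Import Defs.
From HB Require Import structures.
From mathcomp Require Import all_boot all_algebra zify.
From Stdlib Require Import Relations FunctionalExtensionality.
Set Implicit Arguments. Unset Strict Implicit. Unset Printing Implicit Defensive.
Import GRing.Theory Num.Theory.

(* While a mode of the VASS runs, the sum m of the N-counters x, y, z is constant.  A round
   turns x = q k + r, y = 0 into x = p k + r', y = 0, and its three loops pay for it out of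
   a Z-counter d: at most 2 m in all, and exactly 2 m only when the loops are run to their
   end.  So if d starts at 2 m T and t at T, if each round takes 1 off t, and if d = t = 0
   at the end, then there were T rounds, each of them exact.
   A level turns such a triple (m, T, 2 m T) into another one: with T = 2 R + 2 it doubles a
   guessed N' and the number 1, R times each, and outputs T' = 4 * 2^R and 2 T' N' from the
   results.  After l levels there is room for Tower(l) exact rounds of an arbitrary program
   of instructions x = q k + r |-> x = p k + r', and such a program simulates a Turing
   machine, with its tape coded by x = 2^a 3^b.  Each level works on Z-counters of its own,
   so a run between the given configurations has every one of them equal to 0 when its level
   is left.  The number l of levels is an iterated exponential of the size of the input. *)

(** * Exact rounds *)

(** No transition can test a Z-counter; the target configuration tests all of them, once, at the
    end. The proof therefore follows a quantity, the slack of the budget, that is never negative,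
    that no transition lowers and that every inexact loop raises: if it is 0 at the end, every round
    was exact. The counter z makes the price of a round independent of x: it holds what x and y lack
    of the sum m. A product 2 m T cannot be guessed by adding constants unless T is itself a
    constant, so the chain starts from T = 4. In the later triples N' is guessed freely, and the
    product is obtained by doubling; a counter r compares the numbers of doublings of N' and of 1,
    and the two remaining rounds of T = 2 R + 2 are zero tests of x. Soundness does not depend on R,
    since any number of exact rounds is faithful; only completeness counts them. Hardness asks for a
    Turing machine that computes the reduction. It is obtained by compiling a small register
    language with loops. *)

Notation tmpl := (nat * seq int * nat)%type.

(* x, y, z: the N-counters; n, d, t, r, e: block of the current level, where n is the stock
   loaded into z, d the budget, t the rounds left, r the balance of the doublings, and e the sum
   x + y + z to be unloaded; n', d', t': block of the next level. *)
Definition eff (x y z n d t r e n' d' t' : int) : seq int :=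
  [:: x; y; z; n; d; t; r; e; n'; d'; t'; 0%R; 0%R].

Definition eff0 : seq int := eff 0 0 0 0 0 0 0 0 0 0 0.

Definition lstep (ts : seq tmpl) (c c' : nat * seq int) : Prop :=
  exists t, t \in ts /\ c.1 = t.1.1 /\ c' = (t.2, vadd c.2 t.1.2) /\
    nonneg_first 3 (vadd c.2 t.1.2).

(* From state [ri_src] to [ri_tgt]: x = q k + r becomes x = p k + r'. *)
Record rinstr := RI {
  ri_src : nat; ri_q : nat; ri_p : nat; ri_r : nat; ri_r' : nat;
  ri_dr : int; ri_tgt : nat }.

Definition ri0 := RI 0 0 0 0 0 0 0.

Section Gadget.
Local Open Scope ring_scope.

(** The three paid loops move y to x, z to y, and y to z. A unit costs 2 on its way from y to x, and
    1 + 1 if it starts in z; a unit still in x when the first paid loop starts costs nothing, and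
    one left behind in y costs only 1. So the full price 2 (x + y + z) is reached only if the two
    free transitions before have emptied x, which means that x had the form q k + r. *)
Definition gadget (b : nat) (i : rinstr) : seq tmpl :=
  [:: (ri_src i, eff0, b);
      (b, eff (- (ri_q i)%:Z) (ri_p i)%:Z ((ri_q i)%:Z - (ri_p i)%:Z) 0 0 0 0 0 0 0 0, b);
      (b, eff (- (ri_r i)%:Z) (ri_r' i)%:Z ((ri_r i)%:Z - (ri_r' i)%:Z) 0 0 0 0 0 0 0 0, b.+1);
      (b.+1, eff 1 (-1) 0 0 (-2) 0 0 0 0 0 0, b.+1);
      (b.+1, eff0, b.+2);
      (b.+2, eff 0 1 (-1) 0 (-1) 0 0 0 0 0 0, b.+2);
      (b.+2, eff0, b.+3);
      (b.+3, eff 0 (-1) 1 0 (-1) 0 0 0 0 0 0, b.+3);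
      (b.+3, eff 0 0 0 0 0 (-1) (ri_dr i) 0 0 0 0, ri_tgt i)].

Definition gadgets (base : nat) (ins : seq rinstr) : seq tmpl :=
  flatten [seq gadget (base + 4 * j) (nth ri0 ins j) | j <- iota 0 (size ins)].

Lemma gadgetsP base ins t : t \in gadgets base ins ->
  exists2 j, (j < size ins)%N & t \in gadget (base + 4 * j) (nth ri0 ins j).
Proof.
move/flattenP => [s /mapP [j]]; rewrite mem_iota add0n => /= jlt -> tin.
by exists j.
Qed.

Lemma mem_gadgets base ins j t : (j < size ins)%N ->
  t \in gadget (base + 4 * j) (nth ri0 ins j) -> t \in gadgets base ins.
Proof.
move=> jlt tin; apply/flattenP; exists (gadget (base + 4 * j) (nth ri0 ins j)) => //.
by apply/mapP; exists j => //; rewrite mem_iota add0n.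
Qed.

End Gadget.

(** * The invariant of a mode: inexact rounds leave a slack *)

Section ModeInvariant.
Local Open Scope ring_scope.
(** [E] describes what exact rounds can produce in each control state; [Pt] records what is known
    about the number of rounds t while z is being loaded. *)
Variables (E : nat -> int -> int -> int -> int -> int -> Prop).
Variables (ins : seq rinstr) (U : nat) (Pt : int -> Prop).

(* [s] is the part of the budget d that exact rounds would leave over; the execution
   described by [P] is forced when nothing is left. *)
Definition slack (s : int) (P : Prop) := 0 <= s /\ (s = 0 -> P).

Let base := U.+1.
Let I j := nth ri0 ins j.

(* State 0 loads z, the states 1..U are the control states, and the instruction j uses the four
   states from U + 1 + 4 j on.  k is the share of the budget d that came with a stock n left unloaded. *)
Inductive mode_inv : nat -> seq int -> Prop :=
| MILoad z n d t : 0 <= z -> d = 2 * t * (n + z) -> Pt t ->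
    mode_inv 0 (eff 0 0 z n d t 0 z 0 0 0)
| MIMain q x y z n d t r e n' d' t' k m :
    (0 < q <= U)%N -> 0 <= x -> 0 <= y -> 0 <= z -> (n = 0 -> k = 0) ->
    x + y + z = e -> ((q < U)%N -> m = e) ->
    slack (d - k - 2 * m * t) (y = 0 /\ E q x r n' d' t') ->
    mode_inv q (eff x y z n d t r e n' d' t')
| MIPh0 j x y z n d t r e n' d' t' k :
    (j < size ins)%N -> 0 <= x -> 0 <= y -> 0 <= z -> (n = 0 -> k = 0) ->
    x + y + z = e ->
    slack (d - k - 2 * e * t) (exists i : nat,
      y = (ri_p (I j))%:Z * i%:Z /\ E (ri_src (I j)) (x + (ri_q (I j))%:Z * i%:Z) r n' d' t') ->
    mode_inv (base + 4 * j) (eff x y z n d t r e n' d' t')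
| MIPh1 j x y z n d t r e n' d' t' k :
    (j < size ins)%N -> 0 <= x -> 0 <= y -> 0 <= z -> (n = 0 -> k = 0) ->
    x + y + z = e ->
    slack (d - k - 2 * e * (t - 1) - 2 * (y + z))
      (E (ri_tgt (I j)) (x + y) (r + ri_dr (I j)) n' d' t') ->
    mode_inv (base + 4 * j).+1 (eff x y z n d t r e n' d' t')
| MIPh2 j x y z n d t r e n' d' t' k :
    (j < size ins)%N -> 0 <= x -> 0 <= y -> 0 <= z -> (n = 0 -> k = 0) ->
    x + y + z = e ->
    slack (d - k - 2 * e * (t - 1) - (y + 2 * z))
      (E (ri_tgt (I j)) x (r + ri_dr (I j)) n' d' t') ->
    mode_inv (base + 4 * j).+2 (eff x y z n d t r e n' d' t')
| MIPh3 j x y z n d t r e n' d' t' k :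
    (j < size ins)%N -> 0 <= x -> 0 <= y -> 0 <= z -> (n = 0 -> k = 0) ->
    x + y + z = e ->
    slack (d - k - 2 * e * (t - 1) - y)
      (E (ri_tgt (I j)) x (r + ri_dr (I j)) n' d' t') ->
    mode_inv (base + 4 * j).+3 (eff x y z n d t r e n' d' t').

Hypothesis insP : forall j, (j < size ins)%N ->
  [/\ (0 < ri_src (I j) < U)%N, (0 < ri_tgt (I j) <= U)%N &
  forall (i : nat) r n' d' t',
    E (ri_src (I j)) ((ri_q (I j))%:Z * i%:Z + (ri_r (I j))%:Z) r n' d' t' ->
    E (ri_tgt (I j)) ((ri_p (I j))%:Z * i%:Z + (ri_r' (I j))%:Z) (r + ri_dr (I j)) n' d' t'].

Lemma nonneg3 x y z s :
  nonneg_first 3 [:: x, y, z & s] -> [/\ 0 <= x, 0 <= y & 0 <= z].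
Proof. by rewrite /nonneg_first /= take0 /= andbT => /and3P. Qed.

(** The form in which every transition is checked: it may raise the slack, and only if it keeps the
    slack must it be exact. As the slack never goes down again, an inexact step cannot be repaired
    later. *)
Lemma slack_le s s' P P' : slack s P -> s <= s' -> (s' = s -> P -> P') -> slack s' P'.
Proof.
move=> [s0 sP] le H; split; first by lia.
move=> s'0; have e : s' = s by lia.
by apply: H => //; apply: sP; lia.
Qed.

Lemma mode_main q v : (0 < q <= U)%N -> mode_inv q v ->
  exists x y z n d t r e n' d' t' k m,
  [/\ v = eff x y z n d t r e n' d' t', [/\ 0 <= x, 0 <= y & 0 <= z],
    (n = 0 -> k = 0) /\ ((q < U)%N -> m = e), x + y + z = e &
    slack (d - k - 2 * m * t) (y = 0 /\ E q x r n' d' t')].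
Proof.
move=> qU H; case: H qU; rewrite /base; try (intros; lia).
move=> q' x y z n d t r e n' d' t' k m _ x0 y0 z0 nk xyz me sl _.
by exists x, y, z, n, d, t, r, e, n', d', t', k, m.
Qed.

(** The amounts 2 (y + z), y + 2 z and y that the last three phases subtract are the most that the
    rest of the round can still take from d. Each transition takes at most what this potential
    loses, so the slack does not decrease. *)
Lemma mode_gadget j tau v : (j < size ins)%N -> tau \in gadget (base + 4 * j) (I j) ->
  mode_inv tau.1.1 v -> nonneg_first 3 (vadd v tau.1.2) ->
  mode_inv tau.2 (vadd v tau.1.2).
Proof.
move=> jlt; have [srcU tgtU Ej] := insP jlt.
rewrite !inE => tin; repeat case/orP: tin => [/eqP -> /=|tin].
- move=> /mode_main; case; first by lia.
  move=> x [y] [z] [n] [d] [t] [r] [e] [n'] [d'] [t'] [k] [m] [-> [x0 y0 z0] [nk me] xyz sl] nn.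
  rewrite /vadd /= !addr0; apply: (@MIPh0 j) nk xyz _ => //.
  have em : m = e by apply: me; lia.
  apply: slack_le sl _ _; rewrite em // => _ [yz EE]; exists 0%N.
  by rewrite yz !mulr0 !addr0.
- move Eq: (base + 4 * j)%N => q H; case: H Eq; rewrite /base; try (intros; lia).
  move=> i x y z n d t r e n' d' t' k ilt x0 y0 z0 nk xyz sl eqi; have ? : i = j by [lia]; subst i.
  rewrite /vadd /= !addr0 => /nonneg3 [x' y' z'].
  apply: (@MIPh0 j) nk _ _ => //; first by lia.
  apply: slack_le sl _ _; rewrite // => _ [i [yi EE]]; exists i.+1; split; first by lia.
  by rewrite [X in E _ X](_ : _ = x + (ri_q (I j))%:Z * i%:Z); [|lia].
- move Eq: (base + 4 * j)%N => q H; case: H Eq; rewrite /base; try (intros; lia).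
  move=> i x y z n d t r e n' d' t' k ilt x0 y0 z0 nk xyz sl eqi; have ? : i = j by [lia]; subst i.
  rewrite /vadd /= !addr0 => /nonneg3 [x' y' z'].
  apply: (@MIPh1 j) nk _ _ => //; first by lia.
  apply: slack_le sl _ _; first by lia.
  move=> eqs [i [yi EE]].
  (* The slack grows by twice what remains in x, so keeping it forces x to be exactly the
     remainder. *)
  have xr : x = (ri_r (I j))%:Z by lia.
  rewrite [X in E _ X](_ : _ = (ri_p (I j))%:Z * i%:Z + (ri_r' (I j))%:Z); last by lia.
  by apply: Ej; rewrite addrC -xr.
- move Eq: (base + 4 * j).+1%N => q H; case: H Eq; rewrite /base; try (intros; lia).
  move=> i x y z n d t r e n' d' t' k ilt x0 y0 z0 nk xyz sl eqi; have ? : i = j by [lia]; subst i.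
  rewrite /vadd /= !addr0 => /nonneg3 [x' y' z'].
  apply: (@MIPh1 j) nk _ _ => //; first by lia.
  apply: slack_le sl _ _; first by lia.
  by move=> _; rewrite (_ : x + 1 + (y - 1) = x + y); last by lia.
- move Eq: (base + 4 * j).+1%N => q H; case: H Eq; rewrite /base; try (intros; lia).
  move=> i x y z n d t r e n' d' t' k ilt x0 y0 z0 nk xyz sl eqi; have ? : i = j by [lia]; subst i.
  rewrite /vadd /= !addr0 => _.
  apply: (@MIPh2 j) nk _ _ => //.
  apply: slack_le sl _ _; first by lia.
  by move=> eqs; rewrite (_ : y = 0) ?addr0; last by lia.
- move Eq: (base + 4 * j).+2%N => q H; case: H Eq; rewrite /base; try (intros; lia).
  move=> i x y z n d t r e n' d' t' k ilt x0 y0 z0 nk xyz sl eqi; have ? : i = j by [lia]; subst i.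
  rewrite /vadd /= !addr0 => /nonneg3 [x' y' z'].
  apply: (@MIPh2 j) nk _ _ => //; first by lia.
  by apply: slack_le sl _ _; first by lia.
- move Eq: (base + 4 * j).+2%N => q H; case: H Eq; rewrite /base; try (intros; lia).
  move=> i x y z n d t r e n' d' t' k ilt x0 y0 z0 nk xyz sl eqi; have ? : i = j by [lia]; subst i.
  rewrite /vadd /= !addr0 => _.
  apply: (@MIPh3 j) nk _ _ => //.
  by apply: slack_le sl _ _; first by lia.
- move Eq: (base + 4 * j).+3%N => q H; case: H Eq; rewrite /base; try (intros; lia).
  move=> i x y z n d t r e n' d' t' k ilt x0 y0 z0 nk xyz sl eqi; have ? : i = j by [lia]; subst i.
  rewrite /vadd /= !addr0 => /nonneg3 [x' y' z'].
  apply: (@MIPh3 j) nk _ _ => //; first by lia.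
  by apply: slack_le sl _ _; first by lia.
move/eqP: tin => -> /=.
move Eq: (base + 4 * j).+3%N => q H; case: H Eq; rewrite /base; try (intros; lia).
move=> i x y z n d t r e n' d' t' k ilt x0 y0 z0 nk xyz sl eqi.
have ? : i = j by [lia]; subst i.
rewrite /vadd /= !addr0 => _.
apply: (@MIMain _ _ _ _ _ _ _ _ _ _ _ _ k e) => //.
apply: slack_le sl _ _; first by lia.
by move=> eqs EE; split; first by lia.
Qed.

Lemma mode_load v : mode_inv 0 v ->
  exists z n d t, [/\ v = eff 0 0 z n d t 0 z 0 0 0, 0 <= z, d = 2 * t * (n + z) & Pt t].
Proof.
move=> H; move Eq: 0%N H => q H; case: H Eq; rewrite /base; try (intros; lia).
by move=> z n d t z0 dE Pt' _; exists z, n, d, t.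
Qed.

Lemma mode_load_loop v : mode_inv 0 v ->
  nonneg_first 3 (vadd v (eff 0 0 1 (-1) 0 0 0 1 0 0 0)) ->
  mode_inv 0 (vadd v (eff 0 0 1 (-1) 0 0 0 1 0 0 0)).
Proof.
move=> /mode_load [z [n [d [t [-> z0 dE Pt']]]]]; rewrite /vadd /= !addr0 ?add0r => _.
by apply: MILoad => //; lia.
Qed.

(** The transition adds the fixed amount 2 t0 to d for each guessed unit of n, so t must be known in
    advance. *)
Lemma mode_load_guess (t0 : int) v : (forall t, Pt t -> t = t0) -> mode_inv 0 v ->
  mode_inv 0 (vadd v (eff 0 0 0 1 (2 * t0) 0 0 0 0 0 0)).
Proof.
move=> Pt0 /mode_load [z [n [d [t [-> z0 dE Pt']]]]]; rewrite /vadd /= !addr0 ?add0r.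
by apply: MILoad => //; rewrite -(Pt0 _ Pt'); lia.
Qed.

Lemma mode_start v : (0 < U)%N -> E 1 0 0 0 0 0 -> mode_inv 0 v -> mode_inv 1 (vadd v eff0).
Proof.
move=> U0 E1 /mode_load [z [n [d [t [-> z0 dE Pt']]]]]; rewrite /vadd /= !addr0 ?add0r.
(* The budget splits into 2 t z for the z units actually loaded and k = 2 t n for the stock left in
   n. *)
apply: (@MIMain _ _ _ _ _ _ _ _ _ _ _ _ (2 * t * n) z) => //; try lia.
by split; [lia | split].
Qed.

Lemma mode_plain q q' e v : (0 < q < U)%N -> (0 < q' <= U)%N ->
  mode_inv q v -> nonneg_first 3 (vadd v e) ->
  (exists dx dn' dd' dt', e = eff dx 0 (- dx) 0 0 0 0 0 dn' dd' dt' /\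
    forall x r n' d' t', E q x r n' d' t' ->
      E q' (x + dx) r (n' + dn') (d' + dd') (t' + dt')) ->
  mode_inv q' (vadd v e).
Proof.
move=> qU q'U /mode_main []; first by lia.
move=> x [y] [z] [n] [d] [t] [r] [e'] [n'] [d'] [t'] [k] [m] [-> [x0 y0 z0] [nk me] xyz sl] nn.
case=> dx [dn'] [dd'] [dt'] [ee EE]; subst e; move: nn.
rewrite /vadd /= !addr0 => /nonneg3 [x' y' z'].
apply: (@MIMain _ _ _ _ _ _ _ _ _ _ _ _ k m) => //; first by lia.
  by move=> _; apply: me; lia.
by apply: slack_le sl _ _ => // _ [-> EX]; split=> //; apply: EE.
Qed.

(** While e goes down to 0, m keeps the value that the sum had during the rounds; this is why
    [MIMain] ties m to e only for q < U. *)
Lemma mode_unload dx dz v : (0 < U)%N -> mode_inv U v ->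
  nonneg_first 3 (vadd v (eff dx 0 dz 0 0 0 0 (dx + dz) 0 0 0)) ->
  (dx <> 0 -> forall x r n' d' t', E U x r n' d' t' -> E U (x + dx) r n' d' t') ->
  mode_inv U (vadd v (eff dx 0 dz 0 0 0 0 (dx + dz) 0 0 0)).
Proof.
move=> U0 /mode_main []; first by lia.
move=> x [y] [z] [n] [d] [t] [r] [e'] [n'] [d'] [t'] [k] [m] [-> [x0 y0 z0] [nk me] xyz sl].
rewrite /vadd /= !addr0 => /nonneg3 [x' y' z'] EE.
apply: (@MIMain _ _ _ _ _ _ _ _ _ _ _ _ k m) => //; try lia.
apply: slack_le sl _ _ => // _ [-> EX]; split=> //.
have [->|/eqP dx0] := eqVneq dx 0; first by rewrite addr0.
exact: EE.
Qed.

(** With n = 0 the share k vanishes, and d = t = 0 then makes the slack 0 whatever m is. With e = 0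
    the three nonnegative counters are empty. *)
Lemma mode_final v : (0 < U)%N -> mode_inv U v ->
  (forall k, (3 <= k < 8)%N -> nth 0 v k = 0) ->
  exists x y z n' d' t', [/\ v = eff x y z 0 0 0 0 0 n' d' t',
    [/\ 0 <= x, 0 <= z & x + z = 0], y = 0 & E U x 0 n' d' t'].
Proof.
move=> U0 /mode_main []; first by lia.
move=> x [y] [z] [n] [d] [t] [r] [e'] [n'] [d'] [t'] [k] [m] [-> [x0 y0 z0] [nk me] xyz sl] H.
have /= n0 := H 3 erefl; have /= d0 := H 4 erefl; have /= t0 := H 5 erefl.
have /= r0 := H 6 erefl; have /= e0 := H 7 erefl.
have k0 := nk n0; rewrite n0 d0 t0 r0 e0 k0 in xyz sl *.
exists x, y, z, n', d', t'; case: sl => _ [|y00 EE]; first by lia.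
by split=> //; split=> //; lia.
Qed.

End ModeInvariant.

(** * Levels *)

Section Level.
Local Open Scope ring_scope.

(** The counter r goes up with the doublings in state 2 and down with those in state 4. The other
    two instructions, with q = r = 0, are zero tests of x: the first leaves x = 1 for the second
    series of doublings. *)
Definition level_ins : seq rinstr :=
  [:: RI 2 1 2 0 0 1 2; RI 3 0 0 0 1 0 4; RI 4 1 2 0 0 (-1) 4; RI 5 0 0 0 0 0 6].

(* 0: load z; 1: guess x = n'; 2: double x; 3: output d' = 8 x; 4: double x, starting from 1;
   5: output t' = 4 x; 6: unload z. *)
Definition level_plain : seq tmpl :=
  [:: (0%N, eff 0 0 1 (-1) 0 0 0 1 0 0 0, 0%N);
      (0%N, eff0, 1%N);
      (1%N, eff 1 0 (-1) 0 0 0 0 0 1 0 0, 1%N);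
      (1%N, eff0, 2%N);
      (2%N, eff0, 3%N);
      (3%N, eff (-1) 0 1 0 0 0 0 0 0 8 0, 3%N);
      (4%N, eff0, 5%N);
      (5%N, eff (-1) 0 1 0 0 0 0 0 0 0 4, 5%N);
      (6%N, eff 0 0 (-1) 0 0 0 0 (-1) 0 0 0, 6%N)].

Definition level_in : seq tmpl := level_plain ++ gadgets 7 level_ins.

(** Seven control states and four for each of the four instructions; state 23 of a level is state 0
    of the next one. *)
Definition level_states : nat := 23.

Definition level_t : seq tmpl := rcons level_in (6%N, eff0, level_states).

(** Level 0 starts with t = 4, so each unit of n comes with 2 * 4 units of d. *)
Definition init_t : seq tmpl := [:: (0%N, eff 0 0 0 1 8 0 0 0 0 0 0, 0%N)].

Definition level_exact (q : nat) (x r n' d' t' : int) : Prop :=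
  match q with
  | 1 => [/\ x = n', r = 0, d' = 0 & t' = 0]
  | 2 => exists R : nat, [/\ x = 2 ^+ R * n', r = R%:Z, d' = 0 & t' = 0]
  | 3 => exists R : nat, [/\ 8 * x + d' = 8 * 2 ^+ R * n', r = R%:Z & t' = 0]
  | 4 => exists R S : nat, [/\ x = 2 ^+ S, r = R%:Z - S%:Z, d' = 8 * 2 ^+ R * n' & t' = 0]
  | 5 => exists R S : nat, [/\ 4 * x + t' = 4 * 2 ^+ S, r = R%:Z - S%:Z & d' = 8 * 2 ^+ R * n']
  | _ => exists R S : nat,
           [/\ x = 0, r = R%:Z - S%:Z, d' = 8 * 2 ^+ R * n' & t' = 4 * 2 ^+ S]
  end.

Lemma level_insP j : (j < size level_ins)%N ->
  let I := nth ri0 level_ins j in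
  [/\ (0 < ri_src I < 6)%N, (0 < ri_tgt I <= 6)%N &
  forall (i : nat) r n' d' t',
    level_exact (ri_src I) ((ri_q I)%:Z * i%:Z + (ri_r I)%:Z) r n' d' t' ->
    level_exact (ri_tgt I) ((ri_p I)%:Z * i%:Z + (ri_r' I)%:Z) (r + ri_dr I) n' d' t'].
Proof.
case: j => [|[|[|[|j]]]] //= _; split=> // i r n' d' t'.
- case=> R [xE -> -> ->]; exists R.+1; split=> //; last by lia.
  by rewrite exprS; lia.
- case=> R [xE -> ->]; exists R, 0%N; split=> //; lia.
- case=> R [S] [xE -> -> ->]; exists R, S.+1; split=> //; last by lia.
  by rewrite exprS; lia.
- case=> R [S] [xE -> ->]; exists R, S; split=> //; lia.
Qed.

Definition level_inv := mode_inv level_exact level_ins 6.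

Lemma level_in_step Pt tau v : tau \in level_in -> level_inv Pt tau.1.1 v ->
  nonneg_first 3 (vadd v tau.1.2) -> level_inv Pt tau.2 (vadd v tau.1.2).
Proof.
rewrite mem_cat => /orP[|/gadgetsP [j jlt tin]]; last first.
  exact: (mode_gadget level_insP) jlt tin.
rewrite !inE => tin H nn; move: H nn; repeat case/orP: tin => [/eqP -> /=|tin].
- exact: mode_load_loop.
- by move=> H _; apply: mode_start H.
- move=> H nn; apply: mode_plain H nn _ => //; exists 1, 1, 0, 0; split=> //=.
  by move=> x r n' d' t' [-> -> -> ->]; rewrite addr0.
- move=> H nn; apply: mode_plain H nn _ => //; exists 0, 0, 0, 0; split=> //=.
  by move=> x r n' d' t' [-> -> -> ->]; exists 0%N; rewrite !addr0 expr0 mul1r.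
- move=> H nn; apply: mode_plain H nn _ => //; exists 0, 0, 0, 0; split=> //=.
  by move=> x r n' d' t' [R] [-> -> -> ->]; exists R; rewrite !addr0 mulrA.
- move=> H nn; apply: mode_plain H nn _ => //; exists (-1), 0, 8, 0; split=> //=.
  by move=> x r n' d' t' [R] [xE -> ->]; exists R; rewrite !addr0; split=> //; lia.
- move=> H nn; apply: mode_plain H nn _ => //; exists 0, 0, 0, 0; split=> //=.
  by move=> x r n' d' t' [R] [S] [-> -> -> ->]; exists R, S; rewrite !addr0.
- move=> H nn; apply: mode_plain H nn _ => //; exists (-1), 0, 0, 4; split=> //=.
  by move=> x r n' d' t' [R] [S] [xE -> ->]; exists R, S; rewrite !addr0; split=> //; lia.
- move/eqP: tin => -> /= H nn.
  by apply: (@mode_unload _ _ 6 _ 0 (-1)).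
Qed.

(** r = 0 gives R = S, and then d' = 2 t' n' whatever R is. This is all that the next level assumes,
    so the number of rounds need not be determined for soundness. *)
Lemma level_exit Pt v : level_inv Pt 6 v ->
  (forall k, (3 <= k < 8)%N -> nth 0 v k = 0) ->
  exists n' d' t', v = eff 0 0 0 0 0 0 0 0 n' d' t' /\ d' = 2 * t' * n'.
Proof.
move=> H z; have [x [y [z' [n' [d' [t' [-> [_ _ xz] -> /= EE]]]]]]] := mode_final (U:=6) isT H z.
case: EE => R [S] [x0 RS -> ->].
have -> : z' = 0 by lia.
rewrite x0; exists n', (8 * 2 ^+ R * n'), (4 * 2 ^+ S); split=> //.
have -> : R = S by lia.
by lia.
Qed.

End Level.

(** * The last mode: an arithmetic program run by exact rounds *)

Inductive crun (P : seq rinstr) (c : nat * nat) : nat -> nat * nat -> Prop :=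
| crun0 : crun P c 0 c
| crunS m c' j k : crun P c m c' -> j < size P ->
    c' = (ri_src (nth ri0 P j), ri_q (nth ri0 P j) * k + ri_r (nth ri0 P j)) ->
    crun P c m.+1 (ri_tgt (nth ri0 P j), ri_p (nth ri0 P j) * k + ri_r' (nth ri0 P j)).

Section Final.
Local Open Scope ring_scope.
Variables (P : seq rinstr) (S start acc : nat).

Definition shift_ri (i : rinstr) :=
  RI (2 + ri_src i) (ri_q i) (ri_p i) (ri_r i) (ri_r' i) 0 (2 + ri_tgt i).

(** The first instruction loads the input X from x = 0. The second one changes nothing and spends,
    in the accepting state, the rounds that the run of [P] leaves over. *)
Definition final_ins (X : nat) : seq rinstr :=
  [:: RI 1 0 0 0 X 0 (2 + start), RI (2 + acc) 1 1 0 0 0 (2 + acc) & map shift_ri P].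

Definition final_U : nat := (2 + S)%N.

Definition final_plain : seq tmpl :=
  [:: (0%N, eff 0 0 1 (-1) 0 0 0 1 0 0 0, 0%N);
      (0%N, eff0, 1%N);
      ((2 + acc)%N, eff0, final_U);
      (final_U, eff (-1) 0 0 0 0 0 0 (-1) 0 0 0, final_U);
      (final_U, eff 0 0 (-1) 0 0 0 0 (-1) 0 0 0, final_U)].

Definition final_t (X : nat) : seq tmpl :=
  final_plain ++ gadgets final_U.+1 (final_ins X).

Hypothesis P_states : forall j, (j < size P)%N ->
  (ri_src (nth ri0 P j) < S)%N && (ri_tgt (nth ri0 P j) < S)%N.
Hypothesis start_S : (start < S)%N.
Hypothesis acc_S : (acc < S)%N.

Variable X0 : nat.

(** In the unloading state x is about to be destroyed, so only the existence of an accepting run is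
    remembered there. *)
Definition final_exact (q : nat) (x r n' d' t' : int) : Prop :=
  if q == 1%N then x = 0 else
  if q == final_U then exists m x, crun P (start, X0) m (acc, x) else
  exists m (n : nat), x = n%:Z /\ crun P (start, X0) m (q - 2, n)%N.

Lemma final_insP j : (j < size (final_ins X0))%N ->
  let I := nth ri0 (final_ins X0) j in
  [/\ (0 < ri_src I < final_U)%N, (0 < ri_tgt I <= final_U)%N &
  forall (i : nat) r n' d' t',
    final_exact (ri_src I) ((ri_q I)%:Z * i%:Z + (ri_r I)%:Z) r n' d' t' ->
    final_exact (ri_tgt I) ((ri_p I)%:Z * i%:Z + (ri_r' I)%:Z) (r + ri_dr I) n' d' t'].
Proof.
have U s : (s < S)%N -> ((2 + s)%N == final_U) = false by rewrite /final_U; lia.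
rewrite /final_exact; case: j => [_|[_|j]] /=.
- split; [by rewrite /final_U; lia..|] => i r n' d' t' _.
  rewrite U //; exists 0%N, X0; split; first by lia.
  by rewrite addKn; apply: crun0.
- split; [by rewrite /final_U; lia..|] => i r n' d' t'.
  by rewrite U.
rewrite !ltnS size_map => jlt; rewrite (nth_map ri0) //=.
have /andP[sS tS] := P_states jlt.
split; [by rewrite /final_U; lia..|] => i r n' d' t'.
rewrite !U // !addKn => -[m] [n] [xE run].
exists m.+1, (ri_p (nth ri0 P j) * i + ri_r' (nth ri0 P j))%N; split; first by lia.
by apply: (@crunS _ _ _ _ _ i run jlt); congr pair; lia.
Qed.

Definition final_inv := mode_inv final_exact (final_ins X0) final_U.

Lemma final_step Pt tau v : tau \in final_t X0 -> final_inv Pt tau.1.1 v ->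
  nonneg_first 3 (vadd v tau.1.2) -> final_inv Pt tau.2 (vadd v tau.1.2).
Proof.
rewrite mem_cat => /orP[|/gadgetsP [j jlt tin]]; last first.
  exact: (mode_gadget final_insP) jlt tin.
rewrite !inE => tin H nn; move: H nn; repeat case/orP: tin => [/eqP -> /=|tin].
- exact: mode_load_loop.
- by move=> H _; apply: mode_start H.
- move=> H nn; apply: mode_plain H nn _; [by rewrite /final_U; lia..|].
  exists 0, 0, 0, 0; split=> //= x r n' d' t'.
  rewrite /final_exact eqxx [(_ + _)%N == final_U]ltn_eqF ?ltn_add2l //= addKn.
  by case=> m [n] [_ run]; exists m, n.
- move=> H nn; apply: (@mode_unload _ _ final_U _ (-1) 0) => //.
  by move=> _ x r n' d' t'; rewrite /final_exact eqxx.
- move/eqP: tin => -> /= H nn.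
  by apply: (@mode_unload _ _ final_U _ 0 (-1)).
Qed.

Lemma final_exit Pt v : final_inv Pt final_U v ->
  (forall k, (3 <= k < 8)%N -> nth 0 v k = 0) ->
  exists m x, crun P (start, X0) m (acc, x).
Proof.
move=> H z; have [x [y [z' [n' [d' [t' [_ _ _]]]]]]] := mode_final (U:=final_U) isT H z.
by rewrite /final_exact eqxx.
Qed.

End Final.

(** * The reduction is sound *)

Section Global.
Local Open Scope ring_scope.

(* The two blocks of [v] become the blocks i and i + 1 of l + 2 blocks of five counters. *)
Definition embed (l i : nat) (v : seq int) : seq int :=
  take 3 v ++ nseq (5 * i) 0 ++ drop 3 v ++ nseq (5 * (l - i)) 0.

Definition lift_t (l i : nat) (t : tmpl) : tmpl :=
  ((i * level_states + t.1.1)%N, embed l i t.1.2, (i * level_states + t.2)%N).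

Definition start_vec : seq int := eff 0 0 0 0 0 4 0 0 0 0 0.

(** There are l levels and the last mode, and each acts on its own block and the following one;
    hence l + 2 blocks of five Z-counters. The zero target vector is the only test that these
    counters undergo. *)
Definition reduction_vass (P : seq rinstr) (S start acc l X : nat) : vass_inst :=
  VassInst (5 * (l + 2))
    (map (lift_t l 0) init_t ++
     flatten [seq map (lift_t l i) level_t | i <- iota 0 l] ++
     map (lift_t l l) (final_t P S start acc X))
    (0%N, embed l 0 start_vec)
    ((l * level_states + final_U S)%N, nseq (3 + 5 * (l + 2)) 0).

Lemma size_vadd u v : size u = size v -> size (vadd u v) = size u.
Proof. by move=> e; rewrite size_map size_zip e minnn. Qed.

Lemma vadd_cat a b c d : size a = size b -> vadd (a ++ c) (b ++ d) = vadd a b ++ vadd c d.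
Proof. by move=> e; rewrite /vadd zip_cat // map_cat. Qed.

Lemma vadd0 u n : n = size u -> vadd u (nseq n 0) = u.
Proof. by move=> ->; elim: u => //= x u IH; rewrite /vadd /= addr0 -/(vadd _ _) IH. Qed.

Lemma take_vadd n u v : take n (vadd u v) = vadd (take n u) (take n v).
Proof.
by rewrite /vadd -map_take; congr map; elim: n u v => [|n IH] [|x u] [|y v] //=; rewrite IH.
Qed.

Lemma drop_vadd n u v : size u = size v -> drop n (vadd u v) = vadd (drop n u) (drop n v).
Proof.
move=> suv; rewrite /vadd -map_drop; congr map.
by elim: n u v suv => [|n IH] [|x u] [|y v] //= [suv]; rewrite ?drop0 ?IH.
Qed.

Lemma embed_vadd l i v e : size v = 13%N -> size e = 13%N ->
  vadd (embed l i v) (embed l i e) = embed l i (vadd v e).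
Proof.
move=> sv se; rewrite /embed take_vadd drop_vadd ?sv ?se //.
rewrite !vadd_cat ?size_nseq ?size_take ?size_drop ?sv ?se //.
by rewrite !vadd0 ?size_nseq.
Qed.

Lemma size_embed l i v : size v = 13%N -> (i <= l)%N -> size (embed l i v) = (3 + 5 * (l + 2))%N.
Proof.
by move=> sv il; rewrite /embed !size_cat !size_nseq size_take size_drop sv /=; lia.
Qed.

Lemma split_at (u : seq int) n : (n <= size u)%N -> exists a b, [/\ u = a ++ b & size a = n].
Proof. by move=> ns; exists (take n u), (drop n u); rewrite cat_take_drop size_takel. Qed.

Lemma nseq_cat (m n : nat) (x : int) : nseq (m + n) x = nseq m x ++ nseq n x.
Proof. by elim: m => //= m ->. Qed.

Lemma cat_nseqI (a b : seq int) m : a ++ b = nseq m 0 -> a = nseq (size a) 0 /\ b = nseq (size b) 0.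
Proof.
move=> e; have s : m = (size a + size b)%N by rewrite -size_cat e size_nseq.
by move/eqP: e; rewrite s nseq_cat eqseq_cat ?size_nseq // => /andP[/eqP <- /eqP <-].
Qed.

Variables (P : seq rinstr) (S start acc l X : nat).
Hypothesis P_states : forall j, (j < size P)%N ->
  (ri_src (nth ri0 P j) < S)%N && (ri_tgt (nth ri0 P j) < S)%N.
Hypothesis start_S : (start < S)%N.
Hypothesis acc_S : (acc < S)%N.

Let V := reduction_vass P S start acc l X.

(** The value of t is needed only for [init_t], which belongs to level 0. *)
Definition init_T (i : nat) (t : int) : Prop := i = 0%N -> t = 4.

Definition stage_inv (i q : nat) (v : seq int) : Prop :=
  if (i < l)%N then level_inv (init_T i) q v
  else final_inv P S start acc X (init_T i) q v.

(* The counters of the blocks below i are never touched again, so they may be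
   assumed to have already their final value 0. *)
Definition global_inv (c : nat * seq int) : Prop :=
  exists i q a b w d,
  [/\ c.1 = (i * level_states + q)%N /\ c.2 = a ++ b ++ w ++ d,
      (i <= l)%N && ((i < l) ==> (q < level_states))%N,
      size a = 3 /\ size b = (5 * i)%N,
      size w = 10 /\ size d = (5 * (l - i))%N &
      b = nseq (5 * i) 0 -> d = nseq (5 * (l - i)) 0 /\ stage_inv i q (a ++ w)].

Lemma size_gadget b i t : t \in gadget b i -> size t.1.2 = 13%N.
Proof. by rewrite !inE; do ![case/orP=> [/eqP -> //|]]; move/eqP ->. Qed.

Lemma size_level_t t : t \in level_t -> size t.1.2 = 13%N.
Proof.
have /allP H : all (fun t : tmpl => size t.1.2 == 13%N) level_t by [].
by move/H => /eqP.
Qed.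

Lemma size_final_t t : t \in final_t P S start acc X -> size t.1.2 = 13%N.
Proof.
rewrite mem_cat => /orP[|/gadgetsP [j _ /size_gadget //]].
by rewrite !inE; do ![case/orP=> [/eqP -> //|]]; move/eqP ->.
Qed.

Lemma level_in_states t : t \in level_in -> (t.1.1 < level_states)%N && (t.2 < level_states)%N.
Proof.
have /allP H : all (fun t : tmpl => (t.1.1 < level_states)%N && (t.2 < level_states)%N) level_in.
  by [].
exact: H.
Qed.

Lemma vadd_embed_split i a b w d e : size a = 3 -> size b = (5 * i)%N -> size w = 10 ->
  size d = (5 * (l - i))%N -> size e = 13%N ->
  vadd (a ++ b ++ w ++ d) (embed l i e) = vadd a (take 3 e) ++ b ++ vadd w (drop 3 e) ++ d /\
  vadd a (take 3 e) ++ vadd w (drop 3 e) = vadd (a ++ w) e.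
Proof.
move=> sa sb sw sd se; rewrite /embed !vadd_cat ?size_nseq ?size_take ?size_drop ?sa ?sb ?sw ?se //.
rewrite !vadd0 ?sb ?sd //; split=> //.
by rewrite -[in RHS](cat_take_drop 3 e) vadd_cat // size_take se.
Qed.

Lemma nonneg_cat3 a u u' : size a = 3 -> nonneg_first 3 (a ++ u) = nonneg_first 3 (a ++ u').
Proof. by move=> sa; rewrite /nonneg_first !take_cat sa /= !subnn !take0. Qed.

Lemma stage_stay i q q' a b w d e :
  (i <= l)%N && ((i < l) ==> (q' < level_states))%N ->
  size a = 3 -> size b = (5 * i)%N -> size w = 10 -> size d = (5 * (l - i))%N ->
  (b = nseq (5 * i) 0 -> d = nseq (5 * (l - i)) 0 /\ stage_inv i q (a ++ w)) ->
  size e = 13%N -> nonneg_first 3 (vadd (a ++ b ++ w ++ d) (embed l i e)) ->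
  (nonneg_first 3 (vadd (a ++ w) e) -> stage_inv i q (a ++ w) ->
    stage_inv i q' (vadd (a ++ w) e)) ->
  global_inv ((i * level_states + q')%N, vadd (a ++ b ++ w ++ d) (embed l i e)).
Proof.
move=> il sa sb sw sd H se; have [-> E] := vadd_embed_split sa sb sw sd se.
have sa' : size (vadd a (take 3 e)) = 3 by rewrite size_vadd // size_take se.
rewrite (nonneg_cat3 _ (vadd w (drop 3 e))) // E => nn HH.
exists i, q', (vadd a (take 3 e)), b, (vadd w (drop 3 e)), d; split=> //=.
  by rewrite size_vadd ?size_drop ?se.
by move/H => [d0 Hs]; split=> //; rewrite E; apply: HH.
Qed.

Lemma mem_trans t : t \in v_trans V <->
  [\/ exists2 tau, tau \in init_t & t = lift_t l 0 tau,
     exists i tau, [/\ (i < l)%N, tau \in level_t & t = lift_t l i tau] |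
     exists2 tau, tau \in final_t P S start acc X & t = lift_t l l tau].
Proof.
have -> : v_trans V = map (lift_t l 0) init_t ++
     flatten [seq map (lift_t l i) level_t | i <- iota 0 l] ++
     map (lift_t l l) (final_t P S start acc X) by [].
rewrite !mem_cat; split.
  case/or3P => [/mapP [tau ? ->]|/flatten_mapP [i]|/mapP [tau ? ->]].
  - by apply: Or31; exists tau.
  - by rewrite mem_iota add0n => il /mapP [tau ? ->]; apply: Or32; exists i, tau.
  - by apply: Or33; exists tau.
case=> [[tau tin ->]|[i [tau [il tin ->]]]|[tau tin ->]]; apply/or3P.
- by apply: Or31; apply: map_f.
- apply: Or32; apply/flatten_mapP; exists i; first by rewrite mem_iota.
  exact: map_f.
- by apply: Or33; apply: map_f.
Qed.

Lemma global_step c c' : vass_step 3 V c c' -> global_inv c -> global_inv c'.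
Proof.
case: c => s u [t [tin [/= sE [-> nn]]]] [i] [q] [a] [b] [w] [d] [/= [sq uE] il [sa sb] [sw sd] H].
subst u; move/mem_trans: tin => tin.
case: tin => [[tau]|[i' [[[qs e] qt] [i'l tin tE]]]|[[[qs e] qt] tin tE]]; last 1 first.
- subst t; move: sE nn => /= sE nn.
  have ii' : i = l.
    (* Distinct levels own disjoint ranges of states, so the state alone determines the level. *)
    case/andP: il => il /implyP ilq; move: sq ilq; rewrite sE /level_states.
    by case: (ltnP i l) => [? ? /(_ isT)|]; lia.
  subst i; have qE : q = qs by apply/eqP; rewrite -(eqn_add2l (l * level_states)) -sq sE.
  apply: (stage_stay _ _ _ _ _ H) nn _ => //; [by rewrite leqnn ltnn| exact: (size_final_t tin)|].
  by rewrite /stage_inv ltnn qE => nn' Hs; apply: (final_step P_states start_S acc_S tin).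
- rewrite inE => /eqP -> tE; rewrite {}tE /= in sE nn *.
  have i0 : i = 0%N by rewrite /level_states in sq; lia.
  have q0 : q = 0%N by lia.
  subst i q; apply: (@stage_stay 0 0 0) nn _ => //.
  rewrite /stage_inv => _; case: ifP => _; apply: (mode_load_guess (t0 := 4)).
  - by move=> x ->.
  - by move=> x ->.
- subst t; move: sE nn => /= sE nn.
  have tst : (qs < level_states)%N.
    move: tin; rewrite mem_rcons inE => /orP[/eqP [-> _ _] //|/level_in_states/andP[]//].
  have ii' : i = i'.
    case/andP: il => il /implyP ilq; move: sq ilq tst; rewrite sE /level_states.
    by case: (ltnP i l) => [? ? /(_ isT)|]; lia.
  subst i'; have qE : q = qs by apply/eqP; rewrite -(eqn_add2l (i * level_states)) -sq sE.
  have se := size_level_t tin.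
  move: tin; rewrite mem_rcons inE => /orP[/eqP [qsE eE qtE]|tin]; last first.
    apply: (stage_stay _ _ _ _ _ H) nn _ => //.
      by have /andP[_ ->] := level_in_states tin; rewrite implybT ltnW.
    by rewrite /stage_inv i'l qE => nn' Hs; apply: (level_in_step tin).
  rewrite {}qsE {}eE {}qtE /= in nn sE se qE *.
  have [-> _] := @vadd_embed_split i a b w d eff0 sa sb sw sd erefl.
  have -> : take 3 eff0 = nseq 3 0 by [].
  have -> : drop 3 eff0 = nseq 10 0 by [].
  rewrite !vadd0 ?sa ?sw //.
  have [w1 [w2 [wE sw1]]] : exists w1 w2, w = w1 ++ w2 /\ size w1 = 5.
    by have [w1 [w2 []]] := @split_at w 5 ltac:(by rewrite sw); exists w1, w2.
  have [d1 [d2 [dE sd1]]] : exists d1 d2, d = d1 ++ d2 /\ size d1 = 5.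
    by have [d1 [d2 []]] := @split_at d 5 ltac:(by rewrite sd; lia); exists d1, d2.
  subst w d; rewrite !size_cat in sw sd.
  exists i.+1, 0%N, a, (b ++ w1), (w2 ++ d1), d2; split=> //.
  - by rewrite /= -!catA /level_states; split=> //; lia.
  - by rewrite i'l implybT.
  - by rewrite size_cat; split=> //; lia.
  - by rewrite size_cat; split=> //; lia.
  (* The block just left has joined the finished ones. The premise that they are 0 at the end now
     covers it, which gives the zeros that [level_exit] asks for. *)
  move=> /cat_nseqI [b0 w10].
  rewrite sb in b0; case: (H b0) => /cat_nseqI [d10 d20].
  rewrite /stage_inv i'l qE => Hs; split; first by rewrite d20; congr nseq; lia.
  have [|n' [d' [t' [avE dd']]]] := level_exit Hs.
    move=> k k3; rewrite nth_cat sa ltnNge; case/andP: k3 => -> k8 /=.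
    have k5 : (k - 3 < 5)%N by lia.
    by rewrite nth_cat sw1 k5 w10 nth_nseq; case: ifP.
  have aw : a = [:: 0; 0; 0] /\ w1 ++ w2 = [:: 0; 0; 0; 0; 0; n'; d'; t'; 0; 0].
    by move/eqP: avE; rewrite /eff -[X in _ == X](cat_take_drop 3) eqseq_cat ?sa //= 
        => /andP[/eqP -> /eqP ->].
  have w2E : w2 = [:: n'; d'; t'; 0; 0].
    by case: aw => _ /(congr1 (drop 5)); rewrite drop_size_cat.
  case: aw => -> _; rewrite w2E d10 sd1 /=.
  have Pt' : init_T i.+1 t' by [].
  have dE' : d' = 2 * t' * (n' + 0) by rewrite addr0.
  by case: ifP => _; apply: (MILoad _ _ _ _ dE').
Qed.

Lemma global_start : global_inv (v_src V).
Proof.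
exists 0%N, 0%N, [:: 0; 0; 0], [::], [:: 0; 0; 4; 0; 0; 0; 0; 0; 0; 0], (nseq (5 * l) 0).
split=> //.
- by rewrite /= /embed muln0 subn0.
- by rewrite implybT.
- by rewrite size_nseq subn0.
rewrite subn0 => _; split=> //; rewrite /stage_inv.
by case: ifP => _; apply: (@MILoad _ _ _ _ 0 0 0 4).
Qed.

Theorem vass_sound : vass_reach 3 V -> exists m x, crun P (start, X) m (acc, x).
Proof.
rewrite /vass_reach => R.
have : global_inv (v_tgt V).
  by move: global_start; elim: R => // c c' c'' /global_step cc' _ IH /cc'.
case=> i [q] [a] [b] [w] [d] [/= [sq uE] il [sa sb] [sw sd] H].
(* The target vector is 0, so the premise on the finished blocks holds and the invariant of the last
   mode becomes unconditional. *)
have [a0 /cat_nseqI [b0 /cat_nseqI [w0 _]]] :=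
  cat_nseqI (esym uE : _ = nseq (3 + 5 * (l + 2)) 0).
rewrite sa sb sw in a0 b0 w0; case: (H b0) => _.
have iE : i = l.
  case/andP: il => il /implyP ilq; move: sq ilq; rewrite /level_states.
  by case: (ltnP i l) => [? ? /(_ isT)|]; lia.
subst i; rewrite /stage_inv ltnn; have -> : q = final_U S by apply/eqP; rewrite -(eqn_add2l (l * level_states)) -sq.
move/final_exit; apply => // k /andP[k3 k8].
by rewrite a0 w0 -nseq_cat nth_nseq; case: ifP.
Qed.

End Global.

(** * The reduction is complete *)

Section LocalRuns.
Local Open Scope ring_scope.
Variable ts : seq tmpl.

Definition lreach : nat * seq int -> nat * seq int -> Prop := clos_refl_trans_1n _ (lstep ts).

Lemma lreach_trans c1 c2 c3 : lreach c1 c2 -> lreach c2 c3 -> lreach c1 c3.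
Proof. by elim=> // a b c st _ IH /IH; apply: Relation_Operators.rt1n_trans st. Qed.

(** The N-counters are affine in the number of turns, so it is enough that they are nonnegative at
    both ends. *)
Lemma lreach_loop k q x y z n d t r e n' d' t' dx dy dz dn dd dt dr de dn' dd' dt' :
  (q, eff dx dy dz dn dd dt dr de dn' dd' dt', q) \in ts ->
  0 <= x -> 0 <= y -> 0 <= z ->
  0 <= x + dx * k%:Z -> 0 <= y + dy * k%:Z -> 0 <= z + dz * k%:Z ->
  lreach (q, eff x y z n d t r e n' d' t')
    (q, eff (x + dx * k%:Z) (y + dy * k%:Z) (z + dz * k%:Z) (n + dn * k%:Z)
            (d + dd * k%:Z) (t + dt * k%:Z) (r + dr * k%:Z) (e + de * k%:Z)
            (n' + dn' * k%:Z) (d' + dd' * k%:Z) (t' + dt' * k%:Z)).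
Proof.
move=> tin; elim: k x y z n d t r e n' d' t' => [|k IH] x y z n d t r e n' d' t' x0 y0 z0 xk yk zk.
  by rewrite !mulr0 !addr0; apply: rt1n_refl.
have step1 (a b : int) : 0 <= a -> 0 <= a + b * k.+1%:Z -> 0 <= a + b.
  move=> a0; rewrite -addn1 PoszD mulrDr mulr1; case: (lerP 0 b) => b0; first by lia.
  have : b * k%:Z <= 0 by rewrite nmulr_rle0.
  by lia.
have S (a b : int) : a + b * k.+1%:Z = a + b + b * k%:Z by lia.
rewrite !S; apply: (@Relation_Operators.rt1n_trans _ _ _ (q, eff (x + dx) (y + dy) (z + dz) (n + dn) (d + dd)
  (t + dt) (r + dr) (e + de) (n' + dn') (d' + dd') (t' + dt'))); last first.
  by apply: IH; rewrite -?S //; apply: step1.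
exists (q, eff dx dy dz dn dd dt dr de dn' dd' dt', q); split=> //; split=> //.
by split=> //; rewrite /nonneg_first /= (step1 x dx) // (step1 y dy) // (step1 z dz).
Qed.

Lemma lreach_step q q' x y z n d t r e n' d' t' dx dy dz dn dd dt dr de dn' dd' dt' :
  (q, eff dx dy dz dn dd dt dr de dn' dd' dt', q') \in ts ->
  0 <= x + dx -> 0 <= y + dy -> 0 <= z + dz ->
  lreach (q, eff x y z n d t r e n' d' t')
    (q', eff (x + dx) (y + dy) (z + dz) (n + dn) (d + dd) (t + dt) (r + dr) (e + de)
            (n' + dn') (d' + dd') (t' + dt')).
Proof.
move=> tin xk yk zk.
apply: (@Relation_Operators.rt1n_trans _ _ _ (q', eff (x + dx) (y + dy) (z + dz) (n + dn) (d + dd)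
  (t + dt) (r + dr) (e + de) (n' + dn') (d' + dd') (t' + dt'))); last exact: rt1n_refl.
exists (q, eff dx dy dz dn dd dt dr de dn' dd' dt', q'); split=> //; split=> //.
by split=> //; rewrite /nonneg_first /= xk yk zk.
Qed.

Lemma lreach_eq c c' c'' : lreach c c' -> c' = c'' -> lreach c c''.
Proof. by move=> + <-. Qed.

(** The last bound is needed between the two free transitions: after k turns of the loop, z has
    become m - (p k + r). *)
Lemma gadget_run b i (k x x' m : nat) n d t r e n' d' t' :
  {subset gadget b i <= ts} ->
  x = (ri_q i * k + ri_r i)%N -> x' = (ri_p i * k + ri_r' i)%N ->
  (x <= m)%N -> (x' <= m)%N -> (ri_p i * k + ri_r i <= m)%N ->
  lreach (ri_src i, eff x%:Z 0 (m%:Z - x%:Z) n d t r e n' d' t')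
    (ri_tgt i, eff x'%:Z 0 (m%:Z - x'%:Z) n (d - 2 * m%:Z) (t - 1) (r + ri_dr i) e n' d' t').
Proof.
case: i => src q p rr rr' dr tgt /= sub xE x'E xm x'm zk.
have [M0 [M1 [M2 [M3 [M4 [M5 [M6 [M7 M8]]]]]]]] : 
  (src, eff0, b) \in ts /\
  (b, eff (- q%:Z) p%:Z (q%:Z - p%:Z) 0 0 0 0 0 0 0 0, b) \in ts /\
  (b, eff (- rr%:Z) rr'%:Z (rr%:Z - rr'%:Z) 0 0 0 0 0 0 0 0, b.+1) \in ts /\
  (b.+1, eff 1 (-1) 0 0 (-2) 0 0 0 0 0 0, b.+1) \in ts /\
  (b.+1, eff0, b.+2) \in ts /\
  (b.+2, eff 0 1 (-1) 0 (-1) 0 0 0 0 0 0, b.+2) \in ts /\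
  (b.+2, eff0, b.+3) \in ts /\
  (b.+3, eff 0 (-1) 1 0 (-1) 0 0 0 0 0 0, b.+3) \in ts /\
  (b.+3, eff 0 0 0 0 0 (-1) dr 0 0 0 0, tgt) \in ts.
  by do !split; apply: sub; rewrite !in_cons eqxx ?orbT.
apply: lreach_trans.
  by apply: (lreach_step _ _ _ _ _ _ _ _ M0); clear -xE x'E xm x'm zk; lia.
apply: lreach_trans.
  by apply: (lreach_loop (k := k) _ _ _ _ _ _ _ _ M1); clear -xE x'E xm x'm zk; lia.
apply: lreach_trans.
  by apply: (lreach_step _ _ _ _ _ _ _ _ M2); clear -xE x'E xm x'm zk; lia.
apply: lreach_trans.
  by apply: (lreach_loop (k := (p * k + rr')%N) _ _ _ _ _ _ _ _ M3); clear -xE x'E xm x'm zk; lia.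
apply: lreach_trans.
  by apply: (lreach_step _ _ _ _ _ _ _ _ M4); clear -xE x'E xm x'm zk; lia.
apply: lreach_trans.
  by apply: (lreach_loop (k := (m - x')%N) _ _ _ _ _ _ _ _ M5); clear -xE x'E xm x'm zk; lia.
apply: lreach_trans.
  by apply: (lreach_step _ _ _ _ _ _ _ _ M6); clear -xE x'E xm x'm zk; lia.
apply: lreach_trans.
  by apply: (lreach_loop (k := (m - x')%N) _ _ _ _ _ _ _ _ M7); clear -xE x'E xm x'm zk; lia.
apply: lreach_eq.
  by apply: (lreach_step _ _ _ _ _ _ _ _ M8); clear -xE x'E xm x'm zk; lia.
by congr (_, [:: _; _; _; _; _; _; _; _; _; _; _; _; _]); clear -xE x'E xm x'm zk; lia.
Qed.

Lemma gadget_iter b i (R a m : nat) n d t r e n' d' t' :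
  {subset gadget b i <= ts} -> ri_q i = 1%N -> ri_r i = 0%N -> ri_r' i = 0%N ->
  ri_src i = ri_tgt i -> (0 < ri_p i)%N -> (ri_p i ^ R * a <= m)%N ->
  lreach (ri_src i, eff a%:Z 0 (m%:Z - a%:Z) n d t r e n' d' t')
    (ri_src i, eff (ri_p i ^ R * a)%N%:Z 0 (m%:Z - (ri_p i ^ R * a)%N%:Z) n
      (d - 2 * m%:Z * R%:Z) (t - R%:Z) (r + ri_dr i * R%:Z) e n' d' t').
Proof.
move=> sub q1 r0 r0' st p0; elim: R d t r => [|R IH] d t r am.
  rewrite expn0 mul1n !mulr0 addr0 !subr0; exact: rt1n_refl.
have le : (ri_p i ^ R * a <= m)%N.
  by apply: leq_trans am; rewrite expnS -mulnA leq_pmull.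
apply: lreach_trans (IH d t r le) _; rewrite {2}st.
apply: lreach_eq (@gadget_run b i (ri_p i ^ R * a)%N _ (ri_p i ^ R.+1 * a)%N _
  _ _ _ _ _ _ _ _ sub _ _ _ _ _) _ => //.
- by rewrite q1 r0 mul1n addn0.
- by rewrite r0' addn0 mulnA -expnS.
- by rewrite r0 addn0 mulnA -expnS.
by congr (_, [:: _; _; _; _; _; _; _; _; _; _; _; _; _]); lia.
Qed.

End LocalRuns.

(** * A complete run of one level *)

Section LevelRun.
Local Open Scope ring_scope.

Lemma gadgets_sub (ts : seq tmpl) base ins j : {subset gadgets base ins <= ts} -> (j < size ins)%N ->
  {subset gadget (base + 4 * j) (nth ri0 ins j) <= ts}.
Proof. by move=> sub jlt x xin; apply: sub; apply: mem_gadgets xin. Qed.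

(** The sum N has to hold the guess after its R doublings, hence [2 ^ R * N' <= N]. The rounds are R
    doublings, a zero test, R doublings and a zero test. *)
Lemma level_run (R N N' : nat) : (0 < N')%N -> (2 ^ R * N' <= N)%N ->
  lreach level_t
    (0%N, eff 0 0 0 N%:Z (2 * (2 * R + 2)%:Z * N%:Z) (2 * R + 2)%:Z 0 0 0 0 0)
    (level_states, eff 0 0 0 0 0 0 0 0 N'%:Z (8 * (2 ^ R)%:Z * N'%:Z) (4 * (2 ^ R)%:Z)).
Proof.
move=> N'0 NN'.
have R0 : (0 < 2 ^ R)%N by rewrite expn_gt0.
have le1 : (2 ^ R <= N)%N by apply: leq_trans NN'; rewrite leq_pmulr.
have le2 : (N' <= N)%N by apply: leq_trans NN'; rewrite leq_pmull.
have sub : {subset gadgets 7 level_ins <= level_t}.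
  by move=> x xin; rewrite mem_rcons inE mem_cat xin !orbT.
have M k : (k < size level_t)%N -> nth (0%N, [::], 0%N) level_t k \in level_t.
  exact: mem_nth.
have M0 := M 0%N isT; have M1 := M 1%N isT; have M2 := M 2%N isT; have M3 := M 3%N isT.
have M4 := M 4%N isT; have M5 := M 5%N isT; have M6 := M 6%N isT; have M7 := M 7%N isT.
(* The exit transition comes after 9 plain ones and 4 gadgets of 9 transitions each: 45 = 9 + 36. *)
have M8 := M 8%N isT; have M9 := M 45%N isT; rewrite /= in M0 M1 M2 M3 M4 M5 M6 M7 M8 M9; clear M.
have S0 := gadgets_sub sub (isT : 0 < 4)%N; have S1 := gadgets_sub sub (isT : 1 < 4)%N.
have S2 := gadgets_sub sub (isT : 2 < 4)%N; have S3 := gadgets_sub sub (isT : 3 < 4)%N.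
set D := 2 * _ * _; set T := (2 * R + 2)%:Z.
have eqc q v v' : v = v' -> (q, v) = (q, v') :> nat * seq int by move=> ->.
apply: (@lreach_trans _ _ (2%N, eff N'%:Z 0 (N%:Z - N'%:Z) 0 D T 0 N%:Z N'%:Z 0 0)).
  apply: lreach_trans.
    by apply: (lreach_loop (k := N) _ _ _ _ _ _ _ _ M0); clear -R; lia.
  apply: lreach_trans.
    by apply: (lreach_step _ _ _ _ _ _ _ _ M1); clear -R; lia.
  apply: lreach_trans.
    by apply: (lreach_loop (k := N') _ _ _ _ _ _ _ _ M2); clear -le2; lia.
  apply: lreach_eq.
    by apply: (lreach_step _ _ _ _ _ _ _ _ M3); clear -le2; lia.
  by apply: eqc; congr [:: _; _; _; _; _; _; _; _; _; _; _; _; _]; clear; lia.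
apply: lreach_trans.
  exact: (gadget_iter _ _ _ _ _ _ _ _ S0 erefl erefl erefl erefl isT NN').
rewrite [ri_dr _]/= [ri_p _]/= [ri_src _]/=; set A := (_ * N')%N.
have NA : (A <= N)%N by [].
apply: (@lreach_trans _ _ (3%N, eff 0%:Z 0 (N%:Z - 0%:Z) 0 (D - 2 * N%:Z * R%:Z)
    (T - R%:Z) R%:Z N%:Z N'%:Z (8 * A%:Z) 0)).
  apply: lreach_trans.
    by apply: (lreach_step _ _ _ _ _ _ _ _ M4); clear -NA; lia.
  apply: lreach_eq.
    by apply: (lreach_loop (k := A) _ _ _ _ _ _ _ _ M5); clear -NA; lia.
  by apply: eqc; congr [:: _; _; _; _; _; _; _; _; _; _; _; _; _]; clear; lia.
have N0 : (0 < N)%N by apply: leq_trans N'0 le2.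
apply: lreach_trans.
  by apply: (@gadget_run _ _ _ 0 0 1 N _ _ _ _ _ _ _ _ S1).
rewrite [ri_dr _]/= [ri_tgt _]/=.
apply: lreach_trans.
  by apply: (@gadget_iter _ _ _ R 1 N _ _ _ _ _ _ _ _ S2) => //=; rewrite muln1.
rewrite muln1 [ri_dr _]/= [ri_p _]/= [ri_src _]/=.
apply: (@lreach_trans _ _ (5%N, eff 0%:Z 0 (N%:Z - 0%:Z) 0 (D - 2 * N%:Z * (2 * R + 1)%:Z)
    (T - (2 * R + 1)%:Z) 0 N%:Z N'%:Z (8 * A%:Z) (4 * (2 ^ R)%:Z))).
  apply: lreach_trans.
    by apply: (lreach_step _ _ _ _ _ _ _ _ M6); clear -le1; lia.
  apply: lreach_eq.
    by apply: (lreach_loop (k := (2 ^ R)%N) _ _ _ _ _ _ _ _ M7); clear -le1; lia.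
  by apply: eqc; congr [:: _; _; _; _; _; _; _; _; _; _; _; _; _]; clear; lia.
apply: lreach_trans.
  by apply: (@gadget_run _ _ _ 0 0 0 N _ _ _ _ _ _ _ _ S3).
rewrite [ri_dr _]/= [ri_tgt _]/=.
apply: lreach_trans.
  by apply: (lreach_loop (k := N) _ _ _ _ _ _ _ _ M8); clear -N0; lia.
apply: lreach_eq.
  by apply: (lreach_step _ _ _ _ _ _ _ _ M9); clear -N0; lia.
by apply: eqc; congr [:: _; _; _; _; _; _; _; _; _; _; _; _; _]; rewrite ?[ri_dr _]/= /D /T /A; clear; lia.
Qed.

End LevelRun.

Section FinalRun.
Local Open Scope ring_scope.
Variables (P : seq rinstr) (S start acc X0 : nat).

Let ts := final_t P S start acc X0.

Lemma final_gadget j : (j < size (final_ins P start acc X0))%N ->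
  {subset gadget ((final_U S).+1 + 4 * j) (nth ri0 (final_ins P start acc X0) j) <= ts}.
Proof. by apply: gadgets_sub => x xin; rewrite /ts /final_t mem_cat xin orbT. Qed.

(** A run meets finitely many numbers, so every sum beyond some bound leaves room for it. The sum is
    chosen only later. *)
Lemma crun_vass c m c' : crun P c m c' -> exists B : nat, forall N : nat, (B <= N)%N ->
  forall d t r e,
  lreach ts ((2 + c.1)%N, eff c.2%:Z 0 (N%:Z - c.2%:Z) 0 d t r e 0 0 0)
    ((2 + c'.1)%N, eff c'.2%:Z 0 (N%:Z - c'.2%:Z) 0 (d - 2 * N%:Z * m%:Z) (t - m%:Z) r e 0 0 0).
Proof.
elim=> [|{}m {}c' j k run [B HB] jlt cE].
  by exists 0%N => N _ d t r e; rewrite mulr0 !subr0; apply: rt1n_refl.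
have := @final_gadget j.+2; rewrite /= size_map !ltnS (nth_map ri0) // => /(_ jlt).
set I := nth ri0 P j in cE * => sub.
exists (maxn B (maxn (ri_p I * k + ri_r I) (maxn (ri_q I * k + ri_r I) (ri_p I * k + ri_r' I)))).
move=> N; rewrite !geq_max => /andP[BN /andP[N1 /andP[N2 N3]]] d t r e.
apply: lreach_trans (HB N BN d t r e) _; rewrite cE /=.
apply: lreach_eq (@gadget_run _ _ _ k _ _ N _ _ _ _ _ _ _ _ sub erefl erefl N2 N3 N1) _.
by congr (_, [:: _; _; _; _; _; _; _; _; _; _; _; _; _]); rewrite /=; clear; lia.
Qed.

Lemma final_run m x : crun P (start, X0) m (acc, x) ->
  exists2 B : nat, (0 < B)%N & forall N T : nat, (B <= N)%N -> (m < T)%N ->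
  lreach ts (0%N, eff 0 0 0 N%:Z (2 * T%:Z * N%:Z) T%:Z 0 0 0 0 0)
    (final_U S, eff 0 0 0 0 0 0 0 0 0 0 0).
Proof.
move=> run; have [B HB] := crun_vass run.
exists (maxn 1 (maxn B (maxn X0 x))) ; first by rewrite leq_max.
move=> N T.
rewrite !geq_max => /andP[N0 /andP[BN /andP[XN xN]]] mT.
have M k : (k < size (final_plain S acc))%N -> nth (0%N, [::], 0%N) (final_plain S acc) k \in ts.
  by move=> k5; rewrite mem_cat mem_nth.
have M0 := M 0%N isT; have M1 := M 1%N isT; have M2 := M 2%N isT.
have M3 := M 3%N isT; have M4 := M 4%N isT; rewrite /= in M0 M1 M2 M3 M4; clear M.
have eqc q v v' : v = v' -> (q, v) = (q, v') :> nat * seq int by move=> ->.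
set D := 2 * _ * _.
apply: (@lreach_trans _ _ (1%N, eff 0%:Z 0 (N%:Z - 0%:Z) 0 D T 0 N%:Z 0 0 0)).
  apply: lreach_trans.
    by apply: (lreach_loop (k := N) _ _ _ _ _ _ _ _ M0); clear -N; lia.
  apply: lreach_eq.
    by apply: (lreach_step _ _ _ _ _ _ _ _ M1); clear -N; lia.
  by apply: eqc; congr [:: _; _; _; _; _; _; _; _; _; _; _; _; _]; clear; lia.
apply: lreach_trans.
  by apply: (@gadget_run _ _ _ 0 0 X0 N _ _ _ _ _ _ _ _ (@final_gadget 0 isT)).
rewrite [ri_dr _]/= [ri_tgt _]/=.
apply: lreach_trans; first exact: (HB N BN).
apply: lreach_trans.
  (* Of the T rounds, one has loaded X and m have simulated the run; the others are idle. *)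
  by apply: (@gadget_iter _ _ _ (T - m.+1) x N _ _ _ _ _ _ _ _ (@final_gadget 1 isT));
    rewrite //= exp1n mul1n.
rewrite [ri_src _]/= [ri_p _]/= exp1n mul1n.
apply: lreach_trans.
  by apply: (lreach_step _ _ _ _ _ _ _ _ M2); clear -xN; lia.
apply: lreach_trans.
  by apply: (lreach_loop (k := x) _ _ _ _ _ _ _ _ M3); clear -xN; lia.
apply: lreach_eq.
  by apply: (lreach_loop (k := (N - x)%N) _ _ _ _ _ _ _ _ M4); clear -xN; lia.
rewrite [ri_dr _]/=.
have -> : (T - m.+1)%:Z = T%:Z - m.+1%:Z by rewrite -subzn.
by apply: eqc; congr [:: _; _; _; _; _; _; _; _; _; _; _; _; _]; rewrite /D; clear -mT xN; lia.
Qed.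

End FinalRun.

(** The solution of 2 R' + 2 = 4 * 2^R, starting from 2 R + 2 = 4. *)
Fixpoint level_R (i : nat) : nat :=
  if i is i'.+1 then 2 * 2 ^ level_R i' - 1 else 1.

Section GlobalRun.
Local Open Scope ring_scope.
Variables (P : seq rinstr) (S start acc l X : nat).
Let V := reduction_vass P S start acc l X.

Lemma lift_step ts i c c' : {in ts, forall t, size t.1.2 = 13%N} ->
  (forall t, t \in ts -> lift_t l i t \in v_trans V) ->
  size c.2 = 13%N -> lstep ts c c' ->
  vass_step 3 V ((i * level_states + c.1)%N, embed l i c.2)
    ((i * level_states + c'.1)%N, embed l i c'.2) /\ size c'.2 = 13%N.
Proof.
move=> s13 tin sc [t [tts [-> [-> nn]]]]; have st := s13 _ tts.
split; last by rewrite /= size_vadd ?sc.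
exists (lift_t l i t); split; first exact: tin.
rewrite /= embed_vadd //; split=> //; split=> //.
by move: nn; rewrite /nonneg_first /embed take_cat size_take size_vadd ?sc //= subnn take0 cats0.
Qed.

Lemma lift_reach ts i c c' : {in ts, forall t, size t.1.2 = 13%N} ->
  (forall t, t \in ts -> lift_t l i t \in v_trans V) ->
  lreach ts c c' -> size c.2 = 13%N ->
  clos_refl_trans_1n _ (vass_step 3 V) ((i * level_states + c.1)%N, embed l i c.2)
    ((i * level_states + c'.1)%N, embed l i c'.2).
Proof.
move=> s13 tin; elim=> [c0 _|a b d st _ IH sa]; first exact: rt1n_refl.
have [st' sb] := lift_step s13 tin sa st.
exact: Relation_Operators.rt1n_trans st' (IH sb).
Qed.

Lemma mem_init t : t \in init_t -> lift_t l 0 t \in v_trans V.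
Proof. by move=> tin; apply/mem_trans; apply: Or31; exists t. Qed.

Lemma mem_level i t : (i < l)%N -> t \in level_t -> lift_t l i t \in v_trans V.
Proof. by move=> il tin; apply/mem_trans; apply: Or32; exists i, t. Qed.

Lemma mem_final t : t \in final_t P S start acc X -> lift_t l l t \in v_trans V.
Proof. by move=> tin; apply/mem_trans; apply: Or33; exists t. Qed.

Definition level_start (i N : nat) : nat * seq int :=
  ((i * level_states)%N,
   embed l i (eff 0 0 0 N%:Z (2 * (2 * level_R i + 2)%:Z * N%:Z) (2 * level_R i + 2)%:Z 0 0 0 0 0)).

Lemma embed_next i n d t : (i < l)%N ->
  embed l i (eff 0 0 0 0 0 0 0 0 n d t) = embed l i.+1 (eff 0 0 0 n d t 0 0 0 0 0).
Proof.
move=> il; rewrite /embed.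
have -> : (5 * (l - i) = 5 + 5 * (l - i.+1))%N by lia.
have -> : (5 * i.+1 = 5 * i + 5)%N by lia.
by rewrite !nseq_cat -!catA.
Qed.

(** The induction goes from the last mode back to level 0, because the sums are determined in this
    order: the last one must suit the simulated run, and each level needs 2^R times the sum of its
    successor. *)
Lemma level_starts_reach m x : crun P (start, X) m (acc, x) -> (m < 2 * level_R l + 2)%N ->
  forall k, (k <= l)%N -> exists2 N : nat, (0 < N)%N &
  clos_refl_trans_1n _ (vass_step 3 V) (level_start (l - k) N) (v_tgt V).
Proof.
move=> run mT; elim=> [_|k IH kl].
  have [B B0 HB] := final_run S run; exists B => //; rewrite subn0.
  have := lift_reach (@size_final_t P S start acc X) mem_final (HB _ _ (leqnn B) mT) erefl.
  have -> : embed l l (final_U S, eff 0 0 0 0 0 0 0 0 0 0 0).2 = nseq (3 + 5 * (l + 2)) 0.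
    rewrite /embed -[take _ _]/(nseq 3 0) -[drop _ _]/(nseq 10 0) -!nseq_cat.
    by congr nseq; lia.
  by rewrite addn0.
have [N N0 HN] := IH (ltnW kl).
exists (2 ^ level_R (l - k.+1) * N)%N; first by rewrite muln_gt0 expn_gt0.
have il : (l - k.+1 < l)%N by lia.
have := lift_reach size_level_t (fun t => @mem_level _ t il) (@level_run (level_R (l - k.+1)) _ _ N0 (leqnn _)) erefl.
rewrite addn0 embed_next // => R1.
have ek : (l - k = (l - k.+1).+1)%N by lia.
have {}HN : clos_refl_trans_1n _ (vass_step 3 V) (level_start (l - k.+1).+1 N) (v_tgt V).
  by rewrite -ek.
apply: clos_rt_rt1n; apply: rt_trans; first exact: (clos_rt1n_rt _ _ _ _ R1).
apply: clos_rt1n_rt; move: HN; congr (clos_refl_trans_1n _ _ (_, embed l _ _)); first by rewrite mulSn addnC.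
have p0 : (0 < 2 ^ level_R (l - k.+1))%N by rewrite expn_gt0.
by congr [:: _; _; _; _; _; _; _; _; _; _; _; _; _]; rewrite /=; lia.
Qed.

Theorem vass_complete m x : crun P (start, X) m (acc, x) -> (m < 2 * level_R l + 2)%N ->
  vass_reach 3 V.
Proof.
move=> run mT; have [N N0] := level_starts_reach run mT (leqnn l).
rewrite subnn => HN.
have R : lreach init_t (0%N, start_vec) (0%N, eff 0 0 0 N%:Z (2 * 4%:Z * N%:Z) 4%:Z 0 0 0 0 0).
  apply: lreach_eq.
    by apply: (@lreach_loop _ N _ _ _ _ _ _ _ _ _ _ _ _ 0 0 0 1 8 0 0 0 0 0 0).
  by congr (_, [:: _; _; _; _; _; _; _; _; _; _; _; _; _]); clear; lia.
have s13 : {in init_t, forall t, size t.1.2 = 13%N} by move=> t; rewrite inE => /eqP ->.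
have := lift_reach s13 mem_init R erefl; rewrite /= !mul0n !add0n => R1.
apply: clos_rt_rt1n; apply: rt_trans; first exact: (clos_rt1n_rt _ _ _ _ R1).
exact: clos_rt1n_rt HN.
Qed.

End GlobalRun.

(** * Turing machines as arithmetic programs *)

Definition ri_tuple (i : rinstr) :=
  (ri_src i, ri_q i, ri_p i, ri_r i, ri_r' i, ri_dr i, ri_tgt i).
Definition ri_untuple t :=
  let: (s, q, p, r, r', dr, s') := t in RI s q p r r' dr s'.
Lemma ri_tupleK : cancel ri_tuple ri_untuple. Proof. by case. Qed.
HB.instance Definition _ := Equality.copy rinstr (can_type ri_tupleK).
Set Implicit Arguments. Unset Strict Implicit.

Lemma crun_in P c m c' I k : I \in P -> crun P c m c' ->
  c' = (ri_src I, ri_q I * k + ri_r I) ->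
  crun P c m.+1 (ri_tgt I, ri_p I * k + ri_r' I).
Proof.
move=> /(nthP ri0) [j jlt <-] run E; exact: crunS run jlt E.
Qed.

Lemma crun_trans P c1 m c2 m' c3 : crun P c1 m c2 -> crun P c2 m' c3 -> crun P c1 (m + m') c3.
Proof.
move=> r1; elim=> [|{}m' c' j k _ IH jlt E]; first by rewrite addn0.
by rewrite addnS; apply: crunS IH jlt E.
Qed.

Definition dig (a : option bool) : nat := if a is Some b then b.+1 else 0.

(** Base 3 with the blank as digit 0 and the nearest cell lowest: blanks at the far end do not
    count, which agrees with reading [None] from an empty list. *)
Fixpoint tape_val (s : seq (option bool)) : nat :=
  if s is a :: s' then dig a + 3 * tape_val s' else 0.

Lemma tape_val_head s : dig (head None s) + 3 * tape_val (behead s) = tape_val s.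
Proof. by case: s. Qed.

Lemma tape_val_lt s : tape_val s < 3 ^ size s.
Proof.
elim: s => //= a s IH; rewrite expnS.
have : dig a <= 2 by case: a => [[]|].
by lia.
Qed.

Section Simulation.
Variable M : TM.

Let st := 'I_(tm_n M).+1.
Let sym := option bool.

(* [cstate_push s w d] multiplies the push-side exponent by 3 by moving it to the
   prime 5; [cstate_back] moves it back and adds the digit [w]; [cstate_pop] divides
   the pop-side exponent by 3; [cstate_read s a d] moves the quotient back, the digit
   read being [a]. *)
Definition cstate := (bool * bool * st * (sym * bool) + unit)%type.

Definition ckind (k : bool * bool) (s : st) (a : sym) (d : bool) : cstate := inl ((k, s), (a, d)).
Definition cstate_push := ckind (true, true).
Definition cstate_back := ckind (true, false).
Definition cstate_pop s d := ckind (false, true) s None d.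
Definition cstate_read := ckind (false, false).
Definition cstate_acc : cstate := inr tt.

Definition code (c : cstate) : nat := enum_rank c.

Lemma code_inj : injective code.
Proof. by move=> x y /ord_inj /enum_rank_inj. Qed.

Definition push_prime (d : bool) := if d then 2 else 3.
Definition pop_prime (d : bool) := if d then 3 else 2.

Definition cnext (s : st) (a : sym) : option cstate :=
  if @tm_delta M s a is Some (s', w, d) then Some (cstate_push s' w d)
  else if s == tm_acc M then Some cstate_acc else None.

Definition syms : seq sym := [:: None; Some false; Some true].

(** An instruction applies only if x = q k + r, so non-divisibility by p is tested by one
    instruction for each nonzero residue c. Replacing a factor p by 125 = 5^3 triples the exponent
    while moving it. *)
Definition prog_push (s : st) (w : sym) (d : bool) : seq rinstr :=
  let p := push_prime d in
  RI (code (cstate_push s w d)) p 125 0 0 0 (code (cstate_push s w d)) ::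
  [seq RI (code (cstate_push s w d)) p p c c 0 (code (cstate_back s w d)) | c <- iota 1 p.-1].

Definition prog_back (s : st) (w : sym) (d : bool) : seq rinstr :=
  let p := push_prime d in
  RI (code (cstate_back s w d)) 5 p 0 0 0 (code (cstate_back s w d)) ::
  [seq RI (code (cstate_back s w d)) 5 (p ^ dig w * 5) c (p ^ dig w * c) 0
     (code (cstate_pop s d)) | c <- iota 1 4].

(** The exit for the symbol a applies exactly when q occurs in x with exponent [dig a]. Since the
    loop removes q^3, this is the lowest base 3 digit, and the exit deletes it. *)
Definition prog_pop (s : st) (d : bool) : seq rinstr :=
  let q := pop_prime d in
  RI (code (cstate_pop s d)) (q ^ 3) 5 0 0 0 (code (cstate_pop s d)) ::
  flatten [seq [seq RI (code (cstate_pop s d)) (q ^ dig a * q) q (q ^ dig a * c) c 0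
     (code (cstate_read s a d)) | c <- iota 1 q.-1] | a <- syms].

Definition prog_read (s : st) (a : sym) (d : bool) : seq rinstr :=
  let q := pop_prime d in
  RI (code (cstate_read s a d)) 5 q 0 0 0 (code (cstate_read s a d)) ::
  if cnext s a is Some c' then
    [seq RI (code (cstate_read s a d)) 5 5 c c 0 (code c') | c <- iota 1 4]
  else [::].

Definition tm_prog : seq rinstr :=
  flatten [seq prog_push x.1.1 x.1.2 x.2 ++ prog_back x.1.1 x.1.2 x.2 ++
               prog_pop x.1.1 x.2 ++ prog_read x.1.1 x.1.2 x.2
          | x <- enum {: st * sym * bool}].

Lemma mem_prog_parts s a d :
  [/\ {subset prog_push s a d <= tm_prog}, {subset prog_back s a d <= tm_prog},
      {subset prog_pop s d <= tm_prog} & {subset prog_read s a d <= tm_prog}].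
Proof.
by split=> x xin; apply/flatten_mapP; exists ((s, a), d); rewrite ?mem_enum // !mem_cat xin ?orbT.
Qed.

Lemma mem_progP x : x \in tm_prog -> exists s a d,
  [\/ x \in prog_push s a d, x \in prog_back s a d, x \in prog_pop s d | x \in prog_read s a d].
Proof.
move/flatten_mapP => [[[s a] d] _]; rewrite !mem_cat => /or4P H; exists s, a, d.
by case: H => H; [apply: Or41|apply: Or42|apply: Or43|apply: Or44].
Qed.

Lemma code_lt c : code c < #|{: cstate}|. Proof. exact: ltn_ord. Qed.

Lemma tm_prog_states j : j < size tm_prog ->
  (ri_src (nth ri0 tm_prog j) < #|{: cstate}|) && (ri_tgt (nth ri0 tm_prog j) < #|{: cstate}|).
Proof.
move/(mem_nth ri0); move: (nth _ _ _) => x /mem_progP [s [a [d []]]];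
  rewrite inE => /orP[/eqP -> /=|]; rewrite ?code_lt //.
- by move/mapP => [c _ ->]; rewrite /= !code_lt.
- by move/mapP => [c _ ->]; rewrite /= !code_lt.
- by move/flatten_mapP => [b _ /mapP [c _ ->]]; rewrite /= !code_lt.
- by case: cnext => [c'|//]; move/mapP => [c _ ->]; rewrite /= !code_lt.
Qed.

Variable w0 : seq bool.

Definition reached (c : config M) : Prop := exists t, tm_steps t (tm_init M w0) = Some c.

Definition push_val (d : bool) (c : config M) : nat :=
  tape_val (if d then c_left c else c_right c).
Definition pop_val (d : bool) (c : config M) : nat :=
  tape_val (if d then c_right c else c_left c).

Lemma prime_prod d c :
  push_prime d ^ push_val d c * pop_prime d ^ pop_val d c =
  2 ^ tape_val (c_left c) * 3 ^ tape_val (c_right c).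
Proof. by case: d => //; rewrite mulnC. Qed.

Lemma tm_step_vals c s w d : @tm_delta M (c_state c) (c_cur c) = Some (s, w, d) ->
  exists c', [/\ tm_step c = Some c', c_state c' = s,
    push_val d c' = dig w + 3 * push_val d c &
    dig (c_cur c') + 3 * pop_val d c' = pop_val d c].
Proof.
rewrite /tm_step => ->; case: d; eexists; split=> //=; exact: tape_val_head.
Qed.

Lemma reached_step c c' : reached c -> tm_step c = Some c' -> reached c'.
Proof. by case=> t tc cc'; exists t.+1; rewrite /= tc. Qed.

(** Inside a phase, j measures what is currently stored in the exponent of 5 and i what is left at
    the other prime; their weighted sum is fixed by a reached configuration. *)
Definition cinv (y : cstate) (x : nat) : Prop :=
  match y with
  | inl ((true, true, s), (w, d)) => exists c i j,
      [/\ reached c, @tm_delta M (c_state c) (c_cur c) = Some (s, w, d),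
         x = push_prime d ^ i * 5 ^ (3 * j) * pop_prime d ^ pop_val d c &
         i + j = push_val d c]
  | inl ((true, false, s), (w, d)) => exists c i j,
      [/\ reached c, @tm_delta M (c_state c) (c_cur c) = Some (s, w, d),
         x = push_prime d ^ i * 5 ^ j * pop_prime d ^ pop_val d c &
         i + j = 3 * push_val d c]
  | inl ((false, true, s), (_, d)) => exists c i j,
      [/\ reached c, c_state c = s,
         x = push_prime d ^ push_val d c * pop_prime d ^ i * 5 ^ j &
         i + 3 * j = dig (c_cur c) + 3 * pop_val d c]
  | inl ((false, false, s), (a, d)) => exists c i j,
      [/\ reached c, c_state c = s /\ c_cur c = a,
         x = push_prime d ^ push_val d c * pop_prime d ^ i * 5 ^ j &
         i + j = pop_val d c]
  | inr tt => exists c, [/\ reached c, tm_step c = None & c_state c = tm_acc M]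
  end.

Lemma dvd_pow_gt0 p i n x : prime p -> coprime p n -> p %| x -> x = p ^ i * n -> 0 < i.
Proof.
move=> pp pn px xE; case: i xE => // xE; move: px; rewrite xE expn0 mul1n.
by move: (prime_gt1 pp) pn; rewrite prime_coprime // => _ /negPf ->.
Qed.

Lemma ndvd_pow_eq0 p i n : ~~ (p %| p ^ i * n) -> i = 0.
Proof. by case: i => // i; rewrite expnS -mulnA dvdn_mulr. Qed.

Lemma push_primeP d : prime (push_prime d). Proof. by case: d. Qed.
Lemma pop_primeP d : prime (pop_prime d). Proof. by case: d. Qed.

Lemma cop_push d i j : coprime (push_prime d) (5 ^ i * pop_prime d ^ j).
Proof. by rewrite coprimeMr !coprimeXr //; case: d. Qed.
Lemma cop_pop d i j : coprime (pop_prime d) (push_prime d ^ i * 5 ^ j).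
Proof. by rewrite coprimeMr !coprimeXr //; case: d. Qed.
Lemma cop_5 d i j : coprime 5 (push_prime d ^ i * pop_prime d ^ j).
Proof. by rewrite coprimeMr !coprimeXr //; case: d. Qed.

Lemma ndvd_res p k c : c \in iota 1 p.-1 -> ~~ (p %| p * k + c).
Proof.
rewrite mem_iota => /andP[c0 cp]; rewrite dvdn_addr ?dvdn_mulr // gtnNdvd //.
by case: p cp => [|p]; rewrite /= ?add1n; lia.
Qed.

Lemma cinv_push s w d I k : I \in prog_push s w d ->
  cinv (cstate_push s w d) (ri_q I * k + ri_r I) ->
  exists2 y, ri_tgt I = code y & cinv y (ri_p I * k + ri_r' I).
Proof.
rewrite inE => /orP[/eqP -> /=|/mapP [e ein -> /=]].
  case=> c [i] [j] [rc dc xE ij]; exists (cstate_push s w d) => //=.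
  have i0 : 0 < i.
    apply: (@dvd_pow_gt0 _ _ _ (push_prime d * k) (push_primeP d)
      (cop_push d (3 * j) (pop_val d c))); first by rewrite dvdn_mulr.
    by rewrite mulnA -xE addn0.
  exists c, i.-1, j.+1; split=> //; last by lia.
  case: i i0 xE {ij} => // i _ /eqP; rewrite addn0 expnS -!mulnA eqn_pmul2l ?prime_gt0 ?push_primeP //.
  move/eqP => -> /=; rewrite addn0 mulnS expnD; lia.
case=> c [i] [j] [rc dc xE ij]; exists (cstate_back s w d) => //=.
exists c, 0, (3 * j); have i0 : i = 0.
  have := ndvd_res k ein; rewrite [X in _ %| X]xE -mulnA => nd.
  exact: ndvd_pow_eq0 nd.
by split=> //; rewrite ?xE ?i0 //; lia.
Qed.

Lemma cinv_back s w d I k : I \in prog_back s w d ->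
  cinv (cstate_back s w d) (ri_q I * k + ri_r I) ->
  exists2 y, ri_tgt I = code y & cinv y (ri_p I * k + ri_r' I).
Proof.
rewrite inE => /orP[/eqP -> /=|/mapP [e ein ->] /=].
  case=> c [i] [j] [rc dc xE ij]; exists (cstate_back s w d) => //=.
  have {}xE : 5 * k = 5 ^ j * (push_prime d ^ i * pop_prime d ^ pop_val d c).
    by rewrite -[5 * k]addn0 xE; lia.
  have j0 : 0 < j.
    apply: (@dvd_pow_gt0 _ _ _ (5 * k) _ (cop_5 d i (pop_val d c))) => //.
    exact: dvdn_mulr.
  exists c, i.+1, j.-1; split=> //; last by lia.
  case: j j0 xE {ij} => // j _ /eqP; rewrite expnS -!mulnA eqn_pmul2l //.
  by move/eqP => -> /=; rewrite addn0 expnS; lia.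
case=> c [i] [j] [rc dc xE ij]; exists (cstate_pop s d) => //=.
have j0 : j = 0.
  have := ndvd_res (p := 5) k ein; rewrite [X in _ %| X]xE mulnAC mulnC => nd.
  exact: ndvd_pow_eq0 nd.
have [c' [cc' sc' pv qv]] := tm_step_vals dc.
exists c', (pop_val d c), 0; split=> //; last by rewrite muln0 addn0.
  exact: reached_step cc'.
rewrite pv expnD -mulnA -mulnDr xE j0 -ij j0 !addn0 !expn0 !muln1.
by rewrite -mulnA; congr (_ * (_ * _)); congr (_ ^ _); lia.
Qed.

Lemma cinv_pop s d I k : I \in prog_pop s d ->
  cinv (cstate_pop s d) (ri_q I * k + ri_r I) ->
  exists2 y, ri_tgt I = code y & cinv y (ri_p I * k + ri_r' I).
Proof.
have q0 : 0 < pop_prime d by rewrite prime_gt0 ?pop_primeP.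
rewrite inE => /orP[/eqP -> /=|/flatten_mapP [a ain /mapP [e ein ->]] /=].
  case=> c [i] [j] [rc sc xE ij]; exists (cstate_pop s d) => //=.
  have {}xE : pop_prime d ^ 3 * k = pop_prime d ^ i * (push_prime d ^ push_val d c * 5 ^ j).
    by rewrite -[_ * k]addn0 xE; lia.
  have dvd3 : pop_prime d ^ 3 %| pop_prime d ^ i.
    have cop : coprime (pop_prime d ^ 3) (push_prime d ^ push_val d c * 5 ^ j).
      by rewrite coprimeXl // cop_pop.
    by rewrite -(Gauss_dvdl _ cop) -xE dvdn_mulr.
  have i3 : 3 <= i by rewrite dvdn_Pexp2l // in dvd3; apply: prime_gt1 (pop_primeP d).
  exists c, (i - 3), j.+1; split=> //; last by lia.
  move/eqP: xE; rewrite -{1}(subnKC i3) expnD -mulnA eqn_pmul2l ?expn_gt0 ?q0 //.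
  by move/eqP => ->; rewrite addn0 expnS; lia.
case=> c [i] [j] [rc sc xE ij]; exists (cstate_read s a d) => //=.
have {}xE : pop_prime d ^ dig a * (pop_prime d * k + e) =
    pop_prime d ^ i * (push_prime d ^ push_val d c * 5 ^ j) by lia.
have nd := ndvd_res k ein.
(* Comparing the multiplicities of the popped prime on both sides recovers the digit. *)
have ia : i = dig a.
  have := congr1 (logn (pop_prime d)) xE.
  have y0 : 0 < pop_prime d * k + e.
    by rewrite lt0n; apply: contra nd => /eqP ->; rewrite dvdn0.
  have p0 : 0 < push_prime d by rewrite prime_gt0 ?push_primeP.
  rewrite !lognM ?muln_gt0 ?expn_gt0 ?q0 ?p0 //.
  rewrite !pfactorK ?pop_primeP // !lognX => E.
  have l0 x : ~~ (pop_prime d %| x) -> logn (pop_prime d) x = 0.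
    by move=> nx; rewrite lognE (negPf nx) !andbF.
  move: E; rewrite (l0 _ nd) (l0 (push_prime d)) ?(l0 5); try by case: (d).
  by lia.
move/eqP: xE; rewrite ia eqn_pmul2l ?expn_gt0 ?q0 // => /eqP xE.
have ac : c_cur c = a /\ j = pop_val d c.
  move: ij; rewrite ia.
  have [a2 c2] : dig a <= 2 /\ dig (c_cur c) <= 2 by split; [case: (a) => [[]|]|case: (c_cur c) => [[]|]].
  move=> E; have [E1 E2] : dig a = dig (c_cur c) /\ j = pop_val d c by lia.
  by split=> //; case: (a) (c_cur c) E1 => [[]|] [[]|].
case: ac => ac jE.
exists c, 0, j; split=> //; first by rewrite xE expn0 muln1.
Qed.

Lemma cinv_read s a d I k : I \in prog_read s a d ->
  cinv (cstate_read s a d) (ri_q I * k + ri_r I) ->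
  exists2 y, ri_tgt I = code y & cinv y (ri_p I * k + ri_r' I).
Proof.
rewrite inE => /orP[/eqP -> /=|].
  case=> c [i] [j] [rc sc xE ij]; exists (cstate_read s a d) => //=.
  have {}xE : 5 * k = 5 ^ j * (push_prime d ^ push_val d c * pop_prime d ^ i).
    by rewrite -[5 * k]addn0 xE; lia.
  have j0 : 0 < j.
    apply: (@dvd_pow_gt0 _ _ _ (5 * k) _ (cop_5 d (push_val d c) i)) => //.
    exact: dvdn_mulr.
  exists c, i.+1, j.-1; split=> //; last by lia.
  case: j j0 xE {ij} => // j _ /eqP; rewrite expnS -!mulnA eqn_pmul2l //.
  by move/eqP => -> /=; rewrite addn0 expnS; lia.
case E: cnext => [y|//] /mapP [e ein ->] /= [c] [i] [j] [rc [sc ac] xE ij].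
have j0 : j = 0.
  have := ndvd_res (p := 5) k ein; rewrite [X in _ %| X]xE mulnC => nd.
  exact: ndvd_pow_eq0 nd.
exists y => //; move: E; rewrite /cnext -sc -ac.
case dc: tm_delta => [[[s' w] d']|].
  case=> <-; exists c, (push_val d' c), 0; split=> //; last by rewrite addn0.
  by rewrite muln0 muln1 prime_prod -(prime_prod d) xE j0 -ij j0 addn0 muln1.
case: eqP => // sacc [<-]; exists c; split=> //.
by rewrite /tm_step dc.
Qed.

(** The start is a pop from the right tape with the whole input still on it: this pop reads the
    first letter and so produces the initial configuration. *)
Lemma tm_prog_sound m x :
  crun tm_prog (code (cstate_pop ord0 true), 3 ^ tape_val (map Some w0)) m (code cstate_acc, x) ->
  exists c, [/\ reached c, tm_step c = None & c_state c = tm_acc M].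
Proof.
move: {-1}(code cstate_acc, x) (erefl (code cstate_acc, x)) => e eE run.
have : exists2 y, e.1 = code y & cinv y e.2.
  elim: run {eE} => [|{}m c j k _ [y /= yE yinv] jlt cE].
    exists (cstate_pop ord0 true) => //; exists (tm_init M w0), (tape_val (map Some w0)), 0.
    split=> //; first by exists 0.
    - by rewrite mul1n muln1.
    - by rewrite /= tape_val_head addn0.
  have := mem_nth ri0 jlt; move: (nth _ _ _) cE => I cE; rewrite {}cE /= in yE yinv.
  move/mem_progP => [s [a [d H]]].
  have src z : ri_src I = code z -> cinv z (ri_q I * k + ri_r I).
    by rewrite yE => /code_inj <-.
  case: H => H.
  - apply: cinv_push (H) _; apply: src.
    by move: H; rewrite inE => /orP[/eqP ->|/mapP [? _ ->]].
  - apply: cinv_back (H) _; apply: src.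
    by move: H; rewrite inE => /orP[/eqP ->|/mapP [? _ ->]].
  - apply: cinv_pop (H) _; apply: src.
    by move: H; rewrite inE => /orP[/eqP ->|/flatten_mapP [? _ /mapP [? _ ->]]].
  - apply: cinv_read (H) _; apply: src.
    by move: H; rewrite inE => /orP[/eqP ->|] //; case: cnext => // ? /mapP [? _ ->].
by rewrite -eE => -[y /= /code_inj <-].
Qed.

End Simulation.

Arguments cstate_push {M}.
Arguments cstate_back {M}.
Arguments cstate_pop {M}.
Arguments cstate_read {M}.
Arguments cnext {M}.
Arguments code {M}.
Arguments push_val {M}.
Arguments pop_val {M}.
Arguments prime_prod {M}.

(** * The program follows the machine, with a bound on the number of steps *)

Section SimulationRuns.
Variable M : TM.
Let P := tm_prog M.

Lemma crun1 I k : I \in P ->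
  crun P (ri_src I, ri_q I * k + ri_r I) 1 (ri_tgt I, ri_p I * k + ri_r' I).
Proof. by move=> IP; exact: (@crun_in P _ _ _ I k IP (crun0 _ _)). Qed.

Lemma res_in p x : 1 < p -> ~~ (p %| x) -> x %% p \in iota 1 p.-1.
Proof.
move=> p1 nd; rewrite mem_iota; move: nd; rewrite /dvdn; have := @ltn_pmod x p; lia.
Qed.

Lemma ndvd_coprime p x : 1 < p -> coprime p x -> ~~ (p %| x).
Proof.
move=> p1; rewrite /coprime => /eqP g; apply/negP => /gcdn_idPl e.
by move: p1; rewrite -e g.
Qed.

Lemma push_run (s : 'I_(tm_n M).+1) w d i j V :
  crun P (code (cstate_push s w d), push_prime d ^ i * 5 ^ (3 * j) * pop_prime d ^ V) i.+1
         (code (cstate_back s w d), 5 ^ (3 * (i + j)) * pop_prime d ^ V).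
Proof.
have [sub _ _ _] := mem_prog_parts s w d.
have p1 : 1 < push_prime d := prime_gt1 (push_primeP d).
elim: i j => [|i IH] j.
  rewrite expn0 mul1n add0n; set x := _ * _.
  have nd : ~~ (push_prime d %| x) by apply: ndvd_coprime => //; apply: cop_push.
  have := @crun1 (RI (code (cstate_push s w d)) (push_prime d) (push_prime d)
    (x %% push_prime d) (x %% push_prime d) 0 (code (cstate_back s w d))) (x %/ push_prime d).
  rewrite /= mulnC -divn_eq; apply.
  apply: sub; rewrite inE; apply/orP; right.
  by apply/mapP; exists (x %% push_prime d) => //; apply: res_in.
rewrite (addSnnS i j) -[i.+2]/(1 + i.+1).
apply: crun_trans (IH j.+1).
have := @crun1 (RI (code (cstate_push s w d)) (push_prime d) 125 0 0 0 (code (cstate_push s w d)))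
  (push_prime d ^ i * 5 ^ (3 * j) * pop_prime d ^ V) (sub _ (mem_head _ _)).
rewrite /= !addn0 expnS -!mulnA.
by congr (crun _ _ _ (_, _)); rewrite mulnS expnD; lia.
Qed.

Lemma back_run (s : 'I_(tm_n M).+1) w d i j V :
  crun P (code (cstate_back s w d), push_prime d ^ i * 5 ^ j * pop_prime d ^ V) j.+1
         (code (cstate_pop s d), push_prime d ^ (dig w + (i + j)) * pop_prime d ^ V).
Proof.
have [_ sub _ _] := mem_prog_parts s w d.
elim: j i => [|j IH] i.
  rewrite expn0 muln1 addn0; set x := _ * pop_prime d ^ _.
  have nd : ~~ (5 %| x) by apply: ndvd_coprime => //; apply: cop_5.
  have := @crun1 (RI (code (cstate_back s w d)) 5 (push_prime d ^ dig w * 5)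
    (x %% 5) (push_prime d ^ dig w * (x %% 5)) 0 (code (cstate_pop s d))) (x %/ 5).
  have xE : 5 * (x %/ 5) + x %% 5 = x by rewrite mulnC -divn_eq.
  rewrite /= -mulnA -mulnDr xE expnD -mulnA; apply.
  by apply: sub; rewrite inE; apply/orP; right; apply/mapP; exists (x %% 5) => //; apply: (@res_in 5).
rewrite -(addSnnS i j) -[j.+2]/(1 + j.+1).
apply: crun_trans (IH i.+1).
have := @crun1 (RI (code (cstate_back s w d)) 5 (push_prime d) 0 0 0 (code (cstate_back s w d)))
  (push_prime d ^ i * 5 ^ j * pop_prime d ^ V) (sub _ (mem_head _ _)).
rewrite /= !addn0 !expnS.
by congr (crun _ (_, _) _ (_, _)); lia.
Qed.

Lemma pop_run (s : 'I_(tm_n M).+1) a d U n j :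
  crun P (code (cstate_pop s d), push_prime d ^ U * pop_prime d ^ (dig a + 3 * n) * 5 ^ j) n.+1
         (code (cstate_read s a d), push_prime d ^ U * 5 ^ (n + j)).
Proof.
have [_ _ sub _] := mem_prog_parts s a d.
have q1 : 1 < pop_prime d := prime_gt1 (pop_primeP d).
elim: n j => [|n IH] j.
  rewrite muln0 addn0 mulnAC add0n; set x := push_prime d ^ U * 5 ^ j; rewrite [x * _]mulnC.
  have nd : ~~ (pop_prime d %| x) by apply: ndvd_coprime => //; apply: cop_pop.
  have := @crun1 (RI (code (cstate_pop s d)) (pop_prime d ^ dig a * pop_prime d) (pop_prime d)
    (pop_prime d ^ dig a * (x %% pop_prime d)) (x %% pop_prime d) 0
    (code (cstate_read s a d))) (x %/ pop_prime d).
  have xE : pop_prime d * (x %/ pop_prime d) + x %% pop_prime d = x by rewrite mulnC -divn_eq.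
  rewrite /= -mulnA -mulnDr xE; apply.
  apply: sub; rewrite inE; apply/orP; right; apply/flatten_mapP; exists a.
    by case: (a) => [[]|].
  by apply/mapP; exists (x %% pop_prime d) => //; apply: res_in.
rewrite (addSnnS n j) -[n.+2]/(1 + n.+1).
apply: crun_trans (IH j.+1).
have := @crun1 (RI (code (cstate_pop s d)) (pop_prime d ^ 3) 5 0 0 0 (code (cstate_pop s d)))
  (push_prime d ^ U * pop_prime d ^ (dig a + 3 * n) * 5 ^ j) (sub _ (mem_head _ _)).
rewrite /= !addn0 [5 ^ j.+1]expnS mulnS addnCA (expnD _ 3 (dig a + 3 * n)).
by congr (crun _ (_, _) _ (_, _)); lia.
Qed.

Lemma read_run (s : 'I_(tm_n M).+1) a d U i j :
  crun P (code (cstate_read s a d), push_prime d ^ U * pop_prime d ^ i * 5 ^ j) j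
         (code (cstate_read s a d), push_prime d ^ U * pop_prime d ^ (i + j)).
Proof.
have [_ _ _ sub] := mem_prog_parts s a d.
elim: j i => [|j IH] i; first by rewrite addn0 expn0 muln1; apply: crun0.
rewrite -(addSnnS i j) -{2}[j.+1]/(1 + j).
apply: crun_trans (IH i.+1).
have := @crun1 (RI (code (cstate_read s a d)) 5 (pop_prime d) 0 0 0 (code (cstate_read s a d)))
  (push_prime d ^ U * pop_prime d ^ i * 5 ^ j) (sub _ (mem_head _ _)).
rewrite /= !addn0 !expnS.
by congr (crun _ (_, _) _ (_, _)); lia.
Qed.

Lemma read_exit (s : 'I_(tm_n M).+1) a d U V y : cnext s a = Some y ->
  crun P (code (cstate_read s a d), push_prime d ^ U * pop_prime d ^ V) 1
         (code y, push_prime d ^ U * pop_prime d ^ V).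
Proof.
have [_ _ _ sub] := mem_prog_parts s a d.
move=> E; set x := _ * _.
have nd : ~~ (5 %| x) by apply: ndvd_coprime => //; apply: cop_5.
have := @crun1 (RI (code (cstate_read s a d)) 5 5 (x %% 5) (x %% 5) 0 (code y)) (x %/ 5).
rewrite /= mulnC -divn_eq; apply.
apply: sub; rewrite inE; apply/orP; right; rewrite E.
by apply/mapP; exists (x %% 5) => //; apply: (@res_in 5).
Qed.

Variable w0 : seq bool.
Let c0 := (code (cstate_pop (ord0 : 'I_(tm_n M).+1) true), 3 ^ tape_val (map Some w0)).

Lemma tm_steps_size t c : tm_steps t (tm_init M w0) = Some c ->
  size (c_left c) <= t /\ size (c_right c) <= size w0 + t.
Proof.
elim: t c => [|t IH] c /=.
  by case=> <- /=; rewrite size_behead size_map addn0 leq_pred.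
case E: tm_steps => [c'|//]; have [l r] := IH _ E.
rewrite /tm_step; case: tm_delta => [[[s w] []]|//] [<-] /=; rewrite ?size_behead; lia.
Qed.

(** The loops are as long as multiples of the exponents, which are below 3 to the number of cells in
    use. So one machine step costs at most 9 * 3^(size w0 + t) instructions. The direction d is that
    of the last move, the right one at the start. *)
Lemma tm_prog_run t c : tm_steps t (tm_init M w0) = Some c ->
  exists m d, crun P c0 m (code (cstate_read (c_state c) (c_cur c) d),
      push_prime d ^ push_val d c * pop_prime d ^ pop_val d c) /\
    m <= 9 * t.+1 * 3 ^ (size w0 + t).
Proof.
elim: t c => [|t IH] c /=.
  case=> <-; set ci := tm_init M w0.
  have := @pop_run ord0 (c_cur ci) true 0 (tape_val (c_right ci)) 0.
  have := @read_run ord0 (c_cur ci) true 0 0 (tape_val (c_right ci)).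
  rewrite !addn0 /= !mul1n !muln1 add0n => r2 r1.
  have := crun_trans r1 r2; rewrite /ci /= tape_val_head => r.
  eexists; exists true; split; first by rewrite /= mul1n; exact: r.
  have := tape_val_lt (map Some w0); rewrite -tape_val_head size_map ?addn0.
  lia.
case E: tm_steps => [c'|//] st; have [m [d [r mle]]] := IH _ E.
have [sl sr] := tm_steps_size E.
case dc: (@tm_delta M (c_state c') (c_cur c')) => [[[s w] d']|]; last first.
  by move: st; rewrite /tm_step dc.
have [c'' [st' sc pv qv]] := tm_step_vals dc.
have {}st' : c'' = c by move: st'; rewrite st => -[].
subst c''.
have nx : cnext (c_state c') (c_cur c') = Some (cstate_push s w d') by rewrite /cnext dc.
have r1 := read_exit d (push_val d c') (pop_val d c') nx.
have r2 := push_run s w d' (push_val d' c') 0 (pop_val d' c').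
have r3 := back_run s w d' 0 (3 * push_val d' c') (pop_val d' c').
have r4 := pop_run s (c_cur c) d' (push_val d' c) (pop_val d' c) 0.
have r5 := read_run s (c_cur c) d' (push_val d' c) 0 (pop_val d' c).
rewrite prime_prod -(prime_prod d') in r1.
rewrite prime_prod -(prime_prod d') in r.
rewrite muln0 expn0 muln1 addn0 in r2.
rewrite expn0 mul1n add0n -pv -qv in r3.
rewrite expn0 muln1 addn0 in r4.
rewrite expn0 muln1 add0n in r5.
rewrite -[in X in crun _ _ _ X]qv in r2.
have R := crun_trans r (crun_trans r1 (crun_trans r2 (crun_trans r3 (crun_trans r4 r5)))).
eexists; exists d'; split; first by rewrite sc; exact: R.
have vl : push_val d' c' + pop_val d' c' < 2 * 3 ^ (size w0 + t).
  have l1 := leq_trans (tape_val_lt (c_left c')) (leq_pexp2l (isT : 0 < 3) sl).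
  have l2 := leq_trans (tape_val_lt (c_right c')) (leq_pexp2l (isT : 0 < 3) sr).
  have l3 : 3 ^ t <= 3 ^ (size w0 + t) by rewrite leq_pexp2l // leq_addl.
  by rewrite /push_val /pop_val; case: (d'); lia.
rewrite addnS expnS; move: mle vl; set X := 3 ^ _ => mle vl.
have X0 : 0 < X by rewrite expn_gt0.
have qle : 3 * pop_val d' c <= pop_val d' c' by lia.
apply: (@leq_trans (9 * t.+1 * X + 9 * X)); last by nia.
by lia.
Qed.

Lemma tm_prog_complete t c : tm_steps t (tm_init M w0) = Some c -> tm_step c = None ->
  c_state c = tm_acc M ->
  exists m x, crun P c0 m (code (cstate_acc M), x) /\ m <= (9 * t.+1 * 3 ^ (size w0 + t)).+1.
Proof.
move=> tc st ac; have [m [d [r mle]]] := tm_prog_run tc.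
have nx : cnext (c_state c) (c_cur c) = Some (cstate_acc M).
  rewrite /cnext; case dc: tm_delta => [[[s w] d']|]; last by rewrite ac eqxx.
  by move: st; rewrite /tm_step dc; case: d' {dc}.
have R := crun_trans r (read_exit d (push_val d c) (pop_val d c) nx).
by do 2 eexists; split; [exact: R | rewrite addn1 ltnS].
Qed.

End SimulationRuns.

(** * Programming Turing machines *)

Notation tape := (int -> option bool).

Definition upd (t : tape) (x : int) (a : option bool) : tape := fun y => if y == x then a else t y.

Definition move (r : bool) (x : int) : int := if r then (x + 1)%R else (x - 1)%R.

(* The tests of [TIf] and [TWhile] are programs themselves, since a machine cannot
   inspect a cell without moving; every program ends with an exit code. *)
Inductive tprog :=
| TStep of (option bool -> option bool * bool * bool)
| TSeq of tprog & tprog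
| TIf of tprog & tprog & tprog
| TWhile of tprog & tprog.

Inductive texec : tprog -> tape * int -> bool -> tape * int -> nat -> Prop :=
| XStep f t x :
    texec (TStep f) (t, x) (f (t x)).2 (upd t x (f (t x)).1.1, move (f (t x)).1.2 x) 1
| XSeq p q c e c1 n e' c2 m :
    texec p c e c1 n -> texec q c1 e' c2 m -> texec (TSeq p q) c e' c2 (n + m)
| XIf p q1 q2 c (e : bool) c1 n e' c2 m :
    texec p c e c1 n -> texec (if e then q1 else q2) c1 e' c2 m ->
    texec (TIf p q1 q2) c e' c2 (n + m)
| XWhileF p q c c1 n : texec p c false c1 n -> texec (TWhile p q) c false c1 n
| XWhileT p q c c1 n e c2 m e' c3 k :
    texec p c true c1 n -> texec q c1 e c2 m -> texec (TWhile p q) c2 e' c3 k ->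
    texec (TWhile p q) c e' c3 (n + (m + k)).

Fixpoint tsize (p : tprog) : nat :=
  match p with
  | TStep _ => 1
  | TSeq p q => tsize p + tsize q
  | TIf p q1 q2 => tsize p + (tsize q1 + tsize q2)
  | TWhile p q => tsize p + tsize q
  end.

Definition target (o : nat) (k : bool -> nat + bool) (r : nat + bool) : nat + bool :=
  match r with inl s => inl (o + s) | inr e => k e end.

Definition retarget o k (x : (nat + bool) * option bool * bool) :=
  (target o k x.1.1, x.1.2, x.2).

Fixpoint tdelta (p : tprog) (s : nat) (a : option bool) : (nat + bool) * option bool * bool :=
  match p with
  | TStep f => (inr (f a).2, (f a).1.1, (f a).1.2)
  | TSeq p q =>
      if s < tsize p then retarget 0 (fun _ => inl (tsize p)) (tdelta p s a)
      else retarget (tsize p) inr (tdelta q (s - tsize p) a)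
  | TIf p q1 q2 =>
      if s < tsize p then
        retarget 0 (fun e => inl (if e then tsize p else tsize p + tsize q1)) (tdelta p s a)
      else if s < tsize p + tsize q1 then retarget (tsize p) inr (tdelta q1 (s - tsize p) a)
      else retarget (tsize p + tsize q1) inr (tdelta q2 (s - (tsize p + tsize q1)) a)
  | TWhile p q =>
      if s < tsize p then
        retarget 0 (fun e => if e then inl (tsize p) else inr false) (tdelta p s a)
      else retarget (tsize p) (fun _ => inl 0) (tdelta q (s - tsize p) a)
  end.

Lemma tsize_gt0 p : 0 < tsize p.
Proof. by elim: p => //= *; rewrite addn_gt0; apply/orP; left. Qed.

Lemma tdelta_lt p s a s' : s < tsize p -> (tdelta p s a).1.1 = inl s' -> s' < tsize p.
Proof.
elim: p s s' => //= [p IHp q IHq|p IHp q1 IH1 q2 IH2|p IHp q IHq] s s'; have p0 := tsize_gt0 p.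
- have q0 := tsize_gt0 q; case: ifP => sp slt /=.
    by case E: (tdelta p s a).1.1 => [u|e] [<-]; [have := IHp _ _ sp E|]; lia.
  case E: (tdelta q _ a).1.1 => [u|e] //= [<-].
  by have := IHq _ _ _ E; lia.
- have q0 := tsize_gt0 q1; have q0' := tsize_gt0 q2; case: ifP => sp slt /=.
    by case E: (tdelta p s a).1.1 => [u|[]] [<-]; [have := IHp _ _ sp E| |]; lia.
  case: ifP => sq /=.
    by case E: (tdelta q1 _ a).1.1 => [u|e] //= [<-]; have := IH1 _ _ _ E; lia.
  by case E: (tdelta q2 _ a).1.1 => [u|e] //= [<-]; have := IH2 _ _ _ E; lia.
- have q0 := tsize_gt0 q; case: ifP => sp slt /=.
    by case E: (tdelta p s a).1.1 => [u|[]] //= [<-]; [have := IHp _ _ sp E|]; lia.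
  by case E: (tdelta q _ a).1.1 => [u|e] //= [<-]; [have := IHq _ _ _ E|]; lia.
Qed.

Inductive trun (p : tprog) : nat -> tape * int -> bool -> tape * int -> nat -> Prop :=
| RExit s t x e : (tdelta p s (t x)).1.1 = inr e ->
    trun p s (t, x) e (upd t x (tdelta p s (t x)).1.2, move (tdelta p s (t x)).2 x) 1
| RStep s t x s' e c n : (tdelta p s (t x)).1.1 = inl s' ->
    trun p s' (upd t x (tdelta p s (t x)).1.2, move (tdelta p s (t x)).2 x) e c n ->
    trun p s (t, x) e c n.+1.

Definition tcont (p : tprog) (k : nat + bool) c e c' n : Prop :=
  match k with
  | inl s => trun p s c e c' n
  | inr e0 => [/\ e0 = e, c = c' & n = 0]
  end.

(** One statement for all ways of composing: [p] occupies the states of [P] from o on, and [k] says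
    how [P] goes on after each exit code of [p]. *)
Lemma trun_embed P p o (k : bool -> nat + bool) s c e c1 n e' c2 m :
  (forall s a, s < tsize p -> tdelta P (o + s) a = retarget o k (tdelta p s a)) ->
  s < tsize p -> trun p s c e c1 n -> tcont P (k e) c1 e' c2 m -> trun P (o + s) c e' c2 (n + m).
Proof.
move=> HP slt R; elim: R slt => {s c e c1 n} [s t x e dE|s t x s' e c n dE _ IH] slt K.
  have D := HP s (t x) slt; have D1 : (tdelta P (o + s) (t x)).1.1 = k e by rewrite D /= dE.
  case kE: (k e) K D1 => [u|e0] /= K D1.
    by apply: (RStep D1); rewrite D.
  by case: K => <- <- ->; rewrite addn0; have := RExit D1; rewrite D.
have D := HP s (t x) slt; have D1 : (tdelta P (o + s) (t x)).1.1 = inl (o + s') by rewrite D /= dE.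
by apply: (RStep D1); rewrite D; apply: IH K; apply: tdelta_lt dE.
Qed.

Lemma texec_trun p c e c' n : texec p c e c' n -> trun p 0 c e c' n.
Proof.
elim=> {p c e c' n}.
- by move=> f t x; apply: (@RExit (TStep f)).
- move=> p q c e c1 n e' c2 m _ R1 _ R2.
  apply: (@trun_embed _ p 0 (fun _ => inl (tsize p)) 0) R1 _ => [s a slt||/=].
  + by rewrite /= slt.
  + exact: tsize_gt0.
  rewrite -[tsize p]addn0 -[m]addn0.
  apply: (@trun_embed _ q (tsize p) inr 0) R2 _ => [s a slt||//].
  + by rewrite /= ltnNge leq_addr /= addKn.
  + exact: tsize_gt0.
- move=> p q1 q2 c e c1 n e' c2 m _ R1 _ R2.
  apply: (@trun_embed _ p 0 (fun e => inl (if e then tsize p else tsize p + tsize q1)) 0) R1 _.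
  + by move=> s a slt; rewrite /= slt.
  + exact: tsize_gt0.
  rewrite /=; case: e R2 => R2.
    rewrite -[tsize p]addn0 -[m]addn0.
    apply: (@trun_embed _ q1 (tsize p) inr 0) R2 _ => [s a slt||//].
    + by rewrite /= ltnNge leq_addr /= ltn_add2l slt addKn.
    + exact: tsize_gt0.
  rewrite -[_ + tsize q1]addn0 -[m]addn0.
  apply: (@trun_embed _ q2 (tsize p + tsize q1) inr 0) R2 _ => [s a slt||//].
  + by rewrite /= !ltnNge leq_addr -addnA leq_addr /= addnA addKn.
  + exact: tsize_gt0.
- move=> p q c c1 n _ R1; rewrite -[n]addn0.
  apply: (@trun_embed _ p 0 (fun e => if e then inl (tsize p) else inr false) 0) R1 _ => //.
  + by move=> s a slt; rewrite /= slt.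
  + exact: tsize_gt0.
- move=> p q c c1 n e c2 m e' c3 k _ R1 _ R2 _ R3.
  apply: (@trun_embed _ p 0 (fun e => if e then inl (tsize p) else inr false) 0) R1 _ => //.
  + by move=> s a slt; rewrite /= slt.
  + exact: tsize_gt0.
  rewrite /= -[tsize p]addn0.
  apply: (@trun_embed _ q (tsize p) (fun _ => inl 0) 0) R2 _ => [s a slt||//].
  + by rewrite /= ltnNge leq_addr /= addKn.
  + exact: tsize_gt0.
Qed.

(** The additional state [tsize p] has no transitions; every exit leads there and the machine
    halts. *)
Definition tm_of (p : tprog) : TM :=
  @Build_TM (tsize p) (fun s a =>
    if s < tsize p then
      Some (inord (if (tdelta p s a).1.1 is inl s' then s' else tsize p),
            (tdelta p s a).1.2, (tdelta p s a).2)
    else None) ord0.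

Definition tape_rel (M : TM) (c : config M) (t : tape) (x : int) : Prop :=
  [/\ c_cur c = t x, forall i : nat, nth None (c_left c) i = t (x - 1 - i%:Z)%R &
      forall i : nat, nth None (c_right c) i = t (x + 1 + i%:Z)%R].

Lemma tape_rel_step (M : TM) (c : config M) t x s w r : tape_rel c t x ->
  @tm_delta M (c_state c) (c_cur c) = Some (s, w, r) ->
  exists c', [/\ tm_step c = Some c', c_state c' = s & tape_rel c' (upd t x w) (move r x)].
Proof.
case=> cE lE rE D; rewrite /tm_step D.
have ud y : y != x -> upd t x w y = t y by rewrite /upd => /negPf ->.
have ux : upd t x w x = w by rewrite /upd eqxx.
case: r {D} => /=; eexists; split=> //; split=> /=.
- by rewrite ud; [rewrite -nth0 rE; congr t; lia | lia].
- move=> [|i] /=; first by rewrite (_ : _ - _ = x)%R // ; lia.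
  by rewrite lE ud; [congr t; lia | lia].
- by move=> i; rewrite nth_behead rE ud; [congr t; lia | lia].
- by rewrite ud; [rewrite -nth0 lE; congr t; lia | lia].
- by move=> i; rewrite nth_behead lE ud; [congr t; lia | lia].
- move=> [|i] /=; first by rewrite (_ : _ + _ = x)%R // ; lia.
  by rewrite rE ud; [congr t; lia | lia].
Qed.

Lemma tm_steps_add (M : TM) n m (c c' : config M) : tm_steps n c = Some c' ->
  tm_steps (n + m) c = tm_steps m c'.
Proof. by move=> H; elim: m => [|m IH]; rewrite ?addn0 ?addnS //= IH. Qed.

Lemma tm_of_run p s c e c' n (cc : config (tm_of p)) : trun p s c e c' n -> s < tsize p ->
  nat_of_ord (c_state cc) = s -> tape_rel cc c.1 c.2 ->
  exists cc', [/\ tm_steps n cc = Some cc', tm_step cc' = None & tape_rel cc' c'.1 c'.2].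
Proof.
move=> R; elim: R cc => {s c e c' n} [s t x e dE|s t x s' e c n dE _ IH] cc slt sE rel.
  have D : @tm_delta (tm_of p) (c_state cc) (c_cur cc) =
      Some (inord (tsize p), (tdelta p s (t x)).1.2, (tdelta p s (t x)).2).
    by case: (rel) => -> _ _; rewrite /= sE slt dE.
  have [c' [st sE' rel']] := tape_rel_step rel D.
  exists c'; split=> //.
  by rewrite /tm_step sE' /= inordK // ltnn.
have D : @tm_delta (tm_of p) (c_state cc) (c_cur cc) =
    Some (inord s', (tdelta p s (t x)).1.2, (tdelta p s (t x)).2).
  by case: (rel) => -> _ _; rewrite /= sE slt dE.
have [c1 [st sE' rel']] := tape_rel_step rel D.
have s'lt := tdelta_lt slt dE.
have [|c2 [run2 h2 rel2]] := IH c1 s'lt _ rel'; first by rewrite sE' inordK // ltnW.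
exists c2; split=> //.
by have := @tm_steps_add _ 1 n cc c1 st; rewrite add1n => ->.
Qed.

Lemma tape_rel_output (M : TM) (c : config M) t x o : tape_rel c t x ->
  (forall i : nat, t (x + i%:Z)%R = nth None (map Some o) i) -> tm_output c = o.
Proof.
case=> cE _ rE H; rewrite /tm_output.
have : forall i, nth None (c_cur c :: c_right c) i = nth None (map Some o) i.
  by case=> [|i] /=; rewrite -H ?cE ?rE; congr t; lia.
elim: (_ :: _) o {cE rE H} => [|a s IH] o H.
  by case: o H => // b o /(_ 0).
case: o H => [|b o] H; first by have /= -> := H 0.
have /= -> := H 0; congr cons; apply: IH => i; exact: H i.+1.
Qed.

Lemma tape_rel_init (M : TM) w :
  tape_rel (tm_init M w) (fun y => if y is Posz i then nth None (map Some w) i else None) 0.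
Proof.
split=> [|i|i]; first by rewrite /= -nth0.
  by rewrite (_ : 0 - 1 - i%:Z = Negz i)%R ?nth_nil //; lia.
by rewrite (_ : 0 + 1 + i%:Z = i.+1%:Z)%R /= ?nth_behead //; lia.
Qed.

(** * Head movements and scans *)

Section TapeMoves.

Definition texec_le p c e c' B : Prop := exists2 n, n <= B & texec p c e c' n.
Definition texec_any p c c' B : Prop := exists e, texec_le p c e c' B.

Lemma texec_leW p c e c' B B' : texec_le p c e c' B -> B <= B' -> texec_le p c e c' B'.
Proof. by case=> n nB X BB'; exists n => //; apply: leq_trans BB'. Qed.

Lemma texec_anyW p c c' B B' : texec_any p c c' B -> B <= B' -> texec_any p c c' B'.
Proof. by case=> e X BB'; exists e; apply: texec_leW X BB'. Qed.

Lemma texec_seq p q c c1 c2 e B1 B2 : texec_any p c c1 B1 -> texec_le q c1 e c2 B2 ->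
  texec_le (TSeq p q) c e c2 (B1 + B2).
Proof.
by case=> e1 [n nB X] [m mB Y]; exists (n + m); [apply: leq_add | apply: XSeq X Y].
Qed.

Lemma texec_seqa p q c c1 c2 B1 B2 : texec_any p c c1 B1 -> texec_any q c1 c2 B2 ->
  texec_any (TSeq p q) c c2 (B1 + B2).
Proof. by move=> X [e Y]; exists e; apply: texec_seq X Y. Qed.

Lemma texec_if p q1 q2 c (e : bool) c1 e' c2 B1 B2 : texec_le p c e c1 B1 ->
  texec_le (if e then q1 else q2) c1 e' c2 B2 -> texec_le (TIf p q1 q2) c e' c2 (B1 + B2).
Proof.
by case=> n nB X [m mB Y]; exists (n + m); [apply: leq_add | apply: XIf X Y].
Qed.

Lemma texec_ift p q1 q2 c c1 e' c2 B1 B2 : texec_le p c true c1 B1 ->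
  texec_le q1 c1 e' c2 B2 -> texec_le (TIf p q1 q2) c e' c2 (B1 + B2).
Proof. exact: texec_if. Qed.

Lemma texec_iff p q1 q2 c c1 e' c2 B1 B2 : texec_le p c false c1 B1 ->
  texec_le q2 c1 e' c2 B2 -> texec_le (TIf p q1 q2) c e' c2 (B1 + B2).
Proof. exact: (@texec_if _ _ _ _ false). Qed.

Lemma upd_same t x : upd t x (t x) = t.
Proof. by apply: functional_extensionality => y; rewrite /upd; case: eqP => // ->. Qed.

Local Open Scope ring_scope.

Definition dir (r : bool) : int := if r then 1 else -1.

Lemma moveE r x : move r x = x + dir r.
Proof. by case: r. Qed.

Definition keep (r : bool) (a : option bool) := (a, r, isSome a).
(** Every step moves the head, so producing an exit code in place takes a step forth and a step
    back. *)
Definition ret (b : bool) : tprog :=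
  TSeq (TStep (fun a => (a, true, b))) (TStep (fun a => (a, false, b))).

Fixpoint go (r : bool) (j : nat) : tprog :=
  if j is j'.+1 then TSeq (TStep (keep r)) (go r j') else TStep (keep r).

Lemma keep_ok r t x : texec (TStep (keep r)) (t, x) (isSome (t x)) (t, x + dir r) 1.
Proof. by have := XStep (keep r) t x; rewrite /= upd_same moveE. Qed.

Lemma go_ok r j t x : texec_any (go r j) (t, x) (t, x + dir r * j.+1%:Z) j.+1.
Proof.
elim: j x => [|j IH] x; first by exists (isSome (t x)), 1%N; rewrite // mulr1; apply: keep_ok.
apply: (@texec_anyW _ _ _ (1 + j.+1)) => //.
have -> : x + dir r * j.+2%:Z = (x + dir r) + dir r * j.+1%:Z by lia.
by apply: texec_seqa (IH _); exists (isSome (t x)), 1%N; rewrite //; apply: keep_ok.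
Qed.

Lemma ret_ok b t x : texec_le (ret b) (t, x) b (t, x) 2.
Proof.
exists (1 + 1)%N => //.
have X := XStep (fun a => (a, true, b)) t x; rewrite /= upd_same in X.
have Y := XStep (fun a => (a, false, b)) t (x + 1); rewrite /= upd_same in Y.
have Z := XSeq X Y; by rewrite addrK in Z.
Qed.

(** The test that meets the blank moves as well, so a scan ends one cell beyond it and has to be
    followed by a step back. *)
Lemma scan_ok r b (dl : int) k t x m : (forall y, texec_any b (t, y) (t, y + dl) k) ->
  (forall i : nat, (i < m)%N -> isSome (t (x + (dir r + dl) * i%:Z))) ->
  t (x + (dir r + dl) * m%:Z) = None ->
  texec_le (TWhile (TStep (keep r)) b) (t, x) false
    (t, x + (dir r + dl) * m%:Z + dir r) (m * k.+1 + 1).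
Proof.
move=> Hb; elim: m x => [|m IH] x HS HN.
  rewrite mulr0 addr0 in HN *; exists 1%N => //; apply: XWhileF.
  by have := keep_ok r t x; rewrite HN.
have X := keep_ok r t x; have := HS 0%N isT; rewrite mulr0 addr0 => s0; rewrite s0 in X.
have [e [n nk Y]] := Hb (x + dir r).
have S : forall i : nat, x + (dir r + dl) * i.+1%:Z = x + dir r + dl + (dir r + dl) * i%:Z.
  by move=> i; lia.
have [|| u um Z] := IH (x + dir r + dl).
- by move=> i im; rewrite -S; apply: HS.
- by rewrite -S.
exists (1 + (n + u))%N; first by lia.
by rewrite S; apply: XWhileT X Y Z.
Qed.

End TapeMoves.

(** * A register language and its compilation to Turing machines *)

Inductive rcmd :=
| RSkip | RInc of nat | RLoop of nat & rcmd | ROut of bool | RInp of rcmd & rcmd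
| RSeq of rcmd & rcmd.

Notation rstate := ((nat -> nat) * seq bool)%type.

Definition setr (r : nat -> nat) (i v : nat) : nat -> nat := fun j => if j == i then v else r j.

(** One string is both input and output. [RInp] consumes it from its end, running a command for each
    bit, until it is empty; [ROut] appends to it. *)
Inductive rexec : rcmd -> rstate -> rstate -> nat -> Prop :=
| XSkip s : rexec RSkip s s 1
| XInc i r io : rexec (RInc i) (r, io) (setr r i (r i).+1, io) 1
| XOut b r io : rexec (ROut b) (r, io) (r, rcons io b) 1
| XRSeq c d s s1 n s2 m : rexec c s s1 n -> rexec d s1 s2 m -> rexec (RSeq c d) s s2 (n + m)
| XLoop0 i c r io : r i = 0 -> rexec (RLoop i c) (r, io) (r, io) 1
| XLoopS i c r io v s1 n s2 m : r i = v.+1 -> rexec c (setr r i v, io) s1 n ->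
    rexec (RLoop i c) s1 s2 m -> rexec (RLoop i c) (r, io) s2 (1 + (n + m))
| XInp0 c0 c1 r : rexec (RInp c0 c1) (r, [::]) (r, [::]) 1
| XInpS c0 c1 r io (b : bool) s1 n s2 m : rexec (if b then c1 else c0) (r, io) s1 n ->
    rexec (RInp c0 c1) s1 s2 m -> rexec (RInp c0 c1) (r, rcons io b) s2 (1 + (n + m)).

Section Compile.
Variable K : nat.
Hypothesis K1 : 1 < K.
Local Open Scope ring_scope.

(* The io string occupies the cells 0, 1, ...; register i < K is written in unary on the
   cells -1-i-K*m, 1 <= m, and the cells -1, ..., -K of row m = 0 stay blank. *)
Definition layout (s : rstate) : tape := fun y =>
  match y with
  | Posz j => nth None (map Some s.2) j
  | Negz a => if (0 < a %/ K <= s.1 (a %% K))%N then Some true else None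
  end.

Definition home : int := -1.
Definition track (i m : nat) : int := -1 - i%:Z - K%:Z * m%:Z.

Lemma layout_track s i m : (i < K)%N ->
  layout s (track i m) = if (0 < m <= s.1 i)%N then Some true else None.
Proof.
move=> iK; have -> : track i m = Negz (m * K + i) by rewrite /track; lia.
rewrite /layout divnMDl ?divn_small ?addn0; try lia.
by rewrite modnMDl modn_small.
Qed.

Lemma layout_io s j : layout s j%:Z = nth None (map Some s.2) j.
Proof. by []. Qed.

Lemma layout_home s : layout s home = None.
Proof. by have := @layout_track s 0 0 (ltnW K1); rewrite /track /home; congr (_ = _); congr layout; lia. Qed.

Lemma upd_track s i m v a : (i < K)%N -> (0 < m)%N ->
  (forall m', (0 < m')%N -> m' != m -> (m' <= v)%N = (m' <= s.1 i)%N) ->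
  a = (if (m <= v)%N then Some true else None) ->
  upd (layout s) (track i m) a = layout (setr s.1 i v, s.2).
Proof.
move=> iK m0 H aE; apply: functional_extensionality => -[j|x]; rewrite /upd.
  by case: eqP => // E; exfalso; move: E; rewrite /track; lia.
have -> : Negz x = track (x %% K)%N (x %/ K)%N.
  by rewrite /track {1}(divn_eq x K); lia.
have xK : (x %% K < K)%N by rewrite ltn_mod; lia.
rewrite !layout_track //= /setr.
have -> : (track (x %% K)%N (x %/ K)%N == track i m) = (x %% K == i)%N && (x %/ K == m)%N.
  apply/eqP/andP => [E|[/eqP -> /eqP -> //]].
  have {}E : (x %/ K * K + x %% K = m * K + i)%N by move: E; rewrite /track; lia.
  split; apply/eqP.
    by have := congr1 (fun u => u %% K)%N E; rewrite /= !modnMDl (modn_small xK) (modn_small iK).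
  by have := congr1 (fun u => u %/ K)%N E; rewrite /= !divnMDl ?(ltnW K1) // (divn_small xK) (divn_small iK) !addn0.
case: ((x %% K)%N =P i) => [->|] //=; case: ((x %/ K)%N =P m) => [->|/eqP ne] /=.
  by rewrite m0.
by case: (posnP (x %/ K)%N) => [->//|x0]; rewrite (H _ x0 ne).
Qed.

Lemma upd_io r io b : upd (layout (r, io)) (size io)%:Z (Some b) = layout (r, rcons io b).
Proof.
apply: functional_extensionality => -[j|x]; rewrite /upd //=.
rewrite map_rcons nth_rcons size_map.
have -> : (j%:Z == (size io)%:Z) = (j == size io)%N by lia.
case: ltngtP => //= h; by rewrite nth_default // size_map ltnW.
Qed.

Lemma upd_io_pop r io b : upd (layout (r, rcons io b)) (size io)%:Z None = layout (r, io).
Proof.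
apply: functional_extensionality => -[j|x]; rewrite /upd //=.
rewrite map_rcons nth_rcons size_map.
have -> : (j%:Z == (size io)%:Z) = (j == size io)%N by lia.
by case: ltngtP => //= h; rewrite nth_default // size_map ?h // ltnW.
Qed.

(** The test moves by one cell and the body by the K - 1 others, so the head stays on the track of
    one register. *)
Definition scan_track (r : bool) : tprog := TWhile (TStep (keep r)) (go r (K - 2)).
(** The test already moves to the next cell; the body goes one cell forth and back because a program
    cannot be empty. *)
Definition scan_io (r : bool) : tprog :=
  TWhile (TStep (keep r)) (TSeq (TStep (keep r)) (TStep (keep (~~ r)))).

Lemma scan_track_ok r t x m :
  (forall i : nat, (i < m)%N -> isSome (t (x + dir r * K%:Z * i%:Z))) ->
  t (x + dir r * K%:Z * m%:Z) = None ->
  texec_le (scan_track r) (t, x) false (t, x + dir r * K%:Z * m%:Z + dir r) (m * K + 1).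
Proof.
have e : dir r + dir r * (K - 2).+1%:Z = dir r * K%:Z.
  have -> : (K - 2).+1%:Z = K%:Z - 1 by lia.
  by rewrite mulrBr mulr1 addrC subrK.
move=> HS HN; have k2 : ((K - 2).+2 = K)%N by lia.
have := @scan_ok r (go r (K - 2)) (dir r * (K - 2).+1%:Z) (K - 2).+1 t x m.
by rewrite e k2; apply => // y; apply: go_ok.
Qed.

Lemma scan_io_ok r t x m :
  (forall i : nat, (i < m)%N -> isSome (t (x + dir r * i%:Z))) ->
  t (x + dir r * m%:Z) = None ->
  texec_le (scan_io r) (t, x) false (t, x + dir r * m%:Z + dir r) (m * 3 + 1).
Proof.
move=> HS HN.
have := @scan_ok r (TSeq (TStep (keep r)) (TStep (keep (~~ r)))) 0 2 t x m.
rewrite addr0; apply => // y.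
apply: (@texec_seqa _ _ _ (t, y + dir r) _ 1 1).
  by exists (isSome (t y)), 1%N; rewrite //; apply: keep_ok.
exists (isSome (t (y + dir r))), 1%N => //.
have := keep_ok (~~ r) t (y + dir r).
by rewrite (_ : y + dir r + dir (~~ r) = y + 0) //; case: (r); rewrite /dir /=; lia.
Qed.

Notation "p ;; q" := (TSeq p q) (at level 60, right associativity).

Definition inc_prog (i : nat) : tprog :=
  go false i.-1;; go false K.-1;; scan_track false;; go true 0;;
  TStep (fun _ => (Some true, true, true));; go true (K - 2);; scan_track true;;
  go false 0;; go true i.-1.

(** One row before the first blank is the last mark of the register, or row 0 if there is none. Row
    0 is blank, so writing a blank there does no harm, and the symbol read tells the two cases
    apart. *)
Definition dec_prog (i : nat) : tprog :=
  go false i.-1;; go false K.-1;; scan_track false;; go true 0;; go true K.-1;;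
  TIf (TStep (fun a => (None, true, isSome a)))
    (go true (K - 2);; scan_track true;; go false 0;; go true i.-1;; ret true)
    (go false 0;; go true i.-1;; ret false).

Definition out_prog (b : bool) : tprog :=
  go true 0;; scan_io true;; go false 0;; TStep (fun _ => (Some b, false, true));;
  scan_io false;; go true 0.

(** The exits leave the head at different places: just after the last bit if there is one, where
    [inp_body] takes over, and at [home] if the string is empty. *)
Definition inp_test : tprog :=
  go true 0;; scan_io true;; go false 1;;
  TIf (TStep (keep true)) (ret true) (go false 0;; ret false).

Definition inp_body (p0 p1 : tprog) : tprog :=
  go false 0;;
  TIf (TStep (fun a => (None, false, a == Some true)))
    (scan_io false;; go true 0;; p1) (scan_io false;; go true 0;; p0).

Fixpoint compile (c : rcmd) : tprog :=
  match c with
  | RSkip => ret true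
  | RInc i => inc_prog i
  | RLoop i c => TWhile (dec_prog i) (compile c)
  | ROut b => out_prog b
  | RInp c0 c1 => TWhile inp_test (inp_body (compile c0) (compile c1))
  | RSeq c d => compile c;; compile d
  end.

Lemma goE r j t x y : y = x + dir r * j.+1%:Z -> texec_any (go r j) (t, x) (t, y) j.+1.
Proof. by move=> ->; apply: go_ok. Qed.

Lemma step_ok f t x t' y : t' = upd t x (f (t x)).1.1 -> y = x + dir (f (t x)).1.2 ->
  texec_le (TStep f) (t, x) (f (t x)).2 (t', y) 1.
Proof. by move=> -> ->; exists 1%N => //; rewrite -moveE; apply: XStep. Qed.

Lemma anyI p c e c' B : texec_le p c e c' B -> texec_any p c c' B.
Proof. by exists e. Qed.

Lemma scan_left s i x y m : (0 < i < K)%N -> x = track i 1 -> m = s.1 i ->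
  y = track i m.+1 - 1 ->
  texec_any (scan_track false) (layout s, x) (layout s, y) (m * K + 1).
Proof.
move=> /andP[i0 iK] -> -> ->.
have tr j : track i 1 + dir false * K%:Z * j%:Z = track i j.+1 by rewrite /track /dir; lia.
have -> : track i (s.1 i).+1 - 1 = track i 1 + dir false * K%:Z * (s.1 i)%:Z + dir false.
  by rewrite tr.
apply: anyI; apply: scan_track_ok => [j js|]; rewrite tr layout_track //=.
  by rewrite js.
by rewrite ltnn.
Qed.

Lemma scan_right s i x y m : (0 < i < K)%N -> x = track i m -> (m <= s.1 i)%N ->
  y = track i 0 + 1 ->
  texec_any (scan_track true) (layout s, x) (layout s, y) (m * K + 1).
Proof.
move=> /andP[i0 iK] -> ms ->.
have tr (j : nat) : (j <= m)%N -> track i m + dir true * K%:Z * j%:Z = track i (m - j).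
  by move=> jm; rewrite /track /dir -subzn //; lia.
have -> : track i 0 + 1 = track i m + dir true * K%:Z * m%:Z + dir true.
  by rewrite tr // subnn.
apply: anyI; apply: scan_track_ok => [j js|]; rewrite tr ?layout_track ?subnn //; last by rewrite ltnW.
by rewrite subn_gt0 js /= (leq_trans (leq_subr _ _) ms).
Qed.

Lemma inc_ok i r io : (0 < i < K)%N ->
  texec_any (inc_prog i) (layout (r, io), home) (layout (setr r i (r i).+1, io), home)
    (20 * K * (r i).+1).
Proof.
move=> iK; case/andP: (iK) => i0 iltK; set m := r i; set s := (r, io).
have trE j : track i j = -1 - i%:Z - K%:Z * j%:Z by [].
have sr : setr r i m.+1 i = m.+1 by rewrite /setr eqxx.
apply: texec_anyW.
  apply: texec_seqa; first by apply: (@goE _ _ _ _ (track i 0)); rewrite trE /home /dir; lia.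
  apply: texec_seqa; first by apply: (@goE _ _ _ _ (track i 1)); rewrite !trE /dir; lia.
  apply: texec_seqa; first by apply: (@scan_left s i _ _ m).
  apply: texec_seqa; first by apply: (@goE _ _ _ _ (track i m.+1)); rewrite /dir; lia.
  apply: texec_seqa.
    apply: anyI; apply: (@step_ok _ _ _ (layout (setr r i m.+1, io)) (track i m.+1 + 1)) => //.
    apply/esym/(@upd_track s i m.+1 m.+1); rewrite ?leqnn //= => m' m'0 ne.
    by rewrite leq_eqVlt (negPf ne).
  apply: texec_seqa; first by apply: (@goE _ _ _ _ (track i m)); rewrite !trE /dir; lia.
  apply: texec_seqa; first by apply: (@scan_right _ i _ _ m) => //=; rewrite sr.
  apply: texec_seqa; first by apply: (@goE _ _ _ _ (track i 0)); rewrite /dir; lia.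
  by apply: (@goE _ _ _ _ home); rewrite trE /home /dir; lia.
by clear -i0 iltK; nia.
Qed.

Lemma dec_pos_ok i r io v : (0 < i < K)%N -> r i = v.+1 ->
  texec_le (dec_prog i) (layout (r, io), home) true (layout (setr r i v, io), home)
    (20 * K * (r i).+1).
Proof.
move=> iK rv; case/andP: (iK) => i0 iltK; set s := (r, io).
have trE j : track i j = -1 - i%:Z - K%:Z * j%:Z by [].
have sr : setr r i v i = v by rewrite /setr eqxx.
have svK : isSome (layout s (track i v.+1)) by rewrite layout_track // /= rv leqnn.
apply: texec_leW.
  apply: texec_seq; first by apply: (@goE _ _ _ _ (track i 0)); rewrite trE /home /dir; lia.
  apply: texec_seq; first by apply: (@goE _ _ _ _ (track i 1)); rewrite !trE /dir; lia.
  apply: texec_seq; first by apply: (@scan_left s i _ _ v.+1).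
  apply: texec_seq; first by apply: (@goE _ _ _ _ (track i v.+2)); rewrite /dir; lia.
  apply: texec_seq; first by apply: (@goE _ _ _ _ (track i v.+1)); rewrite !trE /dir; lia.
  apply: (@texec_ift _ _ _ _ (layout (setr r i v, io), track i v.+1 + 1)).
    have := @step_ok (fun a => (None, true, isSome a)) (layout s) (track i v.+1)
      (layout (setr r i v, io)) (track i v.+1 + 1) _ erefl.
    rewrite /= svK; apply; apply/esym/(@upd_track s i v.+1 v); rewrite ?ltnn //= => m' m'0 ne.
    by rewrite rv [RHS]leq_eqVlt (negPf ne).
  apply: texec_seq; first by apply: (@goE _ _ _ _ (track i v)); rewrite !trE /dir; lia.
  apply: texec_seq; first by apply: (@scan_right _ i _ _ v) => //=; rewrite sr.
  apply: texec_seq; first by apply: (@goE _ _ _ _ (track i 0)); rewrite /dir; lia.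
  apply: texec_seq; first by apply: (@goE _ _ _ _ home); rewrite trE /home /dir; lia.
  exact: ret_ok.
by rewrite rv; clear -i0 iltK; nia.
Qed.

Lemma dec_zero_ok i r io : (0 < i < K)%N -> r i = 0%N ->
  texec_le (dec_prog i) (layout (r, io), home) false (layout (r, io), home) (20 * K).
Proof.
move=> iK rv; case/andP: (iK) => i0 iltK; set s := (r, io).
have trE j : track i j = -1 - i%:Z - K%:Z * j%:Z by [].
have svK : layout s (track i 0) = None by rewrite layout_track.
apply: texec_leW.
  apply: texec_seq; first by apply: (@goE _ _ _ _ (track i 0)); rewrite trE /home /dir; lia.
  apply: texec_seq; first by apply: (@goE _ _ _ _ (track i 1)); rewrite !trE /dir; lia.
  apply: texec_seq; first by apply: (@scan_left s i _ _ 0).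
  apply: texec_seq; first by apply: (@goE _ _ _ _ (track i 1)); rewrite /dir; lia.
  apply: texec_seq; first by apply: (@goE _ _ _ _ (track i 0)); rewrite !trE /dir; lia.
  apply: (@texec_iff _ _ _ _ (layout s, track i 0 + 1)).
    have := @step_ok (fun a => (None, true, isSome a)) (layout s) (track i 0)
      (layout s) (track i 0 + 1) _ erefl.
    by rewrite /= svK; apply; rewrite -svK upd_same.
  apply: texec_seq; first by apply: (@goE _ _ _ _ (track i 0)); rewrite /dir; lia.
  apply: texec_seq; first by apply: (@goE _ _ _ _ home); rewrite trE /home /dir; lia.
  exact: ret_ok.
by clear -i0 iltK; nia.
Qed.

Lemma scan_io_right s x y : x = 0 -> y = (size s.2)%:Z + 1 ->
  texec_any (scan_io true) (layout s, x) (layout s, y) (size s.2 * 3 + 1).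
Proof.
move=> -> ->; apply: anyI; rewrite -[(size s.2)%:Z]add0r -[X in 0 + X]mul1r.
apply: (@scan_io_ok true) => [j js|]; rewrite mul1r add0r layout_io.
  by rewrite (nth_map true).
by rewrite nth_default ?size_map.
Qed.

Lemma scan_io_left s x y m : x = m%:Z - 1 -> (m <= size s.2)%N -> y = home - 1 ->
  texec_any (scan_io false) (layout s, x) (layout s, y) (m * 3 + 1).
Proof.
move=> -> ms ->; apply: anyI.
have -> : home - 1 = m%:Z - 1 + dir false * m%:Z + dir false by rewrite /home /dir; lia.
apply: scan_io_ok => [j jm|].
  have -> : m%:Z - 1 + dir false * j%:Z = (m - j.+1)%N%:Z by rewrite /dir -subzn //; lia.
  by rewrite layout_io (nth_map true) //; lia.
have -> : m%:Z - 1 + dir false * m%:Z = home by rewrite /home /dir; lia.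
exact: layout_home.
Qed.

Lemma out_ok b r io :
  texec_any (out_prog b) (layout (r, io), home) (layout (r, rcons io b), home)
    (20 * K * (size io).+1).
Proof.
set s := (r, io).
apply: texec_anyW.
  apply: texec_seqa; first by apply: (@goE _ _ _ _ 0).
  apply: texec_seqa; first exact: (@scan_io_right s).
  apply: texec_seqa; first by apply: (@goE _ _ _ _ (size io)%:Z); rewrite /dir /=; lia.
  apply: texec_seqa.
    apply: anyI; apply: (@step_ok _ _ _ (layout (r, rcons io b)) ((size io)%:Z - 1)) => //.
    by rewrite upd_io.
  apply: texec_seqa.
    by apply: (@scan_io_left _ _ _ (size io)) => //=; rewrite size_rcons.
  by apply: (@goE _ _ _ _ home); rewrite /home /dir.
by rewrite [size s.2]/=; clear -K1; nia.
Qed.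

Lemma inp_test_empty r :
  texec_le inp_test (layout (r, [::]), home) false (layout (r, [::]), home) (20 * K).
Proof.
set s := (r, [::]).
apply: texec_leW.
  apply: texec_seq; first by apply: (@goE _ _ _ _ 0).
  apply: texec_seq; first exact: (@scan_io_right s 0 1).
  apply: texec_seq; first by apply: (@goE _ _ _ _ home).
  apply: (@texec_iff _ _ _ _ (layout s, 0)).
    have lh := layout_home s; have := @step_ok (keep true) (layout s) home (layout s) 0.
    by rewrite lh; apply; rewrite // -lh upd_same.
  apply: texec_seq; first by apply: (@goE _ _ _ _ home).
  exact: ret_ok.
by clear -K1; rewrite /=; lia.
Qed.

Lemma inp_test_rcons r io b :
  texec_le inp_test (layout (r, rcons io b), home) true
    (layout (r, rcons io b), (size io).+1%:Z) (20 * K * (size io).+1).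
Proof.
set s := (r, rcons io b).
have ss : size s.2 = (size io).+1 by rewrite size_rcons.
have sl : layout s (size io)%:Z = Some b.
  by rewrite layout_io map_rcons nth_rcons size_map ltnn eqxx.
apply: texec_leW.
  apply: texec_seq; first by apply: (@goE _ _ _ _ 0).
  apply: texec_seq; first exact: (@scan_io_right s).
  apply: texec_seq; first by apply: (@goE _ _ _ _ (size io)%:Z); rewrite ss /dir; lia.
  apply: (@texec_ift _ _ _ _ (layout s, (size io).+1%:Z)).
    have := @step_ok (keep true) (layout s) (size io)%:Z (layout s) (size io).+1%:Z.
    by rewrite sl; apply; [rewrite /= -sl upd_same | rewrite /dir /=; lia].
  exact: ret_ok.
by rewrite ss; clear -K1; nia.
Qed.

Lemma inp_body_ok p0 p1 r io (b : bool) c B :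
  texec_any (if b then p1 else p0) (layout (r, io), home) c B ->
  texec_any (inp_body p0 p1) (layout (r, rcons io b), (size io).+1%:Z) c
    (20 * K * (size io).+1 + B).
Proof.
move=> H; set s := (r, rcons io b).
have sl : layout s (size io)%:Z = Some b.
  by rewrite layout_io map_rcons nth_rcons size_map ltnn eqxx.
have [e He] : texec_any (scan_io false;; go true 0;; (if b then p1 else p0))
    (layout (r, io), (size io)%:Z - 1) c (size io * 3 + 1 + (1 + B)).
  apply: texec_seqa; first exact: (@scan_io_left _ _ _ (size io)).
  by apply: texec_seqa H; apply: goE; rewrite /home /dir.
apply: texec_anyW.
  apply: texec_seqa; first by apply: (@goE _ _ _ _ (size io)%:Z); rewrite /dir; lia.
  exists e; apply: (@texec_if _ _ _ _ b (layout (r, io), (size io)%:Z - 1)).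
    have := @step_ok (fun a => (None, false, a == Some true)) (layout s) (size io)%:Z
      (layout (r, io)) ((size io)%:Z - 1).
    rewrite sl /=; have -> : (Some b == Some true) = b by case: (b).
    by apply; rewrite ?upd_io_pop.
  by move: He; case: (b) => He; apply: He.
by clear -K1; nia.
Qed.

(** [go false i.-1] moves by i cells only if i > 0, so the registers are numbered from 1. *)
Fixpoint regs_ok (c : rcmd) : bool :=
  match c with
  | RSkip | ROut _ => true
  | RInc i => (0 < i < K)%N
  | RLoop i c => (0 < i < K)%N && regs_ok c
  | RInp c d | RSeq c d => regs_ok c && regs_ok d
  end.

Definition bounded (s : rstate) (B : nat) := (forall i, (s.1 i <= B)%N) /\ (size s.2 <= B)%N.

Lemma rexec_bounded c s s' n B : rexec c s s' n -> bounded s B -> bounded s' (B + n).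
Proof.
move=> X; elim: X B => {c s s' n}.
- move=> s B [h1 h2]; split=> [i|]; first by apply: leq_trans (h1 i) (leq_addr _ _).
  exact: leq_trans h2 (leq_addr _ _).
- move=> i r io B [/= h1 h2]; split=> [j|/=]; last by lia.
  by rewrite /= /setr; case: eqP => _; [have := h1 i | have := h1 j]; lia.
- move=> b r io B [/= h1 h2]; split=> [j|/=]; first by have /= := h1 j; lia.
  by rewrite size_rcons; lia.
- by move=> c d s s1 n s2 m _ IH1 _ IH2 B bs; rewrite addnA; apply/IH2/IH1.
- move=> i c r io _ B [/= h1 h2]; split=> [j|/=]; first by have /= := h1 j; lia.
  by lia.
- move=> i c r io v s1 n s2 m rv _ IH1 _ IH2 B [/= h1 h2].
  have := IH2 (B + n)%N; rewrite -addnA => H.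
  have [|h3 h4] := H; first by apply: IH1; split=> //= j; rewrite /setr; case: eqP => // _;
    have := h1 i; lia.
  by split=> [j|]; [have := h3 j | ]; lia.
- move=> c0 c1 r B [/= h1 h2]; split=> [j|//]; have /= := h1 j; lia.
- move=> c0 c1 r io b s1 n s2 m _ IH1 _ IH2 B [/= h1]; rewrite size_rcons => h2.
  have := IH2 (B + n)%N; rewrite -addnA => H.
  have [|h3 h4] := H; first by apply: IH1; split=> //=; lia.
  by split=> [j|]; [have := h3 j | ]; lia.
Qed.

(** Registers and string never exceed B + n, so each of the n units of time costs a bounded number
    of passes over at most K (B + n + 1) cells, up to a constant. *)
Theorem compile_ok c s s' n B : rexec c s s' n -> regs_ok c -> bounded s B ->
  texec_any (compile c) (layout s, home) (layout s', home) (n * (50 * K * (B + n).+1)).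
Proof.
move=> X; elim: X B => {c s s' n}.
- move=> s B _ _; apply: texec_anyW; first exact: anyI (ret_ok _ _ _).
  by clear -K1; nia.
- move=> i r io B /= iK [/= h1 h2]; apply: texec_anyW; first exact: inc_ok.
  by have := h1 i; clear -K1; nia.
- move=> b r io B _ [/= h1 h2]; apply: texec_anyW; first exact: out_ok.
  by clear -K1 h2; nia.
- move=> c d s s1 n s2 m X1 IH1 X2 IH2 B /= /andP[ok1 ok2] bs.
  have b1 := rexec_bounded X1 bs.
  apply: texec_anyW; first exact: texec_seqa (IH1 _ ok1 bs) (IH2 _ ok2 b1).
  by clear -K1; nia.
- move=> i c r io rv B /= /andP[iK _] _; exists false.
  have [k kB Y] := dec_zero_ok io iK rv.
  exists k; last exact: XWhileF Y.
  by clear -K1 kB; nia.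
- move=> i c r io v s1 n s2 m rv X1 IH1 X2 IH2 B /= /andP[iK ok] [/= h1 h2].
  have [k kB Y] := dec_pos_ok io iK rv.
  have bs : bounded (setr r i v, io) B.
    by split=> //= j; rewrite /setr; case: eqP => // _; have := h1 i; lia.
  have b1 := rexec_bounded X1 bs.
  have [e1 [k1 k1B Y1]] := IH1 _ ok bs.
  have [|e2 [k2 k2B Y2]] := IH2 _ _ b1; first by rewrite /= iK.
  exists e2; exists (k + (k1 + k2))%N; last exact: XWhileT Y Y1 Y2.
  by have := h1 i; clear -K1 kB k1B k2B; nia.
- move=> c0 c1 r B /= _ _; exists false.
  have [k kB Y] := inp_test_empty r.
  exists k; last exact: XWhileF Y.
  by clear -K1 kB; nia.
- move=> c0 c1 r io b s1 n s2 m X1 IH1 X2 IH2 B /= /andP[ok0 ok1] [/= h1].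
  rewrite size_rcons => h2.
  have bs : bounded (r, io) B by split=> //=; lia.
  have b1 := rexec_bounded X1 bs.
  have [k kB Y] := inp_test_rcons r io b.
  have okb : regs_ok (if b then c1 else c0) by case: (b).
  have Hb : texec_any (if b then compile c1 else compile c0) (layout (r, io), home)
      (layout s1, home) (n * (50 * K * (B + n).+1)).
    by have := IH1 _ okb bs; case: (b).
  have [e1 [k1 k1B Y1]] := inp_body_ok Hb.
  have [|e2 [k2 k2B Y2]] := IH2 _ _ b1; first by rewrite /= ok0.
  exists e2; exists (k + (k1 + k2))%N; last exact: XWhileT Y Y1 Y2.
  by clear -K1 kB k1B k2B h2; nia.
Qed.

End Compile.

(** * Closure properties of elementary bounds, and elementary register programs *)

Definition elementary_bound (f : nat -> nat) : Prop := exists k, forall n, f n <= exp_iter k n.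

Lemma exp_iterS k n : exp_iter k.+1 n = 2 ^ exp_iter k n.
Proof. by []. Qed.

Lemma exp_iter_ge k n : k + n <= exp_iter k n.
Proof. by elim: k => // k IH; rewrite exp_iterS addSn; apply: leq_ltn_trans IH (ltn_expl _ _). Qed.

Lemma exp_iter_leq k m n : m <= n -> exp_iter k m <= exp_iter k n.
Proof. by move=> mn; elim: k => // k IH; rewrite !exp_iterS leq_exp2l. Qed.

Lemma exp_iter_leqk j k n : j <= k -> exp_iter j n <= exp_iter k n.
Proof.
move=> /subnK <-; elim: (k - j) => // m IH; rewrite addSn exp_iterS.
by apply: leq_trans IH _; apply: ltnW (ltn_expl _ _).
Qed.

Lemma exp_iterD j k n : exp_iter j (exp_iter k n) = exp_iter (j + k) n.
Proof. by rewrite /exp_iter iterD. Qed.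

Lemma elementary_leq f g : (forall n, f n <= g n) -> elementary_bound g -> elementary_bound f.
Proof. by move=> fg [k gk]; exists k => n; apply: leq_trans (fg n) (gk n). Qed.

Lemma elementary_const c : elementary_bound (fun _ => c).
Proof. by exists c => n; apply: leq_trans (exp_iter_ge c n); apply: leq_addr. Qed.

Lemma elementary_id : elementary_bound (fun n => n).
Proof. by exists 0. Qed.

Lemma elementary_exp_iter k f : elementary_bound f -> elementary_bound (fun n => exp_iter k (f n)).
Proof. by case=> j fj; exists (k + j) => n; rewrite -exp_iterD; apply: exp_iter_leq. Qed.

Lemma elementary_pow2 f : elementary_bound f -> elementary_bound (fun n => 2 ^ f n).
Proof. exact: (@elementary_exp_iter 1). Qed.

Lemma elementary_mul f g : elementary_bound f -> elementary_bound g ->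
  elementary_bound (fun n => f n * g n).
Proof.
case=> j fj [k gk]; exists (maxn j k).+2 => n.
set m := exp_iter (maxn j k) n.
have fm : f n <= m by apply: leq_trans (fj n) (exp_iter_leqk _ (leq_maxl _ _)).
have gm : g n <= m by apply: leq_trans (gk n) (exp_iter_leqk _ (leq_maxr _ _)).
rewrite !exp_iterS -/m.
have m2 : m < 2 ^ m by apply: ltn_expl.
apply: (@leq_trans (2 ^ m * 2 ^ m)); first by apply: leq_mul; lia.
rewrite -expnD leq_exp2l // addnn -mul2n.
by elim: (m) => // u IH; rewrite expnS; have : 0 < 2 ^ u; [rewrite expn_gt0 | lia].
Qed.

Lemma elementary_add f g : elementary_bound f -> elementary_bound g ->
  elementary_bound (fun n => f n + g n).
Proof.
move=> ef eg; apply: (@elementary_leq _ (fun n => 2 ^ f n * 2 ^ g n)).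
  move=> n; have := ltn_expl (f n) (isT : 1 < 2); have := ltn_expl (g n) (isT : 1 < 2).
  by nia.
by apply: elementary_mul; apply: elementary_pow2.
Qed.

Lemma elementary_pow c f : elementary_bound f -> elementary_bound (fun n => c ^ f n).
Proof.
move=> ef; apply: (@elementary_leq _ (fun n => 2 ^ (c * f n))).
  move=> n; rewrite expnM; case: (posnP (f n)) => [->//|f0].
  by rewrite leq_exp2r // ltnW // ltn_expl.
by apply/elementary_pow2/elementary_mul; first exact: elementary_const.
Qed.

Section Computes.
Variable K : nat.
Hypothesis K1 : 1 < K.

Lemma layout_init w : layout K (fun _ => 0, w) =
  (fun y => if y is Posz i then nth None (map Some w) i else None).
Proof.
apply: functional_extensionality => -[j|x] //=.
by case: (x %/ K).
Qed.

Theorem rcmd_computes c f T : regs_ok K c ->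
  (forall w, exists r n, rexec c (fun _ => 0, w) (r, f w) n /\ n <= T (size w)) ->
  exists M, computes_in M f (fun n => 2 + T n * (50 * K * (n + T n).+1)).
Proof.
(* The input and the output start at cell 0, whereas compiled programs start and end at cell -1. *)
move=> ok H; exists (tm_of (TSeq (go false 0) (TSeq (compile K c) (go true 0)))) => w.
have [r [n [X nT]]] := H w.
have b0 : bounded (fun _ => 0, w) (size w) by split.
have [e [k kB Y]] : texec_any (TSeq (go false 0) (TSeq (compile K c) (go true 0)))
    (layout K (fun _ => 0, w), 0%R) (layout K (r, f w), 0%R)
    (1 + (n * (50 * K * (size w + n).+1) + 1)).
  apply: texec_seqa; first by apply: (@goE _ _ _ _ home).
  apply: texec_seqa; first exact: (compile_ok K1 X ok b0).
  exact: goE.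
set M := tm_of _.
have rel := tape_rel_init M w; rewrite -layout_init in rel.
have [|cc [run halt rel']] := tm_of_run (texec_trun Y) (tsize_gt0 _) _ rel => //.
exists k, cc; split; last first.
  split=> //; split=> //; apply: tape_rel_output rel' _ => i.
  by rewrite add0r.
have le : n * (50 * K * (size w + n).+1) <= T (size w) * (50 * K * (size w + T (size w)).+1).
  by rewrite leq_mul // leq_mul // ltnS leq_add2l.
by lia.
Qed.

Theorem rcmd_elementary c f T : regs_ok K c -> elementary_bound T ->
  (forall w, exists r n, rexec c (fun _ => 0, w) (r, f w) n /\ n <= T (size w)) ->
  elementary_fun f.
Proof.
move=> ok eT /(rcmd_computes ok) [M HM].
have [k Hk] : elementary_bound (fun n => 2 + T n * (50 * K * (n + T n).+1)).
  apply: elementary_add; first exact: elementary_const.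
  apply: elementary_mul => //; apply: elementary_mul; first exact: elementary_const.
  apply: (@elementary_leq _ (fun n => 1 + (n + T n))); first by move=> n.
  apply: elementary_add; first exact: elementary_const.
  by apply: elementary_add => //; apply: elementary_id.
exists M, k => w; have [t [cc [tT ?]]] := HM w.
by exists t, cc; split=> //; apply: leq_trans tT (Hk _).
Qed.

End Computes.

(** * Arithmetic in the register language *)

Definition rexec_le c s s' B : Prop := exists2 n, rexec c s s' n & n <= B.

Lemma rexec_leW c s s' B B' : rexec_le c s s' B -> B <= B' -> rexec_le c s s' B'.
Proof. by case=> n X nB BB'; exists n => //; apply: leq_trans BB'. Qed.

Lemma rexec_le_eq c s s1 s' B : rexec_le c s s1 B -> s1 = s' -> rexec_le c s s' B.
Proof. by move=> + <-. Qed.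

Lemma rseq_le c d s s1 s2 B1 B2 : rexec_le c s s1 B1 -> rexec_le d s1 s2 B2 ->
  rexec_le (RSeq c d) s s2 (B1 + B2).
Proof.
by case=> n X nB [m Y mB]; exists (n + m); [apply: XRSeq X Y | apply: leq_add].
Qed.

Lemma rinc_le i r io : rexec_le (RInc i) (r, io) (setr r i (r i).+1, io) 1.
Proof. by exists 1 => //; apply: XInc. Qed.

(* [st v] is the state at the head of the loop when the loop register holds [v]. *)
Lemma rloop_le i c (st : nat -> rstate) m B : (forall v, v <= m -> (st v).1 i = v) ->
  (forall v, v < m -> rexec_le c (setr (st v.+1).1 i v, (st v.+1).2) (st v) B) ->
  rexec_le (RLoop i c) (st m) (st 0) (m * B.+1 + 1).
Proof.
elim: m => [|m IH] Hi Hc.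
  have := Hi 0 isT; case E: (st 0) => [r io] /= r0.
  by exists 1 => //; apply: XLoop0.
have [n X nB] := Hc m (ltnSn m).
have [|v vm|k Y kB] := IH; first by move=> v vm; apply: Hi; apply: ltnW.
  by apply: Hc; apply: ltnW.
exists (1 + (n + k)); last by lia.
have := Hi m.+1 (leqnn _); move: X; case E: (st m.+1) => [r io] /= X rm.
exact: XLoopS rm X Y.
Qed.

Fixpoint rincs (i k : nat) : rcmd := if k is k'.+1 then RSeq (RInc i) (rincs i k') else RSkip.

Lemma setr_setr r i u v : setr (setr r i u) i v = setr r i v.
Proof. by apply: functional_extensionality => j; rewrite /setr; case: eqP. Qed.

Lemma setr_same r i v : r i = v -> setr r i v = r.
Proof. by move=> <-; apply: functional_extensionality => j; rewrite /setr; case: eqP => // ->. Qed.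

Lemma rincs_le i k r io : rexec_le (rincs i k) (r, io) (setr r i (r i + k), io) k.+1.
Proof.
elim: k r => [|k IH] r; first by exists 1 => //; rewrite addn0 setr_same //; apply: XSkip.
apply: rexec_le_eq; first exact: rseq_le (rinc_le _ _ _) (IH _).
by rewrite /= setr_setr {2}/setr eqxx addSnnS.
Qed.

Fixpoint routs (s : seq bool) : rcmd := if s is b :: s' then RSeq (ROut b) (routs s') else RSkip.

Lemma routs_le s r io : rexec_le (routs s) (r, io) (r, io ++ s) (size s).+1.
Proof.
elim: s io => [|b s IH] io; first by exists 1; rewrite ?cats0 //; apply: XSkip.
rewrite -cat_rcons; apply: (@rseq_le _ _ _ (r, rcons io b) _ 1) (IH _).
by exists 1 => //; apply: XOut.
Qed.

Definition rN := 1. Definition rR := 2. Definition rX := 3.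
Definition rT := 4. Definition rU := 5. Definition rI := 6.

Lemma rmove_le i j k r io : i != j -> 
  rexec_le (RLoop i (rincs j k)) (r, io) (setr (setr r j (r j + k * r i)) i 0, io)
    (r i * k.+2 + 1).
Proof.
move=> /eqP ij.
have := @rloop_le i (rincs j k) (fun v => (setr (setr r j (r j + k * (r i - v))) i v, io)) (r i) k.+1.
rewrite subnn muln0 addn0 subn0 => H.
have {1}-> : r = setr (setr r j (r j)) i (r i) by rewrite !setr_same.
apply: H => [v _|v vm]; first by rewrite /= /setr eqxx.
apply: rexec_le_eq; first exact: rincs_le.
congr pair; apply: functional_extensionality => x; rewrite /setr /=.
case: (x =P i) => [->|xi]; first by case: (i =P j).
have ji : (j == i) = false by apply/eqP; auto.
by case: (x =P j) => // _; rewrite ji eqxx; nia.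
Qed.

Definition rscale (i k : nat) : rcmd := RSeq (RLoop i (rincs rT 1)) (RLoop rT (rincs i k)).

Lemma rscale_le i k r io : i != rT -> r rT = 0 ->
  rexec_le (rscale i k) (r, io) (setr r i (k * r i), io) (r i * (k + 5) + 2).
Proof.
move=> iT rT0; have Ti : rT != i by rewrite eq_sym.
apply: rexec_leW.
  apply: rexec_le_eq.
    apply: rseq_le (rmove_le 1 r io iT) _.
    exact: (rmove_le k _ io Ti).
  congr pair; apply: functional_extensionality => j; rewrite /setr rT0.
  move/negPf: Ti => Ti.
  rewrite !eqxx Ti ?(negPf iT); case: (j =P rT) => [->|_]; first by rewrite Ti.
  by case: eqP => // _; nia.
move/negPf: Ti => Ti.
by rewrite /setr eqxx Ti rT0; nia.
Qed.

(** The omitted register 4 is the scratch register [rT], which is 0 between the commands. *)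
Definition regs (n r x u i : nat) : nat -> nat := fun j =>
  match j with 1 => n | 2 => r | 3 => x | 5 => u | 6 => i | _ => 0 end.

Ltac regs_ext := rewrite /setr /=; congr pair;
  apply: functional_extensionality => -[|[|[|[|[|[|[|?]]]]]]] //=; try lia.

Definition rdigit (b : bool) : rcmd := RSeq (rscale rR 3) (RSeq (rincs rR b.+1) (RInc rN)).

Lemma rdigit_le b n r io :
  rexec_le (rdigit b) (regs n r 0 0 0, io) (regs n.+1 (b.+1 + 3 * r) 0 0 0, io) (r * 8 + 6).
Proof.
apply: rexec_leW.
  apply: rexec_le_eq.
    apply: rseq_le; first by apply: rscale_le.
    apply: rseq_le; first exact: rincs_le.
    exact: rinc_le.
  by regs_ext.
by case: b; rewrite /=; lia.
Qed.

Definition rinput : rcmd := RInp (rdigit false) (rdigit true).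

Fixpoint bits_val (s : seq bool) : nat := if s is b :: s' then b.+1 + 3 * bits_val s' else 0.

Lemma bits_val_lt s : bits_val s < 3 ^ size s.
Proof. by elim: s => //= b s IH; rewrite expnS; case: b; lia. Qed.

(** The bits arrive last one first, so appending each as a new lowest digit makes the first bit the
    lowest digit in the end, as in [tape_val]. *)
Lemma rinput_le w s :
  rexec_le rinput (regs (size s) (bits_val s) 0 0 0, w)
    (regs (size (w ++ s)) (bits_val (w ++ s)) 0 0 0, [::])
    (size w * (3 ^ size (w ++ s) * 8 + 7) + 1).
Proof.
elim/last_ind: w s => [|w b IH] s.
  by exists 1 => //; apply: XInp0.
have [n X nB] := rdigit_le b (size s) (bits_val s) w.
have [m Y mB] := IH (b :: s).
rewrite cat_rcons; exists (1 + (n + m)).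
  by apply: XInpS Y; case: (b) X.
have : bits_val s < 3 ^ size (w ++ b :: s).
  apply: leq_trans (bits_val_lt s) _; rewrite leq_exp2l // size_cat /=; lia.
rewrite size_rcons mulSn; lia.
Qed.

Definition rpow3 : rcmd := RSeq (RInc rX) (RLoop rR (rscale rX 3)).

Lemma rpow3_le n r io :
  rexec_le rpow3 (regs n r 0 0 0, io) (regs n 0 (3 ^ r) 0 0, io) (r * (3 ^ r * 8 + 3) + 2).
Proof.
apply: rexec_leW.
  apply: rseq_le; first exact: rinc_le.
  have := @rloop_le rR (rscale rX 3) (fun v => (regs n v (3 ^ (r - v)) 0 0, io)) r (3 ^ r * 8 + 2).
  rewrite subnn subn0 expn0 => H.
  have <- : (regs n r 1 0 0, io) = (setr (regs n r 0 0 0) rX (regs n r 0 0 0 rX).+1, io).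
    by regs_ext.
  apply: H => [//|v vr].
  apply: rexec_leW.
    apply: rexec_le_eq; first by apply: rscale_le.
    by regs_ext; rewrite -expnS; congr (3 ^ _); lia.
  by rewrite /setr /= leq_add2r leq_mul // leq_exp2l //; lia.
by lia.
Qed.

Definition rexp2 : rcmd :=
  RSeq (RInc rU) (RSeq (RLoop rN (rscale rU 2)) (RLoop rU (rincs rN 1))).

Lemma rexp2_le n x io :
  rexec_le rexp2 (regs n 0 x 0 0, io) (regs (2 ^ n) 0 x 0 0, io) (n * (2 ^ n * 7 + 3) + 2 ^ n * 3 + 3).
Proof.
apply: rexec_leW.
  apply: rseq_le; first exact: rinc_le.
  apply: rseq_le.
    have := @rloop_le rN (rscale rU 2) (fun v => (regs v 0 x (2 ^ (n - v)) 0, io)) n (2 ^ n * 7 + 2).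
    rewrite subnn subn0 expn0 => H.
    have <- : (regs n 0 x 1 0, io) = (setr (regs n 0 x 0 0) rU (regs n 0 x 0 0 rU).+1, io).
      by regs_ext.
    apply: H => [//|v vr].
    apply: rexec_leW.
      apply: rexec_le_eq; first by apply: rscale_le.
      by regs_ext; rewrite -expnS; congr (2 ^ _); lia.
    by rewrite /setr /= leq_add2r leq_mul // leq_exp2l //; lia.
  apply: rexec_le_eq; first by apply: rmove_le.
  by regs_ext.
by rewrite /=; lia.
Qed.

Fixpoint rexps (k : nat) : rcmd := if k is k'.+1 then RSeq (rexps k') rexp2 else RSkip.

Lemma rexps_le k n x io :
  rexec_le (rexps k) (regs n 0 x 0 0, io) (regs (exp_iter k n) 0 x 0 0, io)
    (k * (20 * exp_iter k.+1 n * exp_iter k.+1 n) + 1).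
Proof.
elim: k => [|k IH]; first by exists 1 => //; apply: XSkip.
apply: rexec_leW; first exact: rseq_le IH (rexp2_le _ _ _).
have lt1 : exp_iter k n < 2 ^ exp_iter k n by apply: ltn_expl.
have le2 : exp_iter k.+1 n <= exp_iter k.+2 n by apply: exp_iter_leqk.
rewrite !exp_iterS in lt1 le2 *.
move: lt1 le2; set a := exp_iter k n; set b := 2 ^ a; set c := 2 ^ b => lt1 le2.
have h1 : a * b <= c * c by apply: leq_mul; lia.
have h2 : b * b <= c * c by apply: leq_mul; lia.
have h3 : c <= c * c by rewrite leq_pmulr // /c expn_gt0.
have h4 : 20 * b * b <= 20 * c * c by lia.
have h5 : 0 < c by rewrite /c expn_gt0.
have h6 : k * (20 * b * b) <= k * (20 * c * c) by rewrite leq_mul.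
by rewrite mulSn; lia.
Qed.

(** * Computing the reduction *)

(** Numbers are written in unary and the instance depends on the registers only through repetitions,
    so repeating fixed words as often as a register says is enough to print it. *)
Inductive eitem := EStr of seq bool | ERep of nat & seq bool.

Definition nrep (n : nat) (s : seq bool) : seq bool := flatten (nseq n s).

Definition eitem_eval (r : nat -> nat) (e : eitem) : seq bool :=
  match e with EStr s => s | ERep i s => nrep (r i) s end.

Definition eeval (r : nat -> nat) (es : seq eitem) : seq bool := flatten (map (eitem_eval r) es).

Definition emit_item (e : eitem) : rcmd :=
  match e with
  | EStr s => routs s
  | ERep i s => RSeq (RLoop i (RSeq (RInc rT) (routs s))) (RLoop rT (rincs i 1))
  end.

Fixpoint emit (es : seq eitem) : rcmd :=
  if es is e :: es' then RSeq (emit_item e) (emit es') else RSkip.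

Definition eitem_size (e : eitem) : nat :=
  match e with EStr s => size s | ERep _ s => size s end + 10.

Definition esize (es : seq eitem) : nat := sumn (map eitem_size es).

Definition eitem_ok (e : eitem) : bool :=
  match e with EStr _ => true | ERep i _ => (0 < i < 8) && (i != rT) end.

Lemma eeval_cat r es es' : eeval r (es ++ es') = eeval r es ++ eeval r es'.
Proof. by rewrite /eeval map_cat flatten_cat. Qed.

Lemma eeval_cons r e es : eeval r (e :: es) = eitem_eval r e ++ eeval r es.
Proof. by []. Qed.

Lemma nrepD m n s : nrep (m + n) s = nrep m s ++ nrep n s.
Proof. by rewrite /nrep -flatten_cat; congr flatten; elim: m => //= m ->. Qed.

Lemma nrep1 s : nrep 1 s = s. Proof. exact: cats0. Qed.

Lemma nrepM m n s : nrep (m * n) s = nrep n (nrep m s).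
Proof. by elim: n => [|n IH]; rewrite ?muln0 // mulnS nrepD IH. Qed.

(** Counting a register down destroys it, so its value is saved in [rT] meanwhile and moved back
    afterwards. *)
Lemma emit_item_le e r io V : eitem_ok e -> r rT = 0 -> (forall j, r j <= V) ->
  rexec_le (emit_item e) (r, io) (r, io ++ eitem_eval r e) (eitem_size e * V.+1).
Proof.
case: e => [s|i s] /= ok rT0 rV.
  by apply: rexec_leW; [exact: routs_le | rewrite /eitem_size; nia].
case/andP: ok => _ iT; have Ti : rT != i by rewrite eq_sym.
have iTf := negPf iT; have Tif := negPf Ti.
apply: rexec_leW.
  apply: (@rseq_le _ _ _ (setr (setr r rT (r i)) i 0, io ++ nrep (r i) s)).
    have := @rloop_le i (RSeq (RInc rT) (routs s))
      (fun v => (setr (setr r rT (r i - v)) i v, io ++ nrep (r i - v) s)) (r i) (1 + (size s).+1).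
    rewrite subnn subn0 /nrep /= cats0 => H.
    have {1}-> : r = setr (setr r rT 0) i (r i) by rewrite !setr_same.
    apply: H => [v _|v vr]; first by rewrite /setr eqxx.
    apply: rexec_le_eq; first exact: rseq_le (rinc_le _ _ _) (routs_le _ _ _).
    rewrite /= -catA; congr (_, _ ++ _).
      rewrite setr_setr; apply: functional_extensionality => j; rewrite /setr Tif eqxx.
      by case: (j =P rT) => [->|//]; rewrite Tif; lia.
    by rewrite -/(nrep _ _) -{2}[s]nrep1 -/(nrep _ _) -nrepD; congr nrep; lia.
  apply: rexec_le_eq; first exact: (rmove_le 1 _ _ Ti).
  congr pair; apply: functional_extensionality => j; rewrite /setr Tif eqxx ?iTf.
  case: (j =P rT) => [->|_]; first by rewrite rT0.
  by case: (j =P i) => [->|//]; rewrite eqxx; lia.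
rewrite /setr Tif eqxx; have := rV i; rewrite /eitem_size; nia.
Qed.

Lemma emit_le es r io V : all eitem_ok es -> r rT = 0 -> (forall j, r j <= V) ->
  rexec_le (emit es) (r, io) (r, io ++ eeval r es) (esize es * V.+1 + 1).
Proof.
move=> + rT0 rV; elim: es io => [|e es IH] io /=.
  by move=> _; exists 1; rewrite ?cats0 //; apply: XSkip.
case/andP=> ok oks; apply: rexec_leW.
  apply: rseq_le; first exact: (emit_item_le _ ok rT0 rV).
  by rewrite eeval_cons catA; apply: IH.
by rewrite /esize /=; lia.
Qed.

Definition remit_loop (es : seq eitem) : rcmd := RLoop rN (RSeq (emit es) (RInc rI)).

Lemma remit_loop_le es l x io V : all eitem_ok es -> l <= V -> x <= V ->
  rexec_le (remit_loop es) (regs l 0 x 0 0, io)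
    (regs 0 0 x 0 l, io ++ flatten [seq eeval (regs (l - i.+1) 0 x 0 i) es | i <- iota 0 l])
    (l * (esize es * V.+1 + 3) + 1).
Proof.
move=> ok lV xV.
have := @rloop_le rN (RSeq (emit es) (RInc rI)) (fun v => (regs v 0 x 0 (l - v),
  io ++ flatten [seq eeval (regs (l - i.+1) 0 x 0 i) es | i <- iota 0 (l - v)])) l
  (esize es * V.+1 + 1 + 1).
rewrite subnn subn0 /= cats0 => H.
apply: (@rexec_leW _ _ _ (l * (esize es * V.+1 + 1 + 1).+1 + 1)); last by lia.
apply: H => [//|v vl].
have -> : setr (regs v.+1 0 x 0 (l - v.+1)) rN v = regs v 0 x 0 (l - v.+1).
  by apply: functional_extensionality => -[|[|[|[|[|[|[|?]]]]]]].
apply: rexec_le_eq.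
  apply: rseq_le (rinc_le _ _ _); apply: emit_le => // j.
  by case: j => [|[|[|[|[|[|[|?]]]]]]] //=; lia.
have ll : l - v = (l - v.+1).+1 by lia.
congr pair.
  by apply: functional_extensionality => -[|[|[|[|[|[|[|?]]]]]]] //=; lia.
rewrite ll -[(l - v.+1).+1]addn1 iotaD map_cat flatten_cat /= cats0 add0n catA.
by congr (_ ++ eeval (regs _ _ _ _ _) _); lia.
Qed.

(** * Printing transitions that contain the input number X *)

Inductive sent := SC of int | SX | SNX.

Notation stmpl := (nat * seq sent * nat)%type.

Definition sent_val (X : nat) (e : sent) : int :=
  match e with SC z => z | SX => X%:Z | SNX => (- X%:Z)%R end.

Definition stmpl_val (X : nat) (t : stmpl) : tmpl := (t.1.1, map (sent_val X) t.1.2, t.2).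
Definition sconst (t : tmpl) : stmpl := (t.1.1, map SC t.1.2, t.2).

Lemma sconstK X t : stmpl_val X (sconst t) = t.
Proof.
by case: t => -[q e] q'; rewrite /stmpl_val /sconst /= -map_comp map_id.
Qed.

Lemma map_sconstK X ts : map (stmpl_val X) (map sconst ts) = ts.
Proof. by rewrite -map_comp -[RHS]map_id; apply: eq_map => t; apply: sconstK. Qed.

Definition ones (k : nat) : seq bool := nrep k sONE.
Definition zero_block : seq bool := nrep 5 sSEP.

Definition sent_items (e : sent) : seq eitem :=
  match e with
  | SC z => [:: EStr (enc_int z)]
  | SX => [:: ERep rX sONE; EStr sSEP]
  | SNX => [:: EStr sNEG; ERep rX sONE; EStr sSEP]
  end.

Definition vec_items (pad : bool) (v : seq sent) : seq eitem :=
  flatten (map sent_items (take 3 v)) ++ ERep rI zero_block ::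
  flatten (map sent_items (drop 3 v)) ++
  [:: EStr (if pad then zero_block else [::]); ERep rN zero_block; EStr sEND].

(* [rI] holds the level i of the transition and [rN] holds l - i, less 1 if [pad]. *)
Definition trans_items (pad : bool) (t : stmpl) : seq eitem :=
  ERep rI (ones level_states) :: EStr (enc_nat t.1.1) :: vec_items pad t.1.2 ++
  [:: ERep rI (ones level_states); EStr (enc_nat t.2)].

Lemma enc_natD a b : enc_nat (a + b) = nrep a sONE ++ enc_nat b.
Proof. by rewrite /enc_nat -/(nrep _ _) nrepD catA. Qed.

Lemma enc_nat_mul i q b : enc_nat (i * q + b) = nrep i (ones q) ++ enc_nat b.
Proof. by rewrite enc_natD mulnC nrepM. Qed.

Lemma enc_zeros m : flatten (map enc_int (nseq m 0%R)) = nrep m sSEP.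
Proof. by elim: m => //= m ->. Qed.

Lemma enc_zero_blocks m : flatten (map enc_int (nseq (5 * m) 0%R)) = nrep m zero_block.
Proof. by rewrite enc_zeros nrepM. Qed.

(** The integer -0 would be encoded without a sign token, hence the assumption that X is positive;
    it holds as X is a power of 3. *)
Lemma sent_items_eval r e : 0 < r rX -> eeval r (sent_items e) = enc_int (sent_val (r rX) e).
Proof.
case: e => [z||] X0 /=; first exact: cats0.
  by rewrite !eeval_cons.
by rewrite !eeval_cons /=; case: (r rX) X0.
Qed.

Lemma sents_items_eval r v : 0 < r rX ->
  eeval r (flatten (map sent_items v)) = flatten (map enc_int (map (sent_val (r rX)) v)).
Proof.
move=> X0; elim: v => //= e v IH; by rewrite eeval_cat IH sent_items_eval.
Qed.

Lemma trans_items_eval r l (pad : bool) t : 0 < r rX -> r rI + (r rN + pad) = l ->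
  eeval r (trans_items pad t) = enc_trans (lift_t l (r rI) (stmpl_val (r rX) t)).
Proof.
move=> X0 <-; rewrite /enc_trans /lift_t /= !enc_nat_mul /embed addKn.
rewrite /trans_items /vec_items !eeval_cons /= !eeval_cat !eeval_cons !eeval_cat.
rewrite !sents_items_eval // /enc_vec !map_cat !flatten_cat !enc_zero_blocks -map_take -map_drop.
rewrite [r rN + pad]addnC nrepD /eeval /= !cats0 -!catA; do 7 congr (_ ++ _).
by case: pad; rewrite ?nrep1.
Qed.

Lemma transs_items_eval r l (pad : bool) ts : 0 < r rX -> r rI + (r rN + pad) = l ->
  eeval r (flatten (map (trans_items pad) ts)) =
  flatten (map enc_trans (map (lift_t l (r rI)) (map (stmpl_val (r rX)) ts))).
Proof.
move=> X0 rl; elim: ts => // t ts IH.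
have -> : flatten (map (trans_items pad) (t :: ts)) =
  trans_items pad t ++ flatten (map (trans_items pad) ts) by [].
by rewrite eeval_cat IH (trans_items_eval _ X0 rl).
Qed.

Section Reduction.
Variables (P : seq rinstr) (S start acc : nat).

(** Transition 7, after five plain ones and two of the first gadget, is the one that loads X; its
    entries X and -X are the only ones that depend on the input. *)
Definition final_sym : seq stmpl :=
  let L := final_t P S start acc 0 in
  map sconst (take 7 L) ++
  (((final_U S).+1 + 4 * 0, SC 0 :: SX :: SNX :: nseq 10 (SC 0), ((final_U S).+1 + 4 * 0).+1)) ::
  map sconst (drop 8 L).

Lemma final_symE X : map (stmpl_val X) final_sym = final_t P S start acc X.
Proof.
rewrite /final_sym map_cat /= !map_sconstK /=.
rewrite -[RHS](cat_take_drop 7) [in RHS]/final_t /=.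
congr [:: _, _, _, _, _, _, _, _, _, _, _, _, _, _ & _].
  by rewrite /stmpl_val /= /eff oppr0 sub0r.
rewrite !sconstK; do 9 congr (_ :: _); congr flatten; apply/eq_in_map => j.
by rewrite mem_iota; case: j => [|[]].
Qed.

Definition header_items : seq eitem :=
  ERep rN (ones 5) :: EStr (enc_nat 10) ::
  flatten (map (trans_items false) (map sconst init_t)).

Definition level_items : seq eitem := flatten (map (trans_items true) (map sconst level_t)).

Definition final_items : seq eitem :=
  flatten (map (trans_items false) final_sym) ++
  [:: EStr (sEND ++ enc_nat 0); EStr (flatten (map enc_int start_vec)); ERep rI zero_block;
      EStr sEND; ERep rI (ones level_states); EStr (enc_nat (final_U S));
      EStr (nrep 13 sSEP); ERep rI zero_block; EStr sEND].

Definition reduction_prog (k : nat) : rcmd :=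
  RSeq rinput (RSeq rpow3 (RSeq (rexps k)
    (RSeq (emit header_items) (RSeq (remit_loop level_items) (emit final_items))))).

Lemma header_eval l X : 0 < X -> eeval (regs l 0 X 0 0) header_items =
  enc_nat (5 * (l + 2)) ++ flatten (map enc_trans (map (lift_t l 0) init_t)).
Proof.
move=> X0; rewrite /header_items 2!eeval_cons (@transs_items_eval _ l) //; last by rewrite /= addn0.
have -> : 5 * (l + 2) = l * 5 + 10 by lia.
by rewrite map_sconstK enc_nat_mul -catA.
Qed.

Lemma level_eval l X i : 0 < X -> i < l -> eeval (regs (l - i.+1) 0 X 0 i) level_items =
  flatten (map enc_trans (map (lift_t l i) level_t)).
Proof.
move=> X0 il; rewrite /level_items (@transs_items_eval _ l) ?map_sconstK //.
by rewrite /=; lia.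
Qed.

Lemma final_eval l X : 0 < X -> eeval (regs 0 0 X 0 l) final_items =
  flatten (map enc_trans (map (lift_t l l) (final_t P S start acc X))) ++
  sEND ++ enc_nat 0 ++ enc_vec (embed l 0 start_vec) ++
  enc_nat (l * level_states + final_U S) ++ enc_vec (nseq (3 + 5 * (l + 2)) 0%R).
Proof.
move=> X0; rewrite /final_items eeval_cat (@transs_items_eval _ l) //; last by rewrite /= !addn0.
rewrite final_symE; congr (_ ++ _).
have -> : embed l 0 start_vec = start_vec ++ nseq (5 * l) 0%R.
  by rewrite /embed muln0 subn0.
have -> : 3 + 5 * (l + 2) = 13 + 5 * l by lia.
rewrite enc_nat_mul /enc_vec (nseq_cat 13 (5 * l)) !map_cat !flatten_cat !enc_zero_blocks enc_zeros.
by rewrite 9!eeval_cons [eeval _ [::]]/= !cats0 -!catA.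
Qed.

Lemma enc_inst_cat k ts (tss : seq (seq tmpl)) ts' (src tgt : nat * seq int) :
  enc_inst (VassInst k (ts ++ flatten tss ++ ts') src tgt) =
  (enc_nat k ++ flatten (map enc_trans ts)) ++
  flatten (map (fun us => flatten (map enc_trans us)) tss) ++
  flatten (map enc_trans ts') ++ sEND ++ enc_nat src.1 ++ enc_vec src.2 ++
  enc_nat tgt.1 ++ enc_vec tgt.2.
Proof.
have e : flatten (map enc_trans (flatten tss)) =
    flatten (map (fun us => flatten (map enc_trans us)) tss).
  by elim: tss => //= us tss IH; rewrite map_cat flatten_cat IH.
by rewrite /enc_inst [v_trans _]/= !map_cat !flatten_cat e -!catA.
Qed.

Lemma reduction_eval l X : 0 < X ->
  eeval (regs l 0 X 0 0) header_items ++
  flatten [seq eeval (regs (l - i.+1) 0 X 0 i) level_items | i <- iota 0 l] ++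
  eeval (regs 0 0 X 0 l) final_items = enc_inst (reduction_vass P S start acc l X).
Proof.
move=> X0; rewrite header_eval // final_eval // /reduction_vass enc_inst_cat.
congr (_ ++ (_ ++ _)); rewrite -map_comp.
by congr flatten; apply/eq_in_map => i; rewrite mem_iota => il; apply: level_eval.
Qed.

Lemma reduction_items_ok :
  [/\ all eitem_ok header_items, all eitem_ok level_items & all eitem_ok final_items].
Proof.
have oks v : all eitem_ok (flatten (map sent_items v)).
  by elim: v => // -[z||] v IH; rewrite [flatten _]/= /= IH.
have okt pad t : all eitem_ok (trans_items pad t).
  by rewrite /trans_items /vec_items /= !all_cat /= !all_cat !oks.
have okts pad ts : all eitem_ok (flatten (map (trans_items pad) ts)).
  elim: ts => // t ts IH.
  have -> : flatten (map (trans_items pad) (t :: ts)) =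
    trans_items pad t ++ flatten (map (trans_items pad) ts) by [].
  by rewrite all_cat okt IH.
split; [|exact: okts|by rewrite all_cat okts].
exact: (okts false (map sconst init_t)).
Qed.

Definition reduction_time (k n : nat) : nat :=
  let V := exp_iter k n + 3 ^ 3 ^ n in
  (n * (3 ^ n * 8 + 7) + 1) + ((3 ^ n * (3 ^ 3 ^ n * 8 + 3) + 2) +
  ((k * (20 * exp_iter k.+1 n * exp_iter k.+1 n) + 1) +
  ((esize header_items * V.+1 + 1) + ((V * (esize level_items * V.+1 + 3) + 1) +
   (esize final_items * V.+1 + 1))))).

Lemma reduction_time_elementary k : elementary_bound (reduction_time k).
Proof.
have ex j : elementary_bound (exp_iter j) by exists j.
have e1 c : elementary_bound (fun n => c ^ n) by apply: elementary_pow elementary_id.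
have e2 c : elementary_bound (fun n => c ^ c ^ n) by apply: elementary_pow.
have eV : elementary_bound (fun n => exp_iter k n + 3 ^ 3 ^ n) by apply: elementary_add.
have eV1 : elementary_bound (fun n => (exp_iter k n + 3 ^ 3 ^ n).+1).
  by apply: elementary_leq (elementary_add (elementary_const 1) eV) => n.
rewrite /reduction_time.
do ?[exact: elementary_id | exact: elementary_const | exact: eV1 | exact: eV | exact: ex | exact: e1
  | exact: e2 | apply: elementary_add | apply: elementary_mul].
Qed.

Lemma reduction_prog_le k w : rexec_le (reduction_prog k) (fun _ => 0, w)
  (regs 0 0 (3 ^ bits_val w) 0 (exp_iter k (size w)),
   enc_inst (reduction_vass P S start acc (exp_iter k (size w)) (3 ^ bits_val w)))
  (reduction_time k (size w)).
Proof.
have [okh okl okf] := reduction_items_ok.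
set n := size w; set l := exp_iter k n; set X := 3 ^ bits_val w.
set V := exp_iter k n + 3 ^ 3 ^ n.
have bv : bits_val w < 3 ^ n := bits_val_lt w.
have X0 : 0 < X by rewrite expn_gt0.
have XV : X <= 3 ^ 3 ^ n by rewrite leq_exp2l // ltnW.
have lV : l <= V by apply: leq_addr.
have XV' : X <= V by apply: leq_trans XV (leq_addl _ _).
rewrite -(reduction_eval l X0) /reduction_prog /reduction_time -/V.
have r0 : (fun _ => 0) = regs 0 0 0 0 0.
  by apply: functional_extensionality => -[|[|[|[|[|[|[|?]]]]]]].
apply: rseq_le.
  by have := rinput_le w [::]; rewrite cats0 /= r0; apply.
apply: rseq_le.
  apply: rexec_leW (rpow3_le _ _ _) _; rewrite leq_add2r leq_mul ?(ltnW bv) //.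
  by rewrite leq_add2r leq_mul.
apply: rseq_le; first exact: rexps_le.
have rv a b c : a <= V -> b <= V -> c <= V -> forall j, regs a 0 b 0 c j <= V.
  by move=> aV bV cV [|[|[|[|[|[|[|?]]]]]]].
apply: rseq_le; first by apply: emit_le => //; apply: rv.
apply: rseq_le.
  apply: rexec_leW (remit_loop_le _ okl lV XV') _.
  by rewrite leq_add2r leq_mul.
by rewrite catA; apply: emit_le => //; apply: rv.
Qed.

Lemma reduction_elementary k : elementary_fun (fun w =>
  enc_inst (reduction_vass P S start acc (exp_iter k (size w)) (3 ^ bits_val w))).
Proof.
apply: (@rcmd_elementary 8 isT (reduction_prog k) _ (reduction_time k)).
- have okk j : regs_ok 8 (rexps j) by elim: j => //= j ->.
  have oks s : regs_ok 8 (routs s) by elim: s.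
  have oke es : all eitem_ok es -> regs_ok 8 (emit es).
    elim: es => // e es IH /andP[ok /IH okes]; rewrite /= okes andbT.
    by case: e ok => [s|i s] //= /andP[-> _]; rewrite oks.
  have [okh okl okf] := reduction_items_ok.
  rewrite /reduction_prog /remit_loop; move: header_items level_items final_items okh okl okf.
  by move=> h l f /oke + /oke + /oke /= => -> -> ->; rewrite okk.
- exact: reduction_time_elementary.
move=> w; have [m X mB] := reduction_prog_le k w.
by exists (regs 0 0 (3 ^ bits_val w) 0 (exp_iter k (size w))), m.
Qed.

End Reduction.

(** * Injectivity of the encoding and growth rates *)

Lemma enc_nat_inj m n s s' : enc_nat m ++ s = enc_nat n ++ s' -> m = n /\ s = s'.
Proof.
rewrite /enc_nat; elim: m n => [|m IH] [|n] //=; first by case.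
by case=> /IH [-> ->].
Qed.

Lemma enc_int_inj y z s s' : enc_int y ++ s = enc_int z ++ s' -> y = z /\ s = s'.
Proof.
case: y => m; case: z => n; rewrite /enc_int; first by case/enc_nat_inj=> -> ->.
- by case: m.
- by case: n.
- by move/(congr1 (drop 2))=> /(@enc_nat_inj m.+1 n.+1) [[->] ->].
Qed.

Lemma enc_vec_inj u v s s' : enc_vec u ++ s = enc_vec v ++ s' -> u = v /\ s = s'.
Proof.
have nend z s1 s2 : enc_int z ++ s1 <> sEND ++ s2 by case: z => [[]|].
rewrite /enc_vec -!catA; elim: u v => [|y u IH] [|z v] /=; first by case.
- by rewrite -catA => e; case: (nend z (flatten (map enc_int v) ++ sEND ++ s') s); rewrite -e.
- by rewrite -catA => /nend.
- by rewrite -!catA => /enc_int_inj [-> /IH [-> ->]].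
Qed.

Lemma enc_trans_inj t t' s s' : enc_trans t ++ s = enc_trans t' ++ s' -> t = t' /\ s = s'.
Proof.
have e u r : enc_trans u ++ r = enc_nat u.1.1 ++ enc_vec u.1.2 ++ enc_nat u.2 ++ r.
  by rewrite /enc_trans -catA; congr (_ ++ _); rewrite catA.
rewrite !e; case: t => -[p v] q; case: t' => -[p' v'] q'.
by case/enc_nat_inj=> /= -> /enc_vec_inj [-> /enc_nat_inj [-> ->]].
Qed.

Lemma enc_transs_inj ts ts' s s' : flatten (map enc_trans ts) ++ sEND ++ s =
  flatten (map enc_trans ts') ++ sEND ++ s' -> ts = ts' /\ s = s'.
Proof.
have nend t s1 s2 : enc_trans t ++ s1 <> sEND ++ s2 by case: t => -[[]].
have cons_eq t us r : flatten (map enc_trans (t :: us)) ++ r =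
  enc_trans t ++ flatten (map enc_trans us) ++ r by rewrite catA.
elim: ts ts' => [|t ts IH] [|t' ts']; rewrite ?cons_eq.
- by case.
- by move/esym/nend.
- by move/nend.
- by case/enc_trans_inj=> -> /IH [-> ->].
Qed.

(** [VASS_reach_unary] speaks of some instance with the given code. Injectivity identifies it with
    the instance constructed. All tokens have two bits, which makes decoding unique. *)
Lemma enc_inst_inj : injective enc_inst.
Proof.
case=> k ts [p u] [q v] [k' ts' [p' u'] [q' v']]; rewrite /enc_inst /=.
case/enc_nat_inj=> -> /enc_transs_inj [-> /enc_nat_inj [-> /enc_vec_inj [->]]].
by case/enc_nat_inj=> -> /(f_equal (cat^~ [::])) /enc_vec_inj [->].
Qed.

Lemma reduction_wf P S start acc l X : vass_wf 3 (reduction_vass P S start acc l X).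
Proof.
have nn : nonneg_first 3 (nseq (3 + 5 * (l + 2)) 0%R).
  by apply/allP => z /mem_take; rewrite mem_nseq => /andP[_ /eqP ->].
have sz t : t \in v_trans (reduction_vass P S start acc l X) -> size t.1.2 = 3 + 5 * (l + 2).
  case/mem_trans=> [[u]|[i [u [il uin ->]]]|[u uin ->]].
  - by rewrite inE => /eqP -> ->; apply: size_embed.
  - by apply: size_embed; [exact: size_level_t | exact: ltnW].
  - by apply: size_embed; first exact: size_final_t uin.
have ss : size (embed l 0 start_vec) = 3 + 5 * (l + 2) by apply: size_embed.
rewrite /vass_wf; apply/andP; split=> //; apply/andP; split=> //; apply/andP; split.
  by apply/andP; split; [apply/allP => t /sz /eqP | apply/eqP].
by apply/eqP; apply: size_nseq.
Qed.

Lemma bits_val_tape w : tape_val (map Some w) = bits_val w.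
Proof. by elim: w => //= b w ->. Qed.

Lemma tm_steps_halt (M : TM) (c0 c d : config M) s t : tm_steps s c0 = Some c ->
  tm_step c = None -> tm_steps t c0 = Some d -> t <= s.
Proof.
move=> sc halt td; rewrite leqNgt; apply/negP => st.
have : exists d', tm_steps s.+1 c0 = Some d'.
  move: st td; elim: t d => // t IH d; rewrite ltnS leq_eqVlt => /orP[/eqP <-|st] /=.
    by rewrite sc halt.
  by case E: tm_steps => [d'|//] _; apply: IH st E.
by rewrite /= sc halt => -[].
Qed.

Lemma tm_halt_uniq (M : TM) (c0 c d : config M) s t :
  tm_steps s c0 = Some c -> tm_step c = None ->
  tm_steps t c0 = Some d -> tm_step d = None -> c = d.
Proof.
move=> sc ch td dh; have e : s = t.
  by apply/eqP; rewrite eqn_leq (tm_steps_halt td dh sc) (tm_steps_halt sc ch td).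
by move: sc; rewrite e td => -[].
Qed.

Lemma size_tape_out s : size (tape_out s) <= size s.
Proof. by elim: s => // -[b|] s IH. Qed.

(** For the unary output [nseq (g n) true] this turns the elementary running time into an elementary
    bound on g itself. *)
Lemma size_computes M f T w : computes_in M f T -> size (f w) <= size w + (T (size w)).+1.
Proof.
move=> /(_ w) [t [c [tT [run [_ <-]]]]].
have [_ r] := tm_steps_size run; apply: leq_trans (size_tape_out _) _.
by rewrite /= addnS ltnS; apply: leq_trans r _; rewrite leq_add2l.
Qed.

Lemma TowerS n : Tower n.+1 = 2 ^ Tower n.
Proof. by []. Qed.

Lemma Tower_add m k : Tower m + k <= Tower (m + k).
Proof.
elim: k => [|k IH]; rewrite ?addn0 // !addnS TowerS.
exact: leq_ltn_trans IH (ltn_expl _ _).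
Qed.

Lemma Tower_leq m n : m <= n -> Tower m <= Tower n.
Proof. by move=> /subnKC <-; apply: leq_trans (Tower_add _ _); apply: leq_addr. Qed.

Lemma Tower_ge n : n < Tower n.
Proof. exact: (Tower_add 0 n). Qed.

Lemma Tower_level_R i : Tower i <= level_R i.
Proof.
elim: i => // i IH; rewrite TowerS /=.
have := leq_pexp2l (isT : 0 < 2) IH; have : 0 < 2 ^ level_R i by rewrite expn_gt0.
by lia.
Qed.

(** The number of steps is at most 2^(4 + t + 2 (n + t)), with t and n below Tower (g + n). The
    exponent is then at most 16 Tower (g + n), hence at most Tower (g + n + 5), and the outer power
    of 2 takes the sixth level. *)
Lemma tower_budget n g t l : t <= Tower g -> g + n + 6 <= l ->
  (9 * t.+1 * 3 ^ (n + t)).+1 < 2 * level_R l + 2.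
Proof.
move=> tg gl; set m := g + n.
have tm : t <= Tower m by apply: leq_trans tg (Tower_leq (leq_addr _ _)).
have nm : n <= Tower m by apply: leq_trans (ltnW (Tower_ge n)) (Tower_leq (leq_addl _ _)).
have m0 : 0 < Tower m by apply: leq_ltn_trans (Tower_ge m).
have p1 : 9 * t.+1 * 3 ^ (n + t) <= 2 ^ 4 * 2 ^ t * 2 ^ (2 * (n + t)).
  rewrite expnM; apply: leq_mul; last first.
    by case: (posnP (n + t)) => [-> //|p]; rewrite leq_exp2r.
  by apply: leq_mul => //; apply: ltn_expl.
have p2 : 2 ^ 4 * 2 ^ t * 2 ^ (2 * (n + t)) <= Tower l.
  rewrite -!expnD; apply: leq_trans (Tower_leq gl); rewrite -/m addnS TowerS leq_exp2l //.
  have h : 4 + t + 2 * (n + t) <= 2 ^ 4 * Tower m by lia.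
  apply: leq_trans h _; apply: (@leq_trans (2 ^ (4 + Tower m))).
    by rewrite expnD leq_mul2l /=; apply: ltnW; apply: ltn_expl.
  by rewrite addnS TowerS leq_exp2l // addnC Tower_add.
have := Tower_level_R l; lia.
Qed.

Theorem theorem15 : TOWER_hard (VASS_reach_unary 3).
Proof.
move=> L [g [[M0 [k gM0]] [M LM]]].
(* K is the height of an iterated exponential that yields enough levels for [tower_budget]. The
   first two summands bound g n through the length of the output of [M0]. *)
have [K HK] : elementary_bound (fun n => n + (exp_iter k n).+1 + n + 6).
  apply: (@elementary_leq _ (fun n => n + exp_iter k n + n + 7)) => [n|]; first by lia.
  have ee : elementary_bound (exp_iter k) by exists k.
  do ?[exact: elementary_id | exact: elementary_const | exact: ee | apply: elementary_add].
have gK n : g n + n + 6 <= exp_iter K n.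
  apply: leq_trans (HK n); rewrite !leq_add2r.
  by have := size_computes (nseq n true) gM0; rewrite !size_nseq.
pose I w := reduction_vass (tm_prog M) #|{: cstate M}| (@code M (cstate_pop ord0 true))
  (code (cstate_acc M)) (exp_iter K (size w)) (3 ^ bits_val w).
exists (fun w => enc_inst (I w)); split; first exact: reduction_elementary.
move=> w; have [t [c [tT [run [halt Lc]]]]] := LM w; split=> [/Lc acc|].
  exists (I w); split; first exact: reduction_wf.
  split=> //; have [m [x [R mB]]] := tm_prog_complete run halt acc.
  rewrite bits_val_tape in R; apply: (vass_complete _ R).
  exact: leq_ltn_trans mB (tower_budget tT (gK _)).
case=> J [_ [/enc_inst_inj -> R]].
have [m [x]] := vass_sound (@tm_prog_states M) (code_lt _) (code_lt _) R.
(* The accepting halting configuration found this way is the one that decides w, since a machine has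
   only one halting configuration for each input. *)
rewrite -bits_val_tape => /tm_prog_sound [d [[s sd] dh da]].
by apply/Lc; rewrite (tm_halt_uniq run halt sd dh).
Qed.
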